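(* Let $\mathcal{P}_0\subset\mathcal{P}$ and $\mathcal{H}_0=\mathcal{P}_0\cap\mathcal{H}$. Suppose that for each $P\in\mathcal{P}_0$ there exist deterministic rate functions $g_P,h_P$ tending to zero as $n\to\infty$ and functions $\xi,\xi':[0,1]\times[0,1]^d\to\mathbb{R}$ such that (i) $\|F_{X\mid Z}-\hat F^{(n)}_{X\mid Z}\|_{\mathcal{T},\infty}\in\mathcal{O}_P(g_P(n))$ and $\|F_{Y\mid Z}-\hat F^{(n)}_{Y\mid Z}\|'_{\mathcal{T},\infty}\in\mathcal{O}_P(h_P(n))$; (ii) $\|\xi-\hat F^{(n)}_{X\mid Z}\|_{\mathcal{T}^c,\infty}\in\mathcal{O}_P(g_P(n))$ and $\|\xi'-\hat F^{(n)}_{Y\mid Z}\|'_{\mathcal{T}^c,\infty}\in\mathcal{O}_P(h_P(n))$; and that $\sqrt n\,g_P(n)h_P(n)\to0$ as $n\to\infty$ for each $P\in\mathcal{P}_0$. Then the statistic $\hat\rho_n=\frac1n\sum_{i=1}^n\phi(\hat U_{1,i})\phi(\hat U_{2,i})^T$ satisfies $$\sqrt n\,\hat\rho_n\Rightarrow_P\mathcal{N}(0,\Sigma\otimes\Sigma)$$ for each fixed $P\in\mathcal{H}_0$, where $\Sigma_{k,s}=\int_0^1\phi_k(u)\phi_s(u)\,\mathrm{d}u$ for $k,s=1,\dots,q$; in particular the asymptotic covariance does not depend on $P$.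
   Context: $\mathcal{P}$ is the set of distributions of $(X,Y,Z)$ on $[0,1]^{2+d}$ ($X,Y\in[0,1]$, $Z\in[0,1]^d$) absolutely continuous with respect to Lebesgue measure; $\mathcal{H}\subset\mathcal{P}$ is the subset for which $X$ and $Y$ are conditionally independent given $Z$. Throughout, for every $z$ the conditional distributions of $X$ and of $Y$ given $Z=z$ are continuous. $F_{X\mid Z}(t\mid z)=P(X\le t\mid Z=z)$ and $Q_{X\mid Z}(\tau\mid z)=\inf\{t\in[0,1]:F_{X\mid Z}(t\mid z)\ge\tau\}$; similarly for $Y$. $(X_i,Y_i,Z_i)_{i=1}^n$ is an i.i.d. sample from $P$. An estimator $\hat F^{(n)}_{X\mid Z}$ is a mapping from the sample $(X_i,Z_i)_{i=1}^n$ to functions $\hat F^{(n)}_{X\mid Z}(\cdot\mid z):[0,1]\to[0,1]$ that for every $z\in[0,1]^d$ are continuous and increasing with value $0$ at $0$ and $1$ at $1$; similarly $\hat F^{(n)}_{Y\mid Z}$ is such a mapping from $(Y_i,Z_i)_{i=1}^n$. Put $\hat U_{1,i}=\hat F^{(n)}_{X\mid Z}(X_i\mid Z_i)$ and $\hat U_{2,i}=\hat F^{(n)}_{Y\mid Z}(Y_i\mid Z_i)$. The function $\phi=(\phi_1,\dots,\phi_q):[0,1]\to\mathbb{R}^q$ satisfies: each $\phi_k$ has support $\mathcal{T}_k$ that is a compact subset of $(0,1)$; each $\phi_k$ is Lipschitz continuous; $\int_0^1\phi_k(u)\,\mathrm{d}u=0$ and $\int_0^1\phi_k(u)^2\,\mathrm{d}u=1$;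 $\phi_1,\dots,\phi_q$ are linearly independent. $\tau_{\min}=\inf(\mathcal{T}_1\cup\dots\cup\mathcal{T}_q)$, $\tau_{\max}=\sup(\mathcal{T}_1\cup\dots\cup\mathcal{T}_q)$, $\mathcal{T}=[\tau_{\min},\tau_{\max}]$. $\|f\|_{\mathcal{T},\infty}=\sup_{z\in[0,1]^d}\sup_{t\in Q_{X\mid Z}(\mathcal{T}\mid z)}|f(t,z)|$ with $Q_{X\mid Z}(\mathcal{T}\mid z)=[Q_{X\mid Z}(\tau_{\min}\mid z),Q_{X\mid Z}(\tau_{\max}\mid z)]$, and $\|f\|_{\mathcal{T}^c,\infty}$ is the same with the inner supremum over the complement $[0,1]\setminus Q_{X\mid Z}(\mathcal{T}\mid z)$. $\|\cdot\|'_{\mathcal{T},\infty}$ and $\|\cdot\|'_{\mathcal{T}^c,\infty}$ are defined in the same way with $Q_{Y\mid Z}$ in place of $Q_{X\mid Z}$. $X_n\in\mathcal{O}_P(a_n)$ (for a nonzero sequence $a_n$) means: for every $\epsilon>0$ there is $M>0$ with $\sup_nP(|X_n/a_n|>M)<\epsilon$. $\Rightarrow_P$ is convergence in distribution under $P$. $\mathcal{N}(0,\Sigma\otimes\Sigma)$ on $\mathbb{R}^{q\times q}$ is the centered Gaussian law in which the covariance of entries $(k,\ell)$ and $(s,t)$ is $(\Sigma\otimes\Sigma)_{k\ell,st}=\Sigma_{ks}\Sigma_{\ell t}$. *)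

(* Defs.v *)
From HB Require Import structures.
From mathcomp Require Import all_boot all_order all_algebra.
From mathcomp Require Import all_classical all_reals all_analysis.

Set Implicit Arguments.
Unset Strict Implicit.
Unset Printing Implicit Defensive.

Import Order.TTheory GRing.Theory Num.Theory.
Import numFieldNormedType.Exports.

Local Open Scope classical_set_scope.
Local Open Scope ring_scope.

Notation unitI R := ([set` `[0 : R, 1 : R]]).

(* A value of (X, Y, Z) is ((x, y), z). *)
Notation obs R d := (R%type * R%type * d.-tuple R%type)%type.
Notation law R d := (probability (obs R d) R).

Section classes.
Context {R : realType}.

Definition zcube (d : nat) : set (d.-tuple R) :=
  [set z | forall j, unitI R (tnth z j)].

Definition cube (d : nat) : set (obs R d) :=
  [set w | [/\ unitI R w.1.1, unitI R w.1.2 & zcube w.2]].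

(* Lebesgue measure on R^d as an iterated product; for d = 0 it is the unit
   mass at the empty tuple. *)
Fixpoint lebesgue_tuple (d : nat) : set (d.-tuple R) -> \bar R :=
  if d is d'.+1 then
    pushforward (lebesgue_measure \x @lebesgue_tuple d')%E
      (fun p : R * d'.-tuple R => [tuple of p.1 :: p.2])
  else \d_ [tuple].

Definition lebesgue_obs (d : nat) : set (obs R d) -> \bar R :=
  ((lebesgue_measure \x lebesgue_measure) \x @lebesgue_tuple d)%E.

Definition calP (d : nat) : set (law R d) :=
  [set P | P (@cube d) = 1%E /\ P `<< @lebesgue_obs d].

(* k is a regular conditional distribution of X given Z under P. *)
Definition cond_law d0 d1 d2 (T : measurableType d0) (T1 : measurableType d1)
    (T2 : measurableType d2) (P : probability T R) (X : T -> T1) (Z : T -> T2)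
    (k : R.-pker T2 ~> T1) : Prop :=
  forall A C, measurable A -> measurable C ->
    P (X @^-1` A `&` Z @^-1` C) = (\int[P]_(w in Z @^-1` C) k (Z w) A)%E.

Definition cond_indep d0 d1 d2 d3 (T : measurableType d0)
    (T1 : measurableType d1) (T2 : measurableType d2) (T3 : measurableType d3)
    (P : probability T R) (X : T -> T1) (Y : T -> T2) (Z : T -> T3) : Prop :=
  exists (kX : R.-pker T3 ~> T1) (kY : R.-pker T3 ~> T2),
    [/\ cond_law P X Z kX, cond_law P Y Z kY &
      forall A B C, measurable A -> measurable B -> measurable C ->
        P (X @^-1` A `&` Y @^-1` B `&` Z @^-1` C) =
        (\int[P]_(w in Z @^-1` C) (kX (Z w) A * kY (Z w) B))%E].

Definition calH (d : nat) : set (law R d) :=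
  [set P | calP P /\
    cond_indep P (fun w => w.1.1) (fun w => w.1.2) (fun w => w.2)].

(* Conditional laws are only determined almost everywhere, whereas the norms
   below are suprema over every z; hence a version k is fixed, and it is a
   continuous distribution on [0,1] for every z in the cube. *)
Definition condF (d : nat) (k : R.-pker d.-tuple R ~> R) (t : R) (z : d.-tuple R) : R :=
  fine (k z [set` `]-oo, t]]).

Definition condQ (d : nat) (k : R.-pker d.-tuple R ~> R) (tau : R) (z : d.-tuple R)
    : R :=
  inf [set t | unitI R t /\ tau <= condF k t z].

Definition continuous_cond_law (d : nat) (P : law R d) (X : obs R d -> R)
    (k : R.-pker d.-tuple R ~> R) : Prop :=
  [/\ cond_law P X (fun w => w.2) k,
      forall z, zcube z -> k z (unitI R) = 1%E &
      forall z, zcube z -> continuous (fun t => condF k t z)].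

Definition phi_supp q (phi : R -> 'cV[R]_q) (k : 'I_q) : set R :=
  closure [set u | unitI R u /\ phi u k 0 != 0].

(* Only the values of phi on [0,1] matter. *)
Definition admissible_phi q (phi : R -> 'cV[R]_q) : Prop :=
  [/\ (0 < q)%N,
      forall k, compact (phi_supp phi k) /\
                phi_supp phi k `<=` [set` `]0 : R, 1 : R[],
      forall k, [lipschitz (phi u k 0 : R^o) | u in (unitI R : set R^o)],
      forall k, \int[lebesgue_measure]_(u in unitI R) (phi u k 0) = 0 /\
                \int[lebesgue_measure]_(u in unitI R) (phi u k 0 ^+ 2) = 1 &
      forall c : 'I_q -> R,
        (forall u, unitI R u -> \sum_k c k * phi u k 0 = 0) ->
        forall k, c k = 0].

Definition tau_min q (phi : R -> 'cV[R]_q) : R :=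
  inf (\bigcup_k phi_supp phi k).

Definition tau_max q (phi : R -> 'cV[R]_q) : R :=
  sup (\bigcup_k phi_supp phi k).

Definition gramSigma q (phi : R -> 'cV[R]_q) : 'M[R]_q :=
  \matrix_(k, s) \int[lebesgue_measure]_(u in unitI R) (phi u k 0 * phi u s 0).

Definition quantile_range (d q : nat) (phi : R -> 'cV[R]_q)
    (k : R.-pker d.-tuple R ~> R) (z : d.-tuple R) : set R :=
  [set` `[condQ k (tau_min phi) z, condQ k (tau_max phi) z]].

Definition sup_norm (d : nat) (A : d.-tuple R -> set R) (f : R -> d.-tuple R -> R)
    : \bar R :=
  ereal_sup [set ereal_sup [set `|f t z|%:E | t in A z] | z in @zcube d].

Definition normT (d q : nat) (phi : R -> 'cV[R]_q) (k : R.-pker d.-tuple R ~> R)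
    (f : R -> d.-tuple R -> R) : \bar R :=
  sup_norm (quantile_range phi k) f.

Definition normTc (d q : nat) (phi : R -> 'cV[R]_q) (k : R.-pker d.-tuple R ~> R)
    (f : R -> d.-tuple R -> R) : \bar R :=
  sup_norm (fun z => unitI R `\` quantile_range phi k z) f.

(* Fh n s z t is the value at t of the estimated distribution function given z,
   computed from the sample s of size n.  The last clause is the usual
   requirement that an estimator be measurable, in the minimal form that makes
   the fitted values Fh(X_i | Z_i) measurable functions of the sample. *)
Definition estimator (d : nat)
    (Fh : forall n, n.-tuple (R * d.-tuple R) -> d.-tuple R -> R -> R) : Prop :=
  let samples n := [set s : n.-tuple (R * d.-tuple R) |
    forall i, unitI R (tnth s i).1 /\ zcube (tnth s i).2] in
  (forall n s z, samples n s -> zcube z ->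
    [/\ forall t, unitI R t -> unitI R (Fh n s z t),
        {within unitI R, continuous (Fh n s z)},
        {in `[0, 1] &, {homo Fh n s z : t u / t <= u}},
        Fh n s z 0 = 0 & Fh n s z 1 = 1]) /\
  (forall n (i : 'I_n),
    measurable_fun (samples n) (fun s => Fh n s (tnth s i).2 (tnth s i).1)).

End classes.

(* Independence of W_0, ..., W_(n-1) for every n; taking some of the A_i to be
   full gives the product rule for every finite subfamily. *)
Definition iid_sample {R : realType} d0 d1 (Om : measurableType d0)
    (T : measurableType d1) (Pr : probability Om R) (W : nat -> Om -> T)
    (P : probability T R) : Prop :=
  [/\ forall i, measurable_fun setT (W i),
      forall i A, measurable A -> Pr (W i @^-1` A) = P A &
      forall n (A : 'I_n -> set T), (forall i, measurable (A i)) ->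
        Pr (\bigcap_(i : 'I_n) (W i @^-1` A i)) =
        (\prod_(i < n) Pr (W i @^-1` A i))%E].

(* X_n in O_P(a_n), n >= 1.  Suprema over z need not be measurable, hence the
   outer probability, which is Pr itself on measurable events. *)
Definition bigO_P {R : realType} d0 (Om : measurableType d0)
    (Pr : probability Om R) (X : nat -> Om -> \bar R) (a : nat -> R) : Prop :=
  (forall n, (0 < n)%N -> a n != 0) /\
  forall eps : R, 0 < eps -> exists2 M : R, 0 < M &
    (ereal_sup [set (Pr^*)%mu [set w | M%:E < `|X n w * ((a n)^-1)%:E|]
               | n in [set n | (0 < n)%N]] < eps%:E)%E.

Notation Borel E := (g_sigma_algebraType (@open E)).

Definition cvg_in_law {R : realType} d0 (Om : measurableType d0)
    (E : ptopologicalType) (Pr : probability Om R) (S : nat -> Om -> E)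
    (mu : probability (Borel E) R) : Prop :=
  forall f : E -> R, continuous f -> bounded_fun f ->
    \int[Pr]_w f (S n w) @[n --> \oo] --> \int[mu]_x f x.

(* mu is the law of a centered Gaussian q x q random matrix in which entries
   (k, l) and (s, t) have covariance C k l s t: every linear functional is
   centered normal, N(0, 0) being the Dirac mass at 0 (normal_prob is not
   meaningful for a zero standard deviation). *)
Definition centered_gaussian {R : realType} q
    (C : 'I_q -> 'I_q -> 'I_q -> 'I_q -> R)
    (mu : probability (Borel 'M[R]_q) R) : Prop :=
  (forall A : 'M[R]_q, exists sigma : R, forall B : set R, measurable B ->
     mu [set M : 'M[R]_q | B (\sum_k \sum_l A k l * M k l)] =
     if sigma == 0 then \d_(0 : R) B else normal_prob 0 sigma B) /\
  (forall k l s t,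
     covariance mu (fun M : 'M[R]_q => M k l) (fun M : 'M[R]_q => M s t) =
     (C k l s t)%:E).

Definition tensor_cov {R : realType} q (Sg : 'M[R]_q) (k l s t : 'I_q) : R :=
  Sg k s * Sg l t.

Section statistic.
Context {R : realType} {Om : Type} {d : nat}.
Variables (W : nat -> Om -> obs R d).

Definition sampleXZ n (w : Om) : n.-tuple (R * d.-tuple R) :=
  [tuple ((W i w).1.1, (W i w).2) | i < n].

Definition sampleYZ n (w : Om) : n.-tuple (R * d.-tuple R) :=
  [tuple ((W i w).1.2, (W i w).2) | i < n].

Variables FhX FhY : forall n, n.-tuple (R * d.-tuple R) -> d.-tuple R -> R -> R.

Definition Uhat1 n (i : 'I_n) (w : Om) : R :=
  FhX (sampleXZ n w) (W i w).2 (W i w).1.1.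

Definition Uhat2 n (i : 'I_n) (w : Om) : R :=
  FhY (sampleYZ n w) (W i w).2 (W i w).1.2.

Definition rho_hat q (phi : R -> 'cV[R]_q) n (w : Om) : 'M[R]_q :=
  n%:R^-1 *: \sum_(i < n) phi (Uhat1 i w) *m (phi (Uhat2 i w))^T.

End statistic.

(* Main.v *)
From HB Require Import structures.
Require Import Defs.
From mathcomp Require Import all_boot all_order all_algebra.
From mathcomp Require Import all_classical all_reals all_analysis.
From mathcomp Require Import measurable_realfun ring lra.

(** Write U1 and U2 for the true conditional ranks F(X | Z) and F(Y | Z).  Given
    Z the rank U1 is uniform, because the conditional law is continuous; under
    conditional independence the kernel of X given Z is also the kernel of X
    given (Y, Z), so U1 is uniform and independent of the pair (Y, Z)
    ([rank_uniform_indep]), and symmetrically for U2 and (X, Z).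

    The statistic is expanded around the true ranks.  With a = phi(U1),
    b = phi(U2) and with rank errors D1 = phi(fitted rank) - a and
    D2 = phi(fitted rank) - b, each summand of rho_hat is, entry by entry,
    a b + a D2 + b D1 + D1 D2 ([rank_correlation_clt]).

    - The products a b form an i.i.d. sequence of centred bounded matrices; since U1
      and U2 are independent uniforms, the covariances of the entries are those of
      Sigma (x) Sigma ([exp_score_form_sqr]).
    - The fitted ranks of Y use only the sample of the (Y, Z), of which the ranks
      U1 are independent.  Hence the terms a D2 are uncorrelated, and the second
      moment of their normalized sum is at most a constant times the largest
      second moment of D2, which tends to zero ([exp_sqr_centred_sum],
      [centred_sum_cvg0]).  The terms b D1 are treated in the same way.
    - The normalized sum of the D1 D2 is bounded by sqrt n times the product of
      the two sup-norm errors, which is the rate that is assumed to vanish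
      ([product_errors_cvg0]).

    The bounds on D1 and D2 hold at every observation, although the sup norms that
    enter are taken over the quantile range: outside that range phi vanishes at the
    true rank, and by monotonicity of the estimator the fitted rank either falls
    where phi vanishes or lies within the error of an endpoint
    ([clipped_error]).

    The passage to the limit law uses characteristic functions in real form, as
    expectations of cos (c + <A, M>).  For i.i.d. sums these expectations satisfy
    a recursion, compared with the powers of the normal characteristic function
    [ncf]; that function needs no closed formula, since stability of the normal
    law gives ncf (sqrt (n v)) = ncf (sqrt v) ^ n ([clt_cos]).  Trigonometric
    polynomials approximate bounded continuous functions uniformly on cubes of
    matrices without exceeding their bound ([trigpoly_dense], Bernstein polynomials
    in sines), so that convergence of these expectations and tightness give
    convergence in law ([levy_cvg_in_law]).  The limit is the law of the random
    combination of fixed matrices B with independent standard normal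
    coefficients; the matrices B are the tensor products of the columns of a
    factor A of Sigma = A A^T ([gauss_law_centered], [cholesky],
    [tensor_factor]). *)

Set Implicit Arguments.
Unset Strict Implicit.
Unset Printing Implicit Defensive.

Import Order.TTheory GRing.Theory Num.Theory.
Import numFieldNormedType.Exports.

Local Open Scope classical_set_scope.
Local Open Scope ring_scope.

(** * Expectations of bounded measurable functions *)

Section bounded_measurable.
Context {d : measure_display} {T : measurableType d} {R : realType}.
Implicit Types f g : T -> R.

(** Bounded measurable functions are integrable for every probability and
    closed under the ring operations, so that expectations of such functions can
    be rewritten without integrability side conditions. *)
Definition bmeas f :=
  measurable_fun setT f /\ exists M, forall x, `|f x| <= M.

Lemma bmeas_cst (c : R) : bmeas (fun=> c).
Proof. by split; [exact: measurable_cst|exists `|c|]. Qed.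

Lemma bmeasD f g : bmeas f -> bmeas g -> bmeas (fun x => f x + g x).
Proof.
move=> [mf [M fM]] [mg [N gN]]; split; first exact: measurable_funD.
by exists (M + N) => x; rewrite (le_trans (ler_normD _ _))// lerD.
Qed.

Lemma bmeasM f g : bmeas f -> bmeas g -> bmeas (fun x => f x * g x).
Proof.
move=> [mf [M fM]] [mg [N gN]]; split; first exact: measurable_funM.
by exists (M * N) => x; rewrite normrM ler_pM.
Qed.

Lemma bmeasZ (c : R) f : bmeas f -> bmeas (fun x => c * f x).
Proof. by apply: bmeasM; exact: bmeas_cst. Qed.

Lemma bmeasB f g : bmeas f -> bmeas g -> bmeas (fun x => f x - g x).
Proof.
move=> bf bg; have := bmeasD bf (bmeasZ (-1) bg).
by under eq_fun do rewrite mulN1r.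
Qed.

Lemma bmeasX f n : bmeas f -> bmeas (fun x => f x ^+ n).
Proof.
move=> bf; elim: n => [|n IH].
  by under eq_fun do rewrite expr0; exact: bmeas_cst.
by under eq_fun do rewrite exprS; exact: bmeasM.
Qed.

Lemma bmeas_sum I (s : seq I) (F : I -> T -> R) :
  (forall i, bmeas (F i)) -> bmeas (fun x => \sum_(i <- s) F i x).
Proof.
move=> bF; elim: s => [|i s IH].
  by under eq_fun do rewrite big_nil; exact: bmeas_cst.
by under eq_fun do rewrite big_cons; exact: bmeasD.
Qed.

Lemma bmeas_indic (A : set T) : measurable A -> bmeas (\1_A : T -> R).
Proof.
move=> mA; split; first exact: measurable_indic.
by exists 1 => x; rewrite indicE; case: (_ \in _); rewrite ?normr1 ?normr0.
Qed.

Lemma bmeas_cos f : measurable_fun setT f -> bmeas (fun x => cos (f x)).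
Proof.
move=> mf; split; last by exists 1 => x; exact: cos_max.
by apply: measurableT_comp mf; apply: continuous_measurable_fun; exact: continuous_cos.
Qed.

Lemma bmeas_sin f : measurable_fun setT f -> bmeas (fun x => sin (f x)).
Proof.
move=> mf; split; last by exists 1 => x; exact: sin_max.
by apply: measurableT_comp mf; apply: continuous_measurable_fun; exact: continuous_sin.
Qed.

End bounded_measurable.

Lemma measurable_preim d1 d2 (T1 : measurableType d1) (T2 : measurableType d2)
    (h : T1 -> T2) (A : set T2) :
  measurable_fun setT h -> measurable A -> measurable (h @^-1` A).
Proof. by move=> mh mA; rewrite -[X in measurable X]setTI; exact: mh. Qed.

Lemma bmeas_comp d1 d2 (T1 : measurableType d1) (T2 : measurableType d2)
    (R : realType) (f : T2 -> R) (h : T1 -> T2) :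
  bmeas f -> measurable_fun setT h -> bmeas (fun x => f (h x)).
Proof.
move=> [mf [M fM]] mh; split; last by exists M => x.
exact: measurableT_comp mf mh.
Qed.

Section bounded_expectation.
Context {d : measure_display} {T : measurableType d} {R : realType}.
Variable P : probability T R.
Implicit Types f g : T -> R.

Lemma bmeas_int f : bmeas f -> P.-integrable setT (EFin \o f).
Proof.
move=> [mf [M fM]]; apply: measurable_bounded_integrable => //.
  by rewrite -ge0_fin_numE ?fin_num_measure.
by exists M; split; [exact: num_real|move=> x Mx y _; rewrite /= (le_trans (fM y))// ltW].
Qed.

Lemma expD f g : bmeas f -> bmeas g ->
  \int[P]_x (f x + g x) = \int[P]_x f x + \int[P]_x g x.
Proof. by move=> bf bg; apply: RintegralD => //; exact: bmeas_int. Qed.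

Lemma expB f g : bmeas f -> bmeas g ->
  \int[P]_x (f x - g x) = \int[P]_x f x - \int[P]_x g x.
Proof. by move=> bf bg; apply: RintegralB => //; exact: bmeas_int. Qed.

Lemma expZ (c : R) f : bmeas f -> \int[P]_x (c * f x) = c * \int[P]_x f x.
Proof. by move=> bf; apply: RintegralZl => //; exact: bmeas_int. Qed.

Lemma exp_cst (c : R) : \int[P]_x c = c.
Proof. by rewrite Rintegral_cst// [X in fine X]probability_setT mulr1. Qed.

Lemma exp_le f g : bmeas f -> bmeas g -> (forall x, f x <= g x) ->
  \int[P]_x f x <= \int[P]_x g x.
Proof. by move=> bf bg fg; apply: le_Rintegral => //; exact: bmeas_int. Qed.

Lemma exp_norm_le f : bmeas f -> `|\int[P]_x f x| <= \int[P]_x `|f x|.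
Proof. by move=> bf; apply: le_normr_Rintegral => //; exact: bmeas_int. Qed.

Lemma bmeas_norm f : bmeas f -> bmeas (fun x => `|f x|).
Proof.
move=> [mf [M fM]]; split; first exact: measurableT_comp.
by exists M => x; rewrite normr_id.
Qed.

Lemma exp_normM f M : bmeas f -> (forall x, `|f x| <= M) -> `|\int[P]_x f x| <= M.
Proof.
move=> bf fM; apply: (le_trans (exp_norm_le bf)).
rewrite -[leRHS]exp_cst; apply: exp_le => //; first exact: bmeas_norm.
exact: bmeas_cst.
Qed.

Lemma exp_sum I (s : seq I) (F : I -> T -> R) : (forall i, bmeas (F i)) ->
  \int[P]_x (\sum_(i <- s) F i x) = \sum_(i <- s) \int[P]_x F i x.
Proof.
move=> bF; elim: s => [|i s IH].
  by under eq_Rintegral do rewrite big_nil; rewrite big_nil exp_cst.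
under eq_Rintegral do rewrite big_cons.
by rewrite big_cons expD ?IH//; exact: bmeas_sum.
Qed.

Lemma exp_indic (A : set T) : measurable A ->
  \int[P]_x (\1_A x : R) = fine (P A).
Proof. by move=> mA; rewrite /Rintegral integral_indic// setIT. Qed.

Lemma exp_EFin f : bmeas f -> (\int[P]_x (f x)%:E)%E = (\int[P]_x f x)%:E.
Proof.
by move=> bf; rewrite fineK//; apply: integrable_fin_num => //; exact: bmeas_int.
Qed.

End bounded_expectation.

(** * Taylor bounds for sine and cosine *)

Section trigonometric_bounds.
Context {R : realType}.
Implicit Types x y : R.

Lemma cos_lip x y : `|cos x - cos y| <= `|x - y|.
Proof.
wlog xy : x y / x < y => [H|].
  have [xy|xy|->] := ltgtP x y; [exact: H| |by rewrite !subrr].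
  by rewrite (distrC (cos x)) (distrC x); exact: H.
have [|c _ E] := @MVT_segment R cos (fun x => - sin x) x y (ltW xy) _.
  by apply: continuous_subspaceT; exact: continuous_cos.
rewrite distrC E normrM normrN [in leRHS]distrC.
by rewrite ler_piMl// sin_max.
Qed.

Lemma sin_lip x y : `|sin x - sin y| <= `|x - y|.
Proof.
rewrite -!cosBpihalf (le_trans (cos_lip _ _))//.
by rewrite (_ : _ - _ - _ = x - y)//; ring.
Qed.

Lemma sin_le_norm x : `|sin x| <= `|x|.
Proof. by have := sin_lip x 0; rewrite sin0 !subr0. Qed.

Lemma oneBcosE x : 1 - cos x = 2 * sin (x / 2) ^+ 2.
Proof.
have -> : cos x = cos ((x / 2) *+ 2) by congr cos; rewrite mulr2n; lra.
by rewrite cos_mulr2n sin2cos2 mulr2n; ring.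
Qed.

(** The derivative 1 - cos is at most the square of its argument; the mean value
    theorem gives the cubic bound. *)
Lemma sin_taylor x : `|x - sin x| <= `|x| ^+ 3.
Proof.
wlog x0 : x / 0 < x => [H|].
  have [x0|x0|->] := ltgtP x 0; last by rewrite sin0 subr0 normr0 expr0n.
    have -> : x - sin x = - (- x - sin (- x)) by rewrite sinN; ring.
    by rewrite normrN -(normrN x); apply: H; rewrite oppr_gt0.
  exact: H.
have [|c + +] := @MVT_segment R (fun x => x - sin x) (fun x => 1 - cos x) 0 x (ltW x0) _.
  apply: continuous_subspaceT => z; apply: cvgB; [exact: cvg_id|exact: continuous_sin].
rewrite in_itv/= => /andP[c0 cx]; rewrite sin0 !subr0 => ->.
rewrite oneBcosE normrM [leRHS]exprSr ler_wpM2r// normrM ger0_norm//.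
have : `|sin (c / 2)| <= c / 2.
  by rewrite (le_trans (sin_le_norm _))// ger0_norm// divr_ge0// ltW.
rewrite normrX => h; have : `|sin (c / 2)| ^+ 2 <= (c / 2) ^+ 2.
  by rewrite lerXn2r// nnegrE// divr_ge0.
have : c ^+ 2 <= `|x| ^+ 2.
  by rewrite lerXn2r// ?nnegrE// ger0_norm// ltW.
have : 0 <= c ^+ 2 by exact: sqr_ge0.
by rewrite expr_div_n; lra.
Qed.

(** With y = x / 2 the left-hand side is twice y^2 - sin^2 y, which factors as
    (y - sin y) (y + sin y). *)
Lemma cos_taylor x : `|1 - cos x - x ^+ 2 / 2| <= x ^+ 4.
Proof.
set y := x / 2; have xE : x = 2 * y by rewrite /y; lra.
have -> : 1 - cos x - x ^+ 2 / 2 = - (2 * ((y - sin y) * (y + sin y))).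
  by rewrite oneBcosE -/y xE; lra.
rewrite normrN normrM ger0_norm// normrM.
have h1 := sin_taylor y; have h2 : `|y + sin y| <= 2 * `|y|.
  by rewrite (le_trans (ler_normD _ _))// mulr_natl mulr2n lerD2l sin_le_norm.
apply: (@le_trans _ _ (2 * (`|y| ^+ 3 * (2 * `|y|)))).
  by rewrite ler_wpM2l// ler_pM.
have -> : 2 * (`|y| ^+ 3 * (2 * `|y|)) = 4 * (`|y| ^+ 2) ^+ 2 by ring.
by rewrite real_normK ?num_real// xE; nra.
Qed.

End trigonometric_bounds.

(** * Disintegration along a kernel *)

(** A pi-system generating one factor suffices to generate the product; for
    samples it is the system of rectangles, on which independence is stated. *)
Lemma pi_system_prod d1 d2 (T1 : measurableType d1) (T2 : measurableType d2)
    (G : set (set T2)) : setI_closed G -> measurable = <<s G >> -> G setT ->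
  let C := [set B `*` A | B in G & A in @measurable _ T1] in
  [/\ setI_closed C, @measurable _ (T2 * T1)%type = <<s C >> & C setT].
Proof.
move=> GI mG GT C; split.
- move=> _ _ [B1 GB1 [A1 mA1 <-]] [B2 GB2 [A2 mA2 <-]].
  exists (B1 `&` B2); first exact: GI.
  by exists (A1 `&` A2); [exact: measurableI|rewrite setXI].
- apply/seteqP; split.
    have C_is : sigma_algebra setT <<s C >> by exact: smallest_sigma_algebra.
    apply: smallest_sub => // _ [|] [A mA <-].
    + pose S := [set B : set T2 | <<s C >> (B `*` [set: T1])].
      suff : <<s G >> `<=` S.
        by move=> /(_ A); rewrite -mG setTI => /(_ mA); rewrite /S/= setXT.
      apply: smallest_sub.
        split; rewrite /S/=.
        * by rewrite set0X; case: C_is.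
        * move=> B sB; rewrite setTD; case: C_is => _ + _ => /(_ _ sB).
          congr (<<s C >> _); apply/seteqP; split => -[x y]/=; tauto.
        * move=> F sF; rewrite setX_bigcupl//.
          by case: C_is => _ _; exact.
      move=> B GB; apply: sub_gen_smallest; exists B => //.
      by exists setT.
    + rewrite setTI; apply: sub_gen_smallest; exists setT => //.
      by exists A => //; rewrite setTX.
  apply: smallest_sub; first exact: sigma_algebra_measurable.
  move=> _ [B GB [A mA <-]]; apply: measurableX => //.
  by rewrite mG; apply: sub_gen_smallest.
- by exists setT => //; exists setT => //; rewrite setXTT.
Qed.

Section image_measure.
Context {d1 d2 : measure_display} {T1 : measurableType d1} {T2 : measurableType d2}.
Context {R : realType} (f : T1 -> T2) (mf : measurable_fun setT f).

Section measure.
Variable m : {measure set T1 -> \bar R}.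

Let image : set T2 -> \bar R := pushforward m f.

Let image0 : image set0 = 0%E. Proof. exact: measure0. Qed.

Let image_ge0 A : (0 <= image A)%E. Proof. exact: measure_ge0. Qed.

Let image_sigma_additive : semi_sigma_additive image.
Proof. exact: measure_semi_sigma_additive. Qed.

HB.instance Definition _ := isMeasure.Build _ _ _ image
  image0 image_ge0 image_sigma_additive.

Definition image_measure : {measure set T2 -> \bar R} := image.

End measure.

Section probability.
Variable P : probability T1 R.

Let image : set T2 -> \bar R := image_measure P.

HB.instance Definition _ := Measure.on image.

Let image_setT : image setT = 1%E.
Proof. exact: (probability_setT P). Qed.

HB.instance Definition _ := Measure_isProbability.Build _ _ _ image image_setT.

Definition image_law : probability T2 R := image.

Lemma exp_image_law (g : T2 -> R) : bmeas g ->
  \int[image_law]_y g y = \int[P]_x g (f x).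
Proof.
move=> bg; rewrite /Rintegral; congr fine.
rewrite [LHS]integral_pushforward ?preimage_setT//.
  by apply/measurable_EFinP; case: bg.
exact: (bmeas_int P (bmeas_comp bg mf)).
Qed.

End probability.

End image_measure.

Section pair_kernel.
Context {d1 d2 : measure_display} {T1 : measurableType d1} {T2 : measurableType d2}.
Context {R : realType}.
Variable k : R.-pker T2 ~> T1.

(** The kernel y |-> delta_y x k(y); the dummy unit argument is the parameter
    demanded by composition of kernels. *)
Definition kpair (p : unit * T2) : {measure set (T2 * T1) -> \bar R} :=
  image_measure (measurable_pair1 p.2) (k p.2).

Let mkpair U : measurable U -> measurable_fun [set: unit * T2] (kpair ^~ U).
Proof.
move=> mU; have -> : kpair ^~ U = (fun y => k y (xsection U y)) \o snd.
  by apply/funext => p; rewrite /= /image_measure/= /pushforward xsectionE.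
apply: measurableT_comp => //.
by apply: measurable_fun_xsection_finite_kernel; rewrite inE.
Qed.

HB.instance Definition _ := isKernel.Build _ _ _ _ R kpair mkpair.

Let kpair_prob p : kpair p setT = 1%E.
Proof. exact: (prob_kernel p.2). Qed.

HB.instance Definition _ := Kernel_isProbability.Build _ _ _ _ R kpair kpair_prob.

End pair_kernel.

Section kernel_law.
Context {d1 d2 : measure_display} {T1 : measurableType d1} {T2 : measurableType d2}.
Context {R : realType}.
Variables (k : R.-pker T1 ~> T2) (x : T1).

Let kx : set T2 -> \bar R := k x.

HB.instance Definition _ := Measure.on kx.

HB.instance Definition _ :=
  Measure_isProbability.Build _ _ _ kx (prob_kernel (s := k) x).

(** The measure k x as an element of the type of probabilities. *)
Definition kernel_law : probability T2 R := kx.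

End kernel_law.

Section constant_kernel.
Context {d1 d2 : measure_display} (T1 : measurableType d1) {T2 : measurableType d2}.
Context {R : realType} (P : probability T2 R).

Definition kconst (_ : T1) : {measure set T2 -> \bar R} := P.

Let mkconst U : measurable U -> measurable_fun [set: T1] (kconst ^~ U).
Proof. by move=> mU; exact: measurable_cst. Qed.

HB.instance Definition _ := isKernel.Build _ _ _ _ R kconst mkconst.

Let kconst_prob p : kconst p setT = 1%E.
Proof. exact: probability_setT. Qed.

HB.instance Definition _ := Kernel_isProbability.Build _ _ _ _ R kconst kconst_prob.

End constant_kernel.
Arguments kconst {d1 d2} T1 {T2 R} P.

Section kernel_precomposition.
Context {d1 d2 d3 : measure_display} {T1 : measurableType d1}.
Context {T2 : measurableType d2} {T3 : measurableType d3} {R : realType}.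
Variables (k : R.-pker T2 ~> T3) (h : T1 -> T2) (mh : measurable_fun setT h).

Let kh (x : T1) : {measure set T3 -> \bar R} := k (h x).

Let mkh U : measurable U -> measurable_fun setT (kh ^~ U).
Proof. by move=> mU; apply: measurableT_comp (measurable_kernel k _ mU) _. Qed.

HB.instance Definition _ := isKernel.Build _ _ _ _ R kh mkh.

Let kh_prob p : kh p setT = 1%E. Proof. exact: (prob_kernel (h p)). Qed.

HB.instance Definition _ := Kernel_isProbability.Build _ _ _ _ R kh kh_prob.

Definition kernel_pre : R.-pker T1 ~> T3 := kh.

End kernel_precomposition.

Section disintegration.
Context {d0 d1 d2 : measure_display} {Om : measurableType d0}.
Context {T1 : measurableType d1} {T2 : measurableType d2} {R : realType}.
Variables (Pr : probability Om R) (U : Om -> T1) (V : Om -> T2).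
Hypotheses (mU : measurable_fun setT U) (mV : measurable_fun setT V).
Variable k : R.-pker T2 ~> T1.
Variable G : set (set T2).
Hypotheses (GI : setI_closed G) (mG : measurable = <<s G >>) (GT : G setT).
Hypothesis cond : forall A B, measurable A -> G B ->
  Pr (U @^-1` A `&` V @^-1` B) = (\int[Pr]_(w in V @^-1` B) k (V w) A)%E.

Let mVU : measurable_fun setT (fun w => (V w, U w)).
Proof. exact: measurable_fun_pair. Qed.

Let joint : {measure set (T2 * T1) -> \bar R} := image_law mVU Pr.

Let mixed : {measure set (T2 * T1) -> \bar R} :=
  kcomp (kconst unit (image_law mV Pr)) (kpair k) tt.

Let jointE S : measurable S -> joint S = mixed S.
Proof.
have [CI mC CT] := pi_system_prod T1 GI mG GT.
apply: (measure_unique _ (fun=> setT) mC CI) => //.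
- by rewrite bigcup_const//; exists 0%N.
- move=> _ [B GB [A mA <-]].
  have mB : measurable B by rewrite mG; exact: sub_gen_smallest.
  rewrite /joint/mixed/= /pushforward.
  rewrite [X in Pr X](_ : _ = U @^-1` A `&` V @^-1` B); last first.
    by apply/seteqP; split => w/= [].
  have mk : measurable_fun setT (fun y => kpair k (tt, y) (B `*` A)).
    exact: (measurableT_comp (measurable_kernel (kpair k) _ (measurableX mB mA))
      (pair1_measurable tt)).
  have k0 : {in [set: T2], forall y, (0 <= kpair k (tt, y) (B `*` A))%E}.
    by move=> y _; exact: measure_ge0.
  rewrite cond// /kcomp/= [RHS](ge0_integral_pushforward mV _ measurableT mk k0)/=.
  rewrite [LHS]integral_mkcond; apply: eq_integral => w _ /=.
  rewrite patchE /= /pushforward; case: ifPn => [|] /=; rewrite ?inE ?notin_setE/= => Vw.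
    by congr (k _ _); apply/seteqP; split => x //= [].
  rewrite [X in k _ X](_ : _ = set0) ?measure0//.
  by apply/seteqP; split => x //= [].
- by move=> _; rewrite -ge0_fin_numE ?fin_num_measure.
Qed.

(** Both sides integrate f, against the law of (V, U) and against the mixture of
    the k y over the law of V.  These two measures agree on a generating
    pi-system, hence everywhere. *)
Lemma ge0_disintegration (f : T2 * T1 -> \bar R) :
  measurable_fun setT f -> (forall p, (0 <= f p)%E) ->
  (\int[Pr]_w f (V w, U w) = \int[Pr]_w \int[k (V w)]_u f (V w, u))%E.
Proof.
move=> mf f0.
transitivity (\int[joint]_p f p)%E.
  by rewrite /joint [RHS]ge0_integral_pushforward//; apply: eq_integral.
rewrite (eq_measure_integral mixed); last by move=> S mS _; exact: jointE.
have kf y : (\int[kpair k (tt, y)]_p f p = \int[k y]_u f (y, u))%E.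
  by rewrite [LHS]ge0_integral_pushforward.
rewrite integral_kcomp//; under [LHS]eq_integral do rewrite kf.
rewrite [LHS]ge0_integral_pushforward//.
- exact: (measurable_fun_integral_finite_kernel f k).
- by move=> y _; exact: integral_ge0.
Qed.

Lemma disintegration (f : T2 * T1 -> R) : bmeas f ->
  bmeas (fun v => \int[k v]_u f (v, u)) /\
  \int[Pr]_w f (V w, U w) = \int[Pr]_w \int[k (V w)]_u f (V w, u).
Proof.
move=> bf; have [mf [M fM]] := bf.
have bfv v : bmeas (fun u => f (v, u)).
  by apply: (bmeas_comp bf); exact: pair1_measurable.
(* The values of f are shifted by M to reduce to the nonnegative case. *)
have shift v : \int[k v]_u f (v, u) =
    fine (\int[k v]_u (f (v, u) + M)%:E)%E - M.
  apply/eqP; rewrite eq_sym subr_eq; apply/eqP.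
  by have := expD (kernel_law k v) (bfv v) (bmeas_cst M); rewrite exp_cst.
have fM0 p : (0 <= (f p + M)%:E)%E.
  by rewrite lee_fin -lerBlDr sub0r; have := fM p; rewrite ler_norml => /andP[].
have bfM : bmeas (fun p => f p + M) by apply: bmeasD => //; exact: bmeas_cst.
have mfM : measurable_fun setT (fun p => (f p + M)%:E).
  by apply/measurable_EFinP; case: bfM.
have bk : bmeas (fun v => \int[k v]_u f (v, u)).
  split; last first.
    by exists M => v; exact: (exp_normM (kernel_law k v) (bfv v)).
  under eq_fun do rewrite shift.
  apply: measurable_funB => //; apply: measurableT_comp => //.
  exact: (measurable_fun_integral_finite_kernel (fun p => (f p + M)%:E) k).
split => //; apply: (addIr M).
have -> : \int[Pr]_w f (V w, U w) + M = \int[Pr]_w (f (V w, U w) + M).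
  by rewrite expD ?exp_cst//; [exact: (bmeas_comp bf)|exact: bmeas_cst].
have -> : \int[Pr]_w (\int[k (V w)]_u f (V w, u)) + M =
    \int[Pr]_w (\int[k (V w)]_u f (V w, u) + M).
  by rewrite expD ?exp_cst//; [exact: (bmeas_comp bk)|exact: bmeas_cst].
congr fine; rewrite [LHS](ge0_disintegration mfM fM0).
apply: eq_integral => w _; rewrite shift subrK.
have bw : bmeas (fun u => f (V w, u) + M) by apply: bmeasD => //; exact: bmeas_cst.
exact: (exp_EFin (kernel_law k (V w)) bw).
Qed.

End disintegration.

Section independence.
Context {d0 d1 d2 : measure_display} {Om : measurableType d0}.
Context {T1 : measurableType d1} {T2 : measurableType d2} {R : realType}.
Variables (Pr : probability Om R) (U : Om -> T1) (V : Om -> T2).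
Hypotheses (mU : measurable_fun setT U) (mV : measurable_fun setT V).
Variable nu : probability T1 R.
Variable G : set (set T2).
Hypotheses (GI : setI_closed G) (mG : measurable = <<s G >>) (GT : G setT).
Hypothesis ind : forall A B, measurable A -> G B ->
  Pr (U @^-1` A `&` V @^-1` B) = (nu A * Pr (V @^-1` B))%E.

(** Independence is disintegration along a constant kernel. *)
Lemma exp_indepE (f : T1 -> R) (g : T2 -> R) : bmeas f -> bmeas g ->
  \int[Pr]_w (f (U w) * g (V w)) = (\int[nu]_u f u) * \int[Pr]_w g (V w).
Proof.
move=> bf bg.
have cond A B : measurable A -> G B ->
    Pr (U @^-1` A `&` V @^-1` B) =
    (\int[Pr]_(w in V @^-1` B) kconst T2 nu (V w) A)%E.
  move=> mA GB; rewrite ind// integral_cst//.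
  by rewrite -[X in measurable X]setTI; apply: mV => //; rewrite mG; exact: sub_gen_smallest.
have bfg : bmeas (fun p : T2 * T1 => f p.2 * g p.1).
  by apply: bmeasM; [exact: (bmeas_comp bf)|exact: (bmeas_comp bg)].
have [_ ->] := disintegration mU mV GI mG GT cond bfg.
transitivity (\int[Pr]_w ((\int[nu]_u f u) * g (V w))).
  apply: eq_Rintegral => w _ /=.
  rewrite mulrC -(expZ nu (g (V w)) bf).
  by apply: eq_Rintegral => u _ /=; rewrite mulrC.
by rewrite expZ//; exact: (bmeas_comp bg).
Qed.

End independence.

(** * Conditional distribution functions and uniform ranks *)

Section ray_laws.
Context {R : realType}.

(** Uniqueness of measures on the pi-system of open right rays, which are the
    complements of the given ones. *)
Lemma eq_prob_rays (P1 P2 : probability R R) :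
  (forall x, P1 `]-oo, x]%classic = P2 `]-oo, x]%classic) ->
  forall A, measurable A -> P1 A = P2 A.
Proof.
move=> P12 A mA.
apply: (@measure_unique _ R R (RGenOInfty.G (R := R)) (fun n => `]- n%:R, +oo[%classic)
  _ _ _ _ P1 P2) => //.
- exact: RGenOInfty.measurableE.
- move=> _ _ [x ->] [y ->]; exists (Num.max x y).
  by apply/seteqP; split => z /=; rewrite !in_itv/= !andbT gt_max => /andP.
- by move=> n; exists (- n%:R).
- apply/seteqP; split => // x _; exists (Num.truncn `|x|).+1 => //=.
  rewrite in_itv/= andbT.
  by have := truncnS_gt `|x|; rewrite ltr_norml => /andP[].
- move=> _ [x ->]; rewrite -setCitvl !probability_setC//.
  by rewrite P12.
- by move=> n; rewrite -ge0_fin_numE ?fin_num_measure.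
Qed.

Let idR : measurableTypeR R -> R := idfun.

Let measurable_idR : measurable_fun setT idR.
Proof. by move=> _ A mA; rewrite setTI. Qed.

(** The Borel sigma-algebra on R is carried by two different structures; this
    transports a probability between them. *)
Definition real_law (P : probability (measurableTypeR R) R) : probability R R :=
  image_law measurable_idR P.

Lemma exp_real_law P (f : R -> R) : bmeas f ->
  \int[real_law P]_x f x = \int[P]_x f x.
Proof. exact: exp_image_law. Qed.

Definition unif01 : probability R R := real_law (uniform_prob (@ltr01 R)).

Lemma exp_unif01 (f : R -> R) : bmeas f ->
  \int[unif01]_u f u = \int[lebesgue_measure]_(u in unitI R) f u.
Proof.
move=> bf; have [mf [M fM]] := bf; rewrite exp_real_law//.
have fM0 x : 0 <= f x + M.
  by rewrite -lerBlDr sub0r; have := fM x; rewrite ler_norml => /andP[].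
have bfM : bmeas (fun p => f p + M) by apply: bmeasD => //; exact: bmeas_cst.
have E : \int[uniform_prob (@ltr01 R)]_x (f x + M) =
         \int[lebesgue_measure]_(u in unitI R) (f u + M).
  congr fine; rewrite integral_uniform ?subr0 ?invr1 ?mul1e//.
  by apply/measurable_EFinP; case: bfM.
suff : \int[uniform_prob (@ltr01 R)]_x f x + M =
  \int[lebesgue_measure]_(u in unitI R) f u + M by move/addIr.
have -> : \int[uniform_prob (@ltr01 R)]_x f x + M =
          \int[uniform_prob (@ltr01 R)]_x (f x + M).
  by rewrite expD ?exp_cst//; exact: bmeas_cst.
have mfI : measurable_fun (unitI R : set (measurableTypeR R)) f.
  exact: (measurable_funTS (measurableT_comp mf measurable_idR)).
have leb01 : lebesgue_measure (unitI R) = 1%E.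
  by rewrite lebesgue_measure_itv/= lte_fin ltr01 oppr0 adde0.
rewrite E RintegralD//.
- by rewrite Rintegral_cst// [X in fine X]leb01 mulr1.
- apply: (measurable_bounded_integrable _ _ mfI) => //.
    by rewrite [X in (X < _)%E]leb01 ltry.
  by exists M; split; [exact: num_real|move=> x Mx y _; rewrite /= (le_trans (fM y))// ltW].
- apply: measurable_bounded_integrable => //.
    by rewrite [X in (X < _)%E]leb01 ltry.
  by exists `|M|; split; [exact: num_real|move=> x Mx y _; rewrite /= ltW].
Qed.

End ray_laws.

Section conditional_cdf.
Context {R : realType} {d : nat}.
Variable k : R.-pker d.-tuple R ~> R.
Implicit Types (t : R) (z : d.-tuple R).

Lemma condF_ge0 t z : 0 <= condF k t z.
Proof. exact: fine_ge0. Qed.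

Lemma condF_le1 t z : condF k t z <= 1.
Proof.
rewrite -lee_fin fineK; first exact: (probability_le1 (kernel_law k z)).
exact: (fin_num_measure (kernel_law k z)).
Qed.

Lemma condF_homo z : {homo (condF k ^~ z) : t u / t <= u}.
Proof.
move=> t u tu; apply: fine_le; try exact: (fin_num_measure (kernel_law k z)).
apply: le_measure; rewrite ?inE//; apply: subset_itvl; exact: tu.
Qed.

(** The value is the k-measure of a section of the half-plane below the diagonal,
    which is jointly measurable. *)
Lemma measurable_condF : measurable_fun [set: d.-tuple R * R] (fun p => condF k p.2 p.1).
Proof.
pose A := [set q : (d.-tuple R * R) * R | q.2 <= q.1.2].
have mA : measurable A.
  rewrite -[A]setTI; apply: measurable_fun_le => //.
  exact: measurableT_comp.
apply: measurableT_comp => //.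
have -> : (fun p : d.-tuple R * R => k p.1 [set` `]-oo, p.2]]) =
          (fun p => kernel_pre k measurable_fst p (xsection A p)).
  apply/funext => p; rewrite /= xsectionE; congr (k _ _).
by apply: measurable_fun_xsection_finite_kernel; rewrite inE.
Qed.

Variable z : d.-tuple R.
Hypothesis kz01 : k z (unitI R) = 1%E.
Hypothesis cF : continuous (fun t => condF k t z).

Lemma condF_le0 t : t <= 0 -> condF k t z = 0.
Proof.
have F0 s : s < 0 -> condF k s z = 0.
  move=> s0; rewrite /condF.
  suff -> : k z `]-oo, s]%classic = 0%E by [].
  apply/eqP; rewrite eq_le measure_ge0 andbT.
  have <- : k z (~` unitI R) = 0%E.
    have := probability_setC (kernel_law k z) (measurable_itv `[0 : R, 1]).
    by rewrite [X in (1 - X)%E]kz01 subee.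
  apply: le_measure; rewrite ?inE//; first exact: measurableC.
  by move=> x/=; rewrite !in_itv/= => xs /andP[]; lra.
rewrite le_eqVlt => /predU1P[->|]; last exact: F0.
apply/eqP; rewrite eq_le condF_ge0 andbT.
apply/ler_addgt0Pl => e e0; rewrite addr0.
have /cvgrPdist_lt /(_ e e0) := cF (x := 0).
move=> /nbhs_ballP[r /= r0 /(_ (- (r / 2)))].
rewrite /ball/= sub0r opprK ger0_norm; last by rewrite ltW// divr_gt0.
rewrite (F0 (- (r / 2))); last by rewrite oppr_lt0 divr_gt0.
rewrite subr0 ger0_norm ?condF_ge0// => H; apply/ltW/H; lra.
Qed.

Lemma condF_ge1 t : 1 <= t -> condF k t z = 1.
Proof.
move=> t1; rewrite /condF.
suff -> : k z `]-oo, t]%classic = 1%E by [].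
apply/eqP; rewrite eq_le; apply/andP; split.
  exact: (probability_le1 (kernel_law k z)).
rewrite -kz01; apply: le_measure; rewrite ?inE// => x/=.
by rewrite !in_itv/= => /andP[_ x1]; exact: le_trans x1 t1.
Qed.

Lemma condF_surj u : 0 <= u <= 1 -> exists2 t, 0 <= t <= 1 & condF k t z = u.
Proof.
move=> u01.
have [||t] := @IVT R (fun t => condF k t z) 0 1 u ler01.
- exact: continuous_subspaceT.
- by rewrite condF_le0// condF_ge1//; rewrite min_l ?max_r ?ler01.
by rewrite in_itv/=; exists t.
Qed.

(** By continuity the sublevel set is a closed left ray, and the distribution
    function takes the value u at its endpoint. *)
Lemma condF_sublevel u : 0 <= u <= 1 ->
  k z [set t | condF k t z <= u] = u%:E.
Proof.
move=> /andP[u0]; rewrite le_eqVlt => /predU1P[->|u1].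
  rewrite (_ : [set _ | _] = setT) ?prob_kernel//.
  by apply/seteqP; split => // t _ /=; exact: condF_le1.
have [s /andP[s0 s1] Fs] := condF_surj (introT andP (conj u0 (ltW u1))).
set A := [set t | _]; have As : A s by rewrite /A/= Fs.
have ubA : has_ubound A.
  exists 1 => t; rewrite /A/= => tu; rewrite leNgt; apply/negP => /ltW t1.
  by move: tu; rewrite (condF_ge1 t1) leNgt u1.
have clA : closed A.
  by apply: (@closed_comp _ _ (fun t => condF k t z) [set x | x <= u]) => //; exact: closed_le.
have AS : A (sup A).
  have := closure_sup (ex_intro _ s As) ubA.
  by move/closure_id : clA => <-.
have -> : A = `]-oo, sup A]%classic.
  apply/seteqP; split => t /=; rewrite in_itv/=; first exact: ub_le_sup.
  by move=> tS; rewrite /A/= (le_trans (condF_homo z tS)).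
rewrite -[LHS]fineK; last exact: (fin_num_measure (kernel_law k z)).
congr EFin; apply/eqP; rewrite eq_le [X in X && _]AS/= -Fs.
by apply: (condF_homo z); exact: ub_le_sup.
Qed.

(** The probability integral transform for the law k z. *)
Lemma condF_uniform A : measurable A ->
  k z ((condF k ^~ z) @^-1` A) = unif01 A.
Proof.
have mF : measurable_fun setT (condF k ^~ z) by exact: continuous_measurable_fun.
move=> mA.
suff rays u : image_law mF (kernel_law k z) `]-oo, u]%classic =
              unif01 `]-oo, u]%classic.
  exact: (eq_prob_rays rays mA).
rewrite /= /pushforward [LHS](_ : _ = k z [set t | condF k t z <= u]); last first.
  by congr (k z _); apply/seteqP; split => t/=; rewrite in_itv.
transitivity (uniform_prob (@ltr01 R) `]-oo, u]%classic); last by [].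
rewrite /uniform_prob integral_uniform_pdf.
have [u0|u0] := ltP u 0.
  rewrite (_ : _ `&` _ = set0) ?integral_set0; last first.
    by apply/seteqP; split => t//=; rewrite !in_itv/= => -[] ? /andP[]; lra.
  rewrite (_ : [set _ | _] = set0) ?measure0//; apply/seteqP; split => t//=.
  by rewrite leNgt (lt_le_trans u0)// condF_ge0.
have [u1|u1] := ltP 1 u.
  rewrite (_ : _ `&` _ = `[0, 1]%classic); last first.
    apply/seteqP; split => t/=; rewrite !in_itv/=; first by case.
    by move=> t01; split => //; case/andP: t01 => _ /le_trans; apply; exact: ltW.
  rewrite integral_uniform_pdf1// (_ : [set _ | _] = setT) ?prob_kernel//.
  by apply/seteqP; split => // t _ /=; rewrite (le_trans (condF_le1 _ _))// ltW.
rewrite condF_sublevel ?u0//.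
rewrite (_ : _ `&` _ = `[0, u]%classic); last first.
  apply/seteqP; split => t/=; rewrite !in_itv/=.
    by move=> [tu /andP[t0 t1]]; rewrite t0 tu.
  by move=> /andP[t0 tu]; rewrite t0 tu; split => //; exact: le_trans tu u1.
rewrite (eq_integral (cst 1%E)); last first.
  move=> t; rewrite inE/= in_itv/= => /andP[t0 tu].
  by rewrite /uniform_pdf t0 (le_trans tu u1) subr0 invr1.
rewrite integral_cst//= lebesgue_measure_itv/= lte_fin mul1e.
by move: u0; rewrite le_eqVlt => /predU1P[<-|->]; rewrite ?ltxx// oppr0 adde0.
Qed.

End conditional_cdf.

(** * Ranks under conditional independence *)

Lemma sigma_algebra_self d (T : measurableType d) :
  @measurable _ T = <<s @measurable _ T >>.
Proof.
apply/seteqP; split; first exact: sub_gen_smallest.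
by apply: smallest_sub => //; exact: sigma_algebra_measurable.
Qed.

Section kernel_values.
Context {d1 d2 : measure_display} {T1 : measurableType d1} {T2 : measurableType d2}.
Context {R : realType}.
Variable k : R.-pker T1 ~> T2.

Lemma fineK_kernel x A : measurable A -> (fine (k x A))%:E = k x A.
Proof. by move=> mA; rewrite fineK//; exact: (fin_num_measure (kernel_law k x)). Qed.

Lemma bmeas_kernel A : measurable A -> bmeas (fun x => fine (k x A)).
Proof.
move=> mA; split; first by apply: measurableT_comp => //; exact: measurable_kernel.
exists 1 => x; rewrite ger0_norm ?fine_ge0//.
by rewrite -lee_fin fineK_kernel//; exact: (probability_le1 (kernel_law k x)).
Qed.

End kernel_values.

Section set_integral.
Context {d : measure_display} {T : measurableType d} {R : realType}.
Variable P : probability T R.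

Lemma integral_exp_indic (D : set T) (g : T -> \bar R) (f : T -> R) :
  measurable D -> bmeas f -> (forall x, g x = (f x)%:E) ->
  (\int[P]_(x in D) g x = (\int[P]_x (\1_D x * f x))%:E)%E.
Proof.
move=> mD bf gf; rewrite -exp_EFin; last by apply: bmeasM => //; exact: bmeas_indic.
rewrite integral_mkcond; apply: eq_integral => x _.
by rewrite patchE indicE; case: ifPn => _; rewrite ?mul1r ?mul0r.
Qed.

Lemma prob_exp_indic (D : set T) : measurable D -> P D = (\int[P]_x \1_D x)%:E.
Proof. by move=> mD; rewrite exp_indic// fineK// fin_num_measure. Qed.

End set_integral.

Lemma indic_setIE T (R : realType) (A B : set T) x : \1_(A `&` B) x = \1_A x * \1_B x :> R.
Proof. by rewrite indicI. Qed.

Lemma cond_law_exp d0 d1 d3 (T : measurableType d0) (TX : measurableType d1)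
    (TZ : measurableType d3) (R : realType) (P : probability T R)
    (X : T -> TX) (Z : T -> TZ) (k : R.-pker TZ ~> TX) (A : set TX) (h : TZ -> R) :
  measurable_fun setT X -> measurable_fun setT Z ->
  cond_law P X Z k -> measurable A -> bmeas h ->
  \int[P]_w (h (Z w) * \1_A (X w)) = \int[P]_w (h (Z w) * fine (k (Z w) A)).
Proof.
move=> mX mZ ck mA bh.
have bf : bmeas (fun p : TZ * TX => h p.1 * \1_A p.2).
  apply: bmeasM; first exact: (bmeas_comp bh).
  exact: (bmeas_comp (bmeas_indic mA)).
have GI : setI_closed (@measurable _ TZ) by move=> *; exact: measurableI.
have [_ ->] := disintegration mX mZ GI (sigma_algebra_self TZ) measurableT ck bf.
apply: eq_Rintegral => w _ /=.
have E := expZ (kernel_law k (Z w)) (h (Z w)) (bmeas_indic mA).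
by rewrite exp_indic in E.
Qed.

(** Conditioning on (Y, Z) instead of Z does not change the kernel of X.  The
    kernels witnessing conditional independence need not be the given version k,
    but each is only seen through integrals against functions of Z, where two
    versions agree. *)
Lemma cond_indep_law d0 d1 d2 d3 (T : measurableType d0) (TX : measurableType d1)
    (TY : measurableType d2) (TZ : measurableType d3) (R : realType)
    (P : probability T R) (X : T -> TX) (Y : T -> TY) (Z : T -> TZ)
    (k : R.-pker TZ ~> TX) (A : set TX) (B : set TY) (C : set TZ) :
  measurable_fun setT X -> measurable_fun setT Y -> measurable_fun setT Z ->
  cond_indep P X Y Z -> cond_law P X Z k ->
  measurable A -> measurable B -> measurable C ->
  P (X @^-1` A `&` (Y @^-1` B `&` Z @^-1` C)) =
  (\int[P]_(w in Y @^-1` B `&` Z @^-1` C) k (Z w) A)%E.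
Proof.
move=> mX mY mZ [k1 [k2 [ck1 ck2 cXY]]] ck mA mB mC.
have bC := bmeas_indic (R := R) mC; have bB := bmeas_indic (R := R) mB.
have bA := bmeas_kernel k mA; have bA1 := bmeas_kernel k1 mA.
have bB2 := bmeas_kernel k2 mB.
have mYB : measurable (Y @^-1` B) by exact: (measurable_preim mY).
have mZC : measurable (Z @^-1` C) by exact: (measurable_preim mZ).
rewrite setIA cXY//.
rewrite (integral_exp_indic P mZC (bmeas_comp (bmeasM bA1 bB2) mZ)); last first.
  by move=> w; rewrite EFinM !fineK_kernel.
rewrite (integral_exp_indic P (measurableI _ _ mYB mZC) (bmeas_comp bA mZ)); last first.
  by move=> w; rewrite fineK_kernel.
congr EFin.
have E1 := cond_law_exp mX mZ ck1 mA (bmeasM bC bB2).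
have E2 := cond_law_exp mX mZ ck mA (bmeasM bC bB2).
have E3 := cond_law_exp mY mZ ck2 mB (bmeasM bC bA).
transitivity (\int[P]_w (\1_C (Z w) * fine (k2 (Z w) B) * fine (k1 (Z w) A))).
  by apply: eq_Rintegral => w _; rewrite -mulrA; congr (_ * _); rewrite mulrC.
(* One kernel is exchanged for another by testing the law of X against the
   conditional probability of B, and back. *)
rewrite -E1 E2.
transitivity (\int[P]_w (\1_C (Z w) * fine (k (Z w) A) * fine (k2 (Z w) B))).
  by apply: eq_Rintegral => w _; rewrite mulrAC.
rewrite -E3; apply: eq_Rintegral => w _.
by rewrite indic_setIE -[\1_C (Z w)]/(\1_(Z @^-1` C) w) -[\1_B (Y w)]/(\1_(Y @^-1` B) w); ring.
Qed.

Section rank_independence.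
Context {R : realType} {d : nat} {d0 d2 : measure_display} {T : measurableType d0}.
Context {TY : measurableType d2}.
Variables (P : probability T R) (X : T -> R) (Y : T -> TY) (Z : T -> d.-tuple R).
Hypotheses (mX : measurable_fun setT X) (mY : measurable_fun setT Y).
Hypothesis mZ : measurable_fun setT Z.
Variable k : R.-pker d.-tuple R ~> R.
Hypotheses (ci : cond_indep P X Y Z) (ck : cond_law P X Z k).
Variable D : set (d.-tuple R).
Hypotheses (mD : measurable D) (PD : P (Z @^-1` D) = 1%E).
Hypothesis k01 : forall z, D z -> k z (unitI R) = 1%E.
Hypothesis kcont : forall z, D z -> continuous (fun t => condF k t z).

(** Disintegrating X along (Y, Z) reduces the claim to the conditional rank of X
    for a fixed z, which is uniform whatever z in D is. *)
Lemma rank_uniform_indep (A : set R) (B : set (TY * d.-tuple R)) :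
  measurable A -> measurable B ->
  P ((fun w => condF k (X w) (Z w)) @^-1` A `&` (fun w => (Y w, Z w)) @^-1` B) =
  (unif01 A * P ((fun w => (Y w, Z w)) @^-1` B))%E.
Proof.
move=> mA mB.
have mV : measurable_fun setT (fun w => (Y w, Z w)) by exact: measurable_fun_pair.
pose rect := [set B0 `*` C0 | B0 in @measurable _ TY & C0 in @measurable _ (d.-tuple R)].
have GI : setI_closed rect.
  move=> _ _ [B1 mB1 [C1 mC1 <-]] [B2 mB2 [C2 mC2 <-]].
  exists (B1 `&` B2); first exact: measurableI.
  by exists (C1 `&` C2); [exact: measurableI|rewrite setXI].
have GT : rect setT by exists setT => //; exists setT => //; rewrite setXTT.
have cond A' B' : measurable A' -> rect B' ->
    P (X @^-1` A' `&` (fun w => (Y w, Z w)) @^-1` B') =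
    (\int[P]_(w in (fun w => (Y w, Z w)) @^-1` B')
       kernel_pre k (@measurable_snd _ _ _ (d.-tuple R)) (Y w, Z w) A')%E.
  move=> mA' [B1 mB1 [C1 mC1 <-]].
  exact: (cond_indep_law mX mY mZ ci ck mA' mB1 mC1).
pose F (p : (TY * d.-tuple R) * R) : R := condF k p.2 p.1.2.
have mF : measurable_fun setT F.
  have mh : measurable_fun setT (fun p : (TY * d.-tuple R) * R => (p.1.2, p.2)).
    by apply: measurable_fun_pair => //; exact: measurableT_comp.
  exact: (measurableT_comp (measurable_condF k) mh).
pose f (p : (TY * d.-tuple R) * R) : R := \1_(B `&` (snd @^-1` D)) p.1 * \1_A (F p).
have mBD : measurable (B `&` (snd @^-1` D)).
  apply: measurableI => //; rewrite -[X in measurable X]setTI.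
  exact: measurable_snd.
have bf : bmeas f.
  apply: bmeasM; first exact: (bmeas_comp (bmeas_indic mBD)).
  exact: (bmeas_comp (bmeas_indic mA)).
have [_ E] := disintegration mX mV GI (measurable_prod_measurableType _ _) GT cond bf.
(* The kernel is only controlled over D, whose complement is null. *)
have PI S : measurable S -> P S = P (S `&` Z @^-1` D).
  move=> mS; have mZD : measurable (Z @^-1` D).
    exact: (measurable_preim mZ).
  have PZ0 : P (~` (Z @^-1` D)) = 0%E.
    by rewrite probability_setC// [X in (_ - X)%E]PD subee.
  have PS0 : P (S `\` (Z @^-1` D)) = 0%E.
    apply/eqP; rewrite eq_le measure_ge0 andbT -PZ0.
    apply: le_measure; rewrite ?inE; [exact: measurableD|exact: measurableC|].
    by move=> w [].
  by rewrite (measureDI P mS mZD) [X in (X + _)%E]PS0 add0e.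
have mVB : measurable ((fun w => (Y w, Z w)) @^-1` B).
  exact: (measurable_preim mV).
have mVBD : measurable ((fun w => (Y w, Z w)) @^-1` (B `&` snd @^-1` D)).
  exact: (measurable_preim mV).
have mVX : measurable_fun setT (fun w => ((Y w, Z w), X w)).
  exact: measurable_fun_pair.
have mFA : measurable ((fun w => condF k (X w) (Z w)) @^-1` A).
  exact: (measurable_preim (measurableT_comp mF mVX)).
rewrite PI; last exact: measurableI.
rewrite (PI ((fun w => (Y w, Z w)) @^-1` B))//.
rewrite -setIA [in LHS]prob_exp_indic; last exact: measurableI.
rewrite [X in (X * _)%E](prob_exp_indic unif01 mA) [X in (_ * X)%E]prob_exp_indic//.
rewrite -EFinM; congr EFin; rewrite -expZ; last exact: bmeas_indic.
transitivity (\int[P]_w f ((Y w, Z w), X w)).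
  by apply: eq_Rintegral => w _; rewrite indicI /= mulrC.
rewrite E; apply: eq_Rintegral => w _.
have [wD|wD] := pselect (D (Z w)); last first.
  rewrite (_ : \1_(_ `&` _) w = 0) ?mulr0; last first.
    by rewrite indicE memNset// => -[].
  rewrite /f; under eq_Rintegral => u _.
    rewrite (_ : \1_(_ `&` _) _ = 0) ?mul0r; last by rewrite indicE memNset// => -[].
    over.
  exact: (exp_cst (kernel_law k (Z w))).
rewrite mulrC.
have bAz : bmeas (fun u => \1_A (condF k u (Z w)) : R).
  apply: (bmeas_comp (bmeas_indic mA)).
  exact: continuous_measurable_fun (kcont wD).
have H := expZ (kernel_law k (Z w)) (\1_(B `&` snd @^-1` D) (Y w, Z w)) bAz.
apply: (etrans H); congr (_ * _).
transitivity (fine (k (Z w) ((condF k ^~ (Z w)) @^-1` A))).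
  apply: (exp_indic (kernel_law k (Z w))).
  rewrite -[X in measurable X]setTI.
  by apply: (continuous_measurable_fun (kcont wD)).
by rewrite (condF_uniform (k01 wD) (kcont wD) mA) (exp_indic unif01).
Qed.

End rank_independence.

(** * Independent samples *)

Section tuple_rectangles.
Context {d : measure_display} {T : measurableType d} (n : nat).

Definition rectangle (B : 'I_n -> set T) : set (n.-tuple T) :=
  [set t | forall i, B i (tnth t i)].

Definition rectangles : set (set (n.-tuple T)) :=
  [set rectangle B | B in [set B | forall i, measurable (B i)]].

Lemma rectangles_setI : setI_closed rectangles.
Proof.
move=> _ _ [B mB <-] [C mC <-]; exists (fun i => B i `&` C i).
  by move=> i; exact: measurableI.
apply/seteqP; split => t /=; first by move=> BC; split => i; case: (BC i).
by move=> [tB tC] i.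
Qed.

Lemma rectangles_setT : rectangles setT.
Proof. by exists (fun=> setT) => //; apply/seteqP; split. Qed.

(** The product sigma-algebra on tuples is generated by cylinders over one
    coordinate, and these are rectangles. *)
Lemma rectangles_gen : @measurable _ (n.-tuple T) = <<s rectangles >>.
Proof.
apply/seteqP; split.
  apply: smallest_sub; first exact: smallest_sigma_algebra.
  move=> A; rewrite -bigcup_seq => -[i _ [B mB <-]]; apply: sub_gen_smallest.
  exists (fun j => if j == i then B else setT).
    by move=> j /=; case: ifP.
  rewrite setTI; apply/seteqP; split => t /=.
    by move=> /(_ i); rewrite eqxx.
  by move=> tB j; case: eqP => [->|].
apply: smallest_sub; first exact: sigma_algebra_measurable.
move=> _ [B mB <-].
rewrite (_ : rectangle B = \bigcap_(i in [set: 'I_n]) ((@tnth _ T ^~ i) @^-1` B i)); last first.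
  by apply/seteqP; split => t /= H i; [move=> _|]; exact: H.
apply: fin_bigcap_measurable => [|i _]; first exact: finite_finset.
by rewrite -[X in measurable X]setTI; exact: measurable_tnth.
Qed.

End tuple_rectangles.

Section iid.
Context {R : realType} {d0 d1 : measure_display} {Om : measurableType d0}.
Context {T : measurableType d1}.
Variables (Pr : probability Om R) (W : nat -> Om -> T) (P : probability T R).
Hypothesis iidW : iid_sample Pr W P.

Let mW i : measurable_fun setT (W i). Proof. by case: iidW. Qed.

Lemma measurable_map_tuple d2 (T' : measurableType d2) (pi : T -> T') n :
  measurable_fun setT pi ->
  measurable_fun setT (fun w => [tuple pi (W i w) | i < n]).
Proof.
move=> mpi; apply/measurable_fun_tnthP => i.
rewrite (_ : _ \o _ = pi \o W i); last by apply/funext => w /=; rewrite tnth_mktuple.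
exact: measurableT_comp.
Qed.

(** The next observation is independent of the sample so far, in the form
    required by disintegration: product rule on a generating pi-system. *)
Lemma iid_next n (A : set T) (B : set (n.-tuple T)) :
  measurable A -> rectangles B ->
  Pr (W n @^-1` A `&` (fun w => [tuple W i w | i < n]) @^-1` B) =
  (P A * Pr ((fun w => [tuple W i w | i < n]) @^-1` B))%E.
Proof.
move=> mA [C mC <-]; case: iidW => _ lawW indW.
have -> : (fun w => [tuple W i w | i < n]) @^-1` rectangle C =
    \bigcap_(i : 'I_n) (W i @^-1` C i).
  apply/seteqP; split => w /= H i; first by have := H i; rewrite tnth_mktuple.
  by rewrite tnth_mktuple; exact: H.
(* The family of events with the new one at the last index. *)
pose C' (i : 'I_n.+1) : set T := if unlift ord_max i is Some j then C j else A.
have -> : W n @^-1` A `&` \bigcap_(i : 'I_n) (W i @^-1` C i) =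
    \bigcap_(i : 'I_n.+1) (W i @^-1` C' i).
  apply/seteqP; split => w /=.
    move=> [wA wC] i _; rewrite /C'; case: unliftP => [j ->|->] //.
    by rewrite lift_max; exact: wC.
  move=> H; split; first by have := H ord_max I; rewrite /C' unlift_none.
  move=> i _; have := H (lift ord_max i) I.
  by rewrite /C' liftK lift_max.
rewrite (indW n.+1) => [|i]; last by rewrite /C'; case: unlift.
rewrite (indW n)// big_ord_recr/= muleC; congr (_ * _)%E.
  by rewrite /C' unlift_none lawW.
apply: eq_bigr => i _; congr (Pr (W i @^-1` _)).
rewrite /C' (_ : widen_ord _ i = lift ord_max i) ?liftK//.
by apply/val_inj; rewrite [RHS]lift_max.
Qed.

(** Conditioning on the first n terms and the addition formula for cos turn one
    more term into multiplication by the mean of cos s, up to the mean of sin s;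
    each of the n steps therefore costs at most the two displayed errors. *)
Lemma cos_sum_iid (s : T -> R) (e : R) n c : measurable_fun setT s -> `|e| <= 1 ->
  `|\int[Pr]_w cos (c + \sum_(i < n) s (W i w)) - cos c * e ^+ n| <=
  n%:R * (`|\int[P]_x cos (s x) - e| + `|\int[P]_x sin (s x)|).
Proof.
move=> ms e1.
have mS m : measurable_fun setT (fun t : m.-tuple T => \sum_(i < m) s (tnth t i)).
  by apply: measurable_sum => i; apply: measurableT_comp ms _; exact: measurable_tnth.
set p := \int[P]_x cos (s x); set r := \int[P]_x sin (s x).
pose Ss m w := \sum_(i < m) s (W i w).
have mSs m : measurable_fun setT (Ss m).
  by apply: measurable_sum => i; exact: measurableT_comp ms (mW i).
elim: n c => [|n IH] c.
  rewrite mul0r expr0 mulr1.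
  under eq_Rintegral do rewrite big_ord0 addr0.
  by rewrite exp_cst subrr normr0.
have mV := measurable_map_tuple (pi := idfun) (n := n) (@measurable_id _ T setT).
have mcW : measurable_fun setT (fun w => c + Ss n w).
  by apply: measurable_funD => //; exact: mSs.
have step (g h : R -> R) (bg : bmeas (fun x => g (s x)))
    (bh : bmeas (fun t : n.-tuple T => h (c + \sum_(i < n) s (tnth t i)))) :
    \int[Pr]_w (g (s (W n w)) * h (c + Ss n w)) =
    \int[P]_x g (s x) * \int[Pr]_w h (c + Ss n w).
  have := exp_indepE (mW n) mV (@rectangles_setI _ T n) (rectangles_gen n)
    (@rectangles_setT _ T n) (@iid_next n) bg bh.
  have SE w : \sum_(i < n) s (tnth [tuple W i w | i < n] i) = Ss n w.
    by apply: eq_bigr => i _; rewrite tnth_mktuple.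
  under eq_Rintegral do rewrite SE.
  by under [in X in _ = _ * X -> _]eq_Rintegral do rewrite SE.
have rec : \int[Pr]_w cos (c + Ss n.+1 w) =
    p * \int[Pr]_w cos (c + Ss n w) - r * \int[Pr]_w sin (c + Ss n w).
  have mcS : measurable_fun setT (fun t : n.-tuple T => c + \sum_(i < n) s (tnth t i)).
    by apply: measurable_funD => //; exact: mS.
  have mWn := measurableT_comp ms (mW n).
  rewrite -!step; [|exact: bmeas_sin|exact: bmeas_sin|exact: bmeas_cos|exact: bmeas_cos].
  rewrite -expB; last 2 first.
  - by apply: bmeasM; [exact: bmeas_cos|exact: bmeas_cos].
  - by apply: bmeasM; [exact: bmeas_sin|exact: bmeas_sin].
  apply: eq_Rintegral => w _; rewrite /Ss big_ord_recr/= addrA cosD.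
  by rewrite [X in X - _ = _]mulrC [X in _ - X = _]mulrC.
rewrite rec exprS.
set Cn := \int[Pr]_w cos (c + Ss n w); set Sn := \int[Pr]_w sin (c + Ss n w).
have Cn1 : `|Cn| <= 1.
  by apply: exp_normM => [|w]; [exact: bmeas_cos|exact: cos_max].
have Sn1 : `|Sn| <= 1.
  by apply: exp_normM => [|w]; [exact: bmeas_sin|exact: sin_max].
have -> : p * Cn - r * Sn - cos c * (e * e ^+ n) =
    (p - e) * Cn + e * (Cn - cos c * e ^+ n) - r * Sn by ring.
apply: (le_trans (ler_normB _ _)).
rewrite -natr1 [leRHS]mulrDl mul1r addrA.
apply: lerD; last by rewrite normrM ler_piMr.
apply: (le_trans (ler_normD _ _)); rewrite [leLHS]addrC; apply: lerD.
  by rewrite normrM (le_trans _ (IH c))// ler_piMl.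
by rewrite normrM ler_piMr.
Qed.

End iid.

(** * Sums of conditionally centred terms *)

Section conditionally_centred_sums.
Context {R : realType} {d0 d1 d2 : measure_display} {Om : measurableType d0}.
Context {T : measurableType d1} {T' : measurableType d2}.
Variables (Pr : probability Om R) (W : nat -> Om -> T) (P : probability T R).
Hypothesis iidW : iid_sample Pr W P.
Variables (u : T -> R) (pi : T -> T') (nu : probability R R).
Hypotheses (mu : measurable_fun setT u) (mpi : measurable_fun setT pi).
Hypothesis ind : forall A B, measurable A -> measurable B ->
  P (u @^-1` A `&` pi @^-1` B) = (nu A * P (pi @^-1` B))%E.

Let mW i : measurable_fun setT (W i). Proof. by case: iidW. Qed.

Let V n w : n.-tuple T' := [tuple pi (W i w) | i < n].

Let mV n : measurable_fun setT (V n).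
Proof. exact: (measurable_map_tuple iidW). Qed.

(** For i <> j the rank u(W_i) is independent of all the pi(W_m) and of W_j: at
    index i it is independent of pi(W_i), and the other indices involve other
    observations. *)
Lemma iid_rank_indep n (i j : 'I_n) (A : set R) (D : set (n.-tuple T' * T)) :
  i != j -> measurable A ->
  [set B `*` C | B in @rectangles _ T' n & C in @measurable _ T] D ->
  Pr ((fun w => u (W i w)) @^-1` A `&` (fun w => (V n w, W j w)) @^-1` D) =
  (nu A * Pr ((fun w => (V n w, W j w)) @^-1` D))%E.
Proof.
move=> ij mA [_ [B mB <-] [C mC <-]]; case: iidW => _ lawW indW.
pose E (m : 'I_n) : set T := pi @^-1` B m `&` (if m == j then C else setT).
pose E' (m : 'I_n) : set T := if m == i then u @^-1` A `&` pi @^-1` B i else E m.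
have mE m : measurable (E m).
  by apply: measurableI; [exact: (measurable_preim mpi (mB m))|case: ifP].
have mE' m : measurable (E' m).
  rewrite /E'; case: ifP => _ //.
  by apply: measurableI; [exact: (measurable_preim mu mA)|exact: (measurable_preim mpi (mB i))].
have -> : (fun w => (V n w, W j w)) @^-1` (rectangle B `*` C) =
    \bigcap_(m : 'I_n) (W m @^-1` E m).
  apply/seteqP; split => w /=.
    move=> [wB wC] m _; split; first by have := wB m; rewrite tnth_mktuple.
    by case: eqP => [->|].
  move=> H; split => [m|]; first by rewrite tnth_mktuple; case: (H m I).
  by have [_] := H j I; rewrite eqxx.
have -> : (fun w => u (W i w)) @^-1` A `&` \bigcap_(m : 'I_n) (W m @^-1` E m) =
    \bigcap_(m : 'I_n) (W m @^-1` E' m).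
  apply/seteqP; split => w /=.
    move=> [wA wE] m _; rewrite /E'; case: eqP => [->|_]; last exact: wE.
    by split => //; case: (wE i I).
  move=> H; split; first by have := H i I; rewrite /E' eqxx => -[].
  move=> m _; have := H m I; rewrite /E'; case: eqP => [->|//] [_ wB].
  by split => //=; rewrite (negbTE ij).
rewrite !indW// (bigD1 i)//= [in RHS](bigD1 i)//= muleA; congr (_ * _)%E.
  rewrite !lawW// /E' eqxx ind// /E (negbTE ij) setIT//.
by apply: eq_bigr => m /negbTE mi; rewrite /E' mi.
Qed.

Variables (psi : R -> R) (n : nat) (D : 'I_n -> n.-tuple T' -> R).
Hypotheses (bpsi : bmeas psi) (psi0 : \int[nu]_x psi x = 0).
Hypothesis bD : forall i, bmeas (D i).

Let Y (i : 'I_n) w := psi (u (W i w)) * D i (V n w).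

Let bpsiu : bmeas (fun x => psi (u x)). Proof. exact: (bmeas_comp bpsi mu). Qed.

Let bDV (i : 'I_n) : bmeas (fun w => D i (V n w)). Proof. exact: (bmeas_comp (bD i) (@mV n)). Qed.

Let bY (i : 'I_n) : bmeas (Y i).
Proof. by apply: bmeasM; [exact: (bmeas_comp bpsiu (@mW i))|exact: bDV]. Qed.

(** In a mixed product with i <> j the factor psi(u(W_i)) has mean zero and is
    independent of all the others, so that only the squares survive. *)
Lemma exp_sqr_centred_sum :
  \int[Pr]_w (\sum_(i < n) Y i w) ^+ 2 = \sum_(i < n) \int[Pr]_w (Y i w ^+ 2).
Proof.
transitivity (\int[Pr]_w \sum_(i < n) \sum_(j < n) Y i w * Y j w).
  by apply: eq_Rintegral => w _; rewrite expr2 big_distrlr.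
rewrite exp_sum => [|i]; last by apply: bmeas_sum => j; exact: bmeasM.
apply: eq_bigr => i _; rewrite exp_sum => [|j]; last exact: bmeasM.
rewrite (bigD1 i)//= [X in _ + X]big1 ?addr0 => [|j ji].
  by apply: eq_Rintegral => w _; rewrite expr2.
pose g (p : n.-tuple T' * T) : R := psi (u p.2) * (D i p.1 * D j p.1).
have bg : bmeas g.
  apply: bmeasM; first exact: (bmeas_comp bpsiu).
  by apply: bmeasM; [exact: (bmeas_comp (bD i))|exact: (bmeas_comp (bD j))].
have muW := measurableT_comp mu (@mW i).
have mVW := measurable_fun_pair (@mV n) (@mW j).
have [CI mC CT] := pi_system_prod T (@rectangles_setI _ T' n) (rectangles_gen n)
  (@rectangles_setT _ T' n).
have ij : i != j by rewrite eq_sym.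
have := exp_indepE muW mVW CI mC CT
  (fun A B mA CB => iid_rank_indep ij mA CB) bpsi bg.
rewrite psi0 mul0r => <-.
by apply: eq_Rintegral => w _; rewrite /Y /g /=; ring.
Qed.

End conditionally_centred_sums.

(** * Measures with a density *)

(** Change of variables for nonnegative functions. *)
Lemma ge0_integral_image d1 d2 (T1 : measurableType d1) (T2 : measurableType d2)
    (R : realType) (F : T1 -> T2) (mF : measurable_fun setT F)
    (m : {measure set T1 -> \bar R}) (f : T2 -> \bar R) :
  measurable_fun setT f -> (forall x, (0 <= f x)%E) ->
  (\int[image_measure mF m]_y f y = \int[m]_x f (F x))%E.
Proof. by move=> mf f0; rewrite ge0_integral_pushforward. Qed.

Section density.
Context {R : realType}.
Local Notation RR := (measurableTypeR R).
Local Notation mu := (@lebesgue_measure R).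
Variables (nu : {measure set RR -> \bar R}) (p : RR -> R).
Hypotheses (mp : measurable_fun setT p) (p0 : forall x, 0 <= p x).
Hypothesis nuE : forall A, measurable A -> nu A = (\int[mu]_(x in A) (p x)%:E)%E.

Let under_graph : set (RR * RR) := [set q | 0 <= q.2 <= p q.1].

Let measurable_under_graph : measurable under_graph.
Proof.
rewrite (_ : under_graph = (snd @^-1` `[0, +oo[%classic) `&` [set q | q.2 <= p q.1]); last first.
  by apply/seteqP; split => q /=; rewrite in_itv/= andbT; [move=> /andP|move=> [*]; exact/andP].
apply: measurableI; first by rewrite -[X in measurable X]setTI; exact: measurable_snd.
rewrite -[X in measurable X]setTI; apply: measurable_fun_le => //.
exact: measurableT_comp.
Qed.

Let under_graph_section x : mu (xsection under_graph x) = (p x)%:E.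
Proof.
rewrite xsectionE (_ : _ @^-1` _ = `[0, p x]%classic); last first.
  by apply/seteqP; split => y /=; rewrite in_itv.
rewrite lebesgue_measure_itv/= lte_fin oppr0 adde0.
by have := p0 x; rewrite le_eqVlt => /predU1P[<-|->//]; rewrite ltxx.
Qed.

Let slice (g : RR -> \bar R) : measurable_fun setT g -> (forall x, (0 <= g x)%E) ->
  (\int[mu \x mu]_(q in under_graph) g q.1 = \int[mu]_x (g x * (p x)%:E))%E.
Proof.
move=> mg g0.
pose h (q : RR * RR) := (g q.1 * (\1_under_graph q)%:E)%E.
have mh : measurable_fun setT h.
  apply: emeasurable_funM; first exact: measurableT_comp.
  by apply/measurable_EFinP; exact: measurable_indic.
have h0 q : (0 <= h q)%E by rewrite mule_ge0// lee_fin.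
transitivity (\int[mu \x mu]_q h q)%E.
  rewrite [LHS]integral_mkcond; apply: eq_integral => q _.
  by rewrite patchE /h indicE; case: ifPn => _; rewrite ?mule1 ?mule0.
rewrite fubini_tonelli1//; apply: eq_integral => x _.
have mS : measurable (xsection under_graph x) by exact: measurable_xsection.
rewrite /fubini_F /h /= -under_graph_section -[in RHS](setIT (xsection under_graph x)).
rewrite -(integral_indic _ measurableT mS) -ge0_integralZl//; last first.
  by apply/measurable_EFinP; exact: measurable_indic.
by apply: eq_integral => y _; rewrite !indicE mem_xsection.
Qed.

(** A measure with density p is the first marginal of Lebesgue measure restricted
    to the region under the graph of p; integrating a function of the first
    coordinate over that region by Fubini gives the formula. *)
Lemma ge0_integral_density (f : RR -> \bar R) :
  measurable_fun setT f -> (forall x, (0 <= f x)%E) ->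
  (\int[nu]_x f x = \int[mu]_x (f x * (p x)%:E))%E.
Proof.
move=> mf f0; pose m := mrestr (mu \x mu)%E measurable_under_graph.
have mG := measurable_under_graph.
have mfst := @measurable_fst _ _ RR RR.
rewrite -slice// (eq_measure_integral (image_measure mfst m)); last first.
  move=> A mA _; rewrite nuE// integral_mkcond.
  transitivity (\int[mu]_x ((\1_A x)%:E * (p x)%:E))%E.
    by apply: eq_integral => x _; rewrite patchE indicE; case: ifPn => _; rewrite ?mul1e ?mul0e.
  rewrite -(slice (g := fun x => (\1_A x)%:E)); last 2 first.
  - by apply/measurable_EFinP; exact: measurable_indic.
  - by move=> x; rewrite lee_fin.
  have mA1 : measurable (fst @^-1` A : set (RR * RR)).
    exact: (measurable_preim mfst).
  by rewrite (integral_indic _ mG mA1).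
have E : (\int[image_measure mfst m]_x f x = \int[m]_q f q.1)%E.
  exact: (ge0_integral_image mfst m mf f0).
rewrite E.
have mfG : measurable (~` under_graph) by exact: measurableC.
have mf1 : measurable_fun setT (fun q : RR * RR => f q.1) by exact: measurableT_comp.
have m0 : m (~` under_graph) = 0%E by rewrite /m /= /mrestr setICl measure0.
have := ge0_negligible_integral mfG measurableT mf1 (fun q _ => f0 q.1) m0.
move=> ->; rewrite setTD setCK; apply: eq_measure_integral => A mA AG.
by rewrite /m /= /mrestr setIidl.
Qed.

End density.

(** * The standard normal law *)

Section change_of_variables.
Context {R : realType}.
Local Notation mu := (@lebesgue_measure R).

(** Change of variables for a map F under which Lebesgue measure is c times the
    image of itself. *)
Lemma lebesgue_density_image (F : measurableTypeR R -> measurableTypeR R)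
    (c : {nonneg R}) (p p' : R -> R) (A : set R) :
  measurable_fun setT F ->
  (forall B, measurable B -> mu B = (c%:num%:E * mu (F @^-1` B))%E) ->
  measurable_fun setT (p : measurableTypeR R -> R) -> (forall x, 0 <= p x) ->
  (forall x, p (F x) * c%:num = p' x) -> measurable A ->
  (\int[mu]_(x in F @^-1` A) (p' x)%:E = \int[mu]_(x in A) (p x)%:E)%E.
Proof.
move=> mF muF mp p0 pF mA.
rewrite [RHS](eq_measure_integral (mscale c (image_measure mF mu))); last first.
  by move=> B mB _; exact: muF.
have mpA : measurable_fun (A : set (measurableTypeR R)) (fun x => (p x)%:E).
  by apply/measurable_EFinP; exact: measurable_funTS.
have pA0 x : A x -> (0 <= (p x)%:E)%E by move=> _; rewrite lee_fin.
rewrite ge0_integral_mscale//.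
rewrite [X in (_ * X)%E]ge0_integral_pushforward//; last first.
  by move=> x _; rewrite lee_fin.
rewrite -ge0_integralZl//.
- by apply: eq_integral => x _; rewrite /= -EFinM mulrC pF.
- exact: (measurable_preim mF).
- by apply: measurable_funTS; apply/measurable_EFinP; exact: (measurableT_comp mp mF).
- by move=> x _; rewrite /= lee_fin.
Qed.

Lemma lebesgue_affine (m s : R) B : 0 < s -> measurable B ->
  mu B = (s%:E * mu ((fun x => (m + s * x)%R) @^-1` B))%E.
Proof.
move=> s0 mB.
have mF : measurable_fun setT ((fun x => m + s * x) : measurableTypeR R -> measurableTypeR R).
  by apply: measurable_funD => //; exact: measurable_funM.
pose c := NngNum (ltW s0).
rewrite [LHS](@lebesgue_measure_unique R (mscale c (image_measure mF mu)))// => _ [[a b] _ <-].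
have H x : (m + s * ((x - m) / s) = x)%R by rewrite mulrC divfK ?gt_eqF// addrC subrK.
rewrite /= /mscale/= /pushforward.
rewrite (_ : _ @^-1` _ = `](a - m) / s, (b - m) / s]%classic); last first.
  apply/seteqP; split => x /=; rewrite !in_itv/= ltr_pdivrMr// ler_pdivlMr//.
    by move=> /andP[? ?]; apply/andP; split; lra.
  by move=> /andP[? ?]; apply/andP; split; lra.
rewrite !lebesgue_measure_itv/= !lte_fin ltr_pM2r ?invr_gt0// ltrD2r.
case: ifPn => _; last by rewrite mule0.
by rewrite -!EFinD -EFinM; congr EFin; field; rewrite gt_eqF.
Qed.

End change_of_variables.

Section standard_normal.
Context {R : realType}.
Local Notation mu := (@lebesgue_measure R).

Definition stdn : probability R R := real_law (normal_prob 0 1).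

Lemma stdnE (A : set R) : stdn A = (\int[mu]_(x in A) (normal_pdf 0 1 x)%:E)%E.
Proof. by []. Qed.

Let measurable_pdf m s : measurable_fun setT (normal_pdf m s : measurableTypeR R -> R).
Proof. exact: measurable_normal_pdf. Qed.

(** Substituting m + s x turns the standard density into the density with mean m
    and deviation s. *)
Lemma stdn_affine (m s : R) (A : set R) : 0 < s -> measurable A ->
  stdn ((fun x => m + s * x) @^-1` A) = normal_prob m s A.
Proof.
move=> s0 mA; rewrite stdnE.
have mF : measurable_fun setT ((fun x => m + s * x) : measurableTypeR R -> measurableTypeR R).
  by apply: measurable_funD => //; exact: measurable_funM.
apply: (lebesgue_density_image (c := NngNum (ltW s0))) => //.
- by move=> B mB; exact: (lebesgue_affine m s0 mB).
- by move=> x; exact: normal_pdf_ge0.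
move=> x /=; rewrite !normal_pdfE ?gt_eqF// /normal_peak /normal_fun.
have -> : - (m + s * x - m) ^+ 2 / (s ^+ 2 *+ 2) = - (x - 0) ^+ 2 / (1 ^+ 2 *+ 2).
  by rewrite !mulr2n; field; rewrite gt_eqF// addr_gt0// exprn_gt0.
rewrite mulrAC; congr (_ * _).
rewrite expr1n mul1r -mulrnAr sqrtrM ?sqr_ge0// sqrtr_sqr gtr0_norm// invfM.
by rewrite mulrAC mulVf ?gt_eqF// mul1r.
Qed.

Lemma stdnN (A : set R) : measurable A -> stdn ((fun x => - x) @^-1` A) = stdn A.
Proof.
move=> mA; rewrite !stdnE.
have mF : measurable_fun setT (-%R : measurableTypeR R -> measurableTypeR R).
  exact: oppr_measurable.
apply: (lebesgue_density_image (c := 1%:nng)) => //.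
- by move=> B mB; rewrite mul1e -[LHS]lebesgue_measureN.
- by move=> x; exact: normal_pdf_ge0.
move=> x /=; rewrite mulr1 !normal_pdfE ?oner_eq0// /normal_fun !subr0.
by rewrite sqrrN.
Qed.

Lemma ge0_integral_stdn (f : R -> \bar R) : measurable_fun setT f ->
  (forall x, 0 <= f x)%E ->
  (\int[stdn]_x f x = \int[mu]_x (f x * (normal_pdf 0 1 x)%:E))%E.
Proof.
move=> mf f0.
have mf' : measurable_fun [set: measurableTypeR R] f.
  exact: mf.
rewrite -(@ge0_integral_density R (normal_prob 0 1)) //; last first.
  by move=> x; exact: normal_pdf_ge0.
rewrite [LHS]ge0_integral_pushforward//.
by move=> _ A mA; rewrite setTI.
Qed.

End standard_normal.

(** * Stability and moments of the normal law *)

Section normal_stability.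
Context {R : realType}.
Local Notation mu := (@lebesgue_measure R).
Local Notation RR := (measurableTypeR R).

Lemma normal_peakM (s t r : R) : 0 < s -> 0 < t -> 0 < r -> s * t = r ->
  normal_peak 1 * normal_peak r = normal_peak s * normal_peak t :> R.
Proof.
move=> s0 t0 r0 str.
have peakE (x : R) : 0 < x -> normal_peak x = x^-1 * normal_peak 1.
  move=> x0; rewrite /normal_peak expr1n mul1r -mulrnAr sqrtrM ?sqr_ge0//.
  by rewrite sqrtr_sqr gtr0_norm// invfM.
by rewrite (peakE s)// (peakE t)// (peakE r)// -str invfM; ring.
Qed.

(** Completing the square: the joint density of (x, u), with u normal around t x,
    is the marginal density of u times a normal density in x. *)
Lemma normal_pdf_mix (s t r x u : R) : 0 < s -> 0 < t -> 0 < r ->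
  s ^+ 2 + t ^+ 2 = r ^+ 2 ->
  normal_pdf (t * x) s u * normal_pdf 0 1 x =
  normal_pdf 0 r u * normal_pdf (t * u / r ^+ 2) (s / r) x.
Proof.
move=> s0 t0 r0 str; rewrite !normal_pdfE ?gt_eqF// ?divr_gt0//.
rewrite mulrACA [RHS]mulrACA; congr (_ * _).
  by rewrite mulrC (@normal_peakM r (s / r) s)// ?divr_gt0// mulrC divfK ?gt_eqF.
rewrite /normal_fun -!expRD; congr expR.
have s2 : s ^+ 2 = r ^+ 2 - t ^+ 2 by rewrite -str addrK.
have s2n : r ^+ 2 - t ^+ 2 != 0 by rewrite -s2 gt_eqF// exprn_gt0.
rewrite !mulr2n !expr_div_n s2; field.
by rewrite (gt_eqF r0)//= -s2 !gt_eqF// addr_gt0// exprn_gt0.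
Qed.

(** Fubini and [normal_pdf_mix]: the inner integral of the conditional density
    in x is one, which leaves the density of the sum. *)
Lemma stdn_sum_gt0 (s t r : R) (A : set R) : 0 < s -> 0 < t -> 0 < r ->
  s ^+ 2 + t ^+ 2 = r ^+ 2 -> measurable A ->
  (\int[stdn]_x stdn ((fun y => t * x + s * y)%R @^-1` A) = stdn ((fun x => r * x)%R @^-1` A))%E.
Proof.
move=> s0 t0 r0 str mA.
have -> : (fun x => r * x) = (fun x => 0 + r * x) by apply/funext => x; rewrite add0r.
rewrite stdn_affine//.
rewrite ge0_integral_stdn//; last first.
  have mh : measurable_fun setT (fun p : R * R => t * p.1 + s * p.2).
    by apply: measurable_funD; apply: measurable_funM.
  have mS : measurable ((fun p : R * R => t * p.1 + s * p.2) @^-1` A).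
    exact: (measurable_preim mh).
  rewrite (_ : (fun x => _) = stdn \o xsection ((fun p : R * R => t * p.1 + s * p.2) @^-1` A)).
    exact: measurable_fun_xsection.
  by apply/funext => x /=; rewrite xsectionE.
pose f (p : RR * RR) : \bar R :=
  (\1_A p.2 * (normal_pdf (t * p.1) s p.2 * normal_pdf 0 1 p.1))%:E.
have mA' : @measurable _ RR A by exact: mA.
have mf : measurable_fun setT f.
  apply/measurable_EFinP; apply: measurable_funM.
    by apply: measurableT_comp => //; exact: measurable_indic.
  rewrite (_ : (fun p : RR * RR => _) = (fun p : RR * RR =>
     (normal_peak s * expR (- (p.2 - t * p.1) ^+ 2 / (s ^+ 2 *+ 2)))
       * normal_pdf 0 1 p.1)); last first.
    by apply/funext => p; rewrite normal_pdfE ?gt_eqF.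
  apply: measurable_funM; last first.
    by apply: measurableT_comp => //; exact: measurable_normal_pdf.
  apply: measurable_funM => //; apply: measurableT_comp => //.
  apply: measurable_funM => //; apply: measurableT_comp => //.
  apply: measurable_funX => //; apply: measurable_funB => //.
  exact: measurable_funM.
have f0 p : (0 <= f p)%E.
  by rewrite lee_fin mulr_ge0 ?mulr_ge0 ?normal_pdf_ge0// indicE ler0n.
transitivity (\int[mu]_x \int[mu]_u f (x, u))%E.
  apply: eq_integral => x _; rewrite stdn_affine// /normal_prob.
  rewrite integral_mkcond -ge0_integralZr//.
  - apply: eq_integral => u _; rewrite patchE /f /= indicE.
    by case: ifPn => _; rewrite ?mul1r ?mul0r ?mul0e ?EFinM.
  - apply/(measurable_restrictT _ _).1 => //; apply/measurable_EFinP/measurable_funTS.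
    exact: measurable_normal_pdf.
  - by move=> u _; rewrite patchE; case: ifPn; rewrite ?lee_fin ?normal_pdf_ge0.
  - by rewrite lee_fin normal_pdf_ge0.
rewrite fubini_tonelli// /normal_prob [RHS]integral_mkcond.
apply: eq_integral => u _; rewrite patchE.
case: ifPn => [|] uA; last first.
  by rewrite integral0_eq// => x _; rewrite /f /= indicE (negbTE uA) mul0r.
transitivity (\int[mu]_x ((normal_pdf 0 r u)%:E * (normal_pdf (t * u / r ^+ 2) (s / r) x)%:E))%E.
  apply: eq_integral => x _; rewrite /f /= indicE uA mul1r.
  by rewrite (normal_pdf_mix _ _ s0 t0 r0 str) EFinM.
rewrite ge0_integralZl//.
- by rewrite integral_normal_pdf mule1.
- by apply/measurable_EFinP; exact: measurable_normal_pdf.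
- by move=> x _; rewrite lee_fin normal_pdf_ge0.
- by rewrite lee_fin normal_pdf_ge0.
Qed.

Lemma stdn_scale_abs (t : R) (A : set R) : measurable A ->
  stdn ((fun y => t * y) @^-1` A) = stdn ((fun y => `|t| * y) @^-1` A).
Proof.
move=> mA; have [t0|t0] := leP 0 t; first by rewrite ger0_norm.
rewrite ltr0_norm// -(@stdnN R ((fun y => t * y) @^-1` A)).
  congr (stdn _); apply/seteqP; split => y/=; by rewrite mulrN mulNr.
by rewrite -[X in measurable X]setTI; exact: measurable_funM.
Qed.

(** Stability: a combination of two independent standard normals is a multiple of
    one.  The degenerate cases, where a coefficient vanishes, have no density and
    are separate. *)
Lemma stdn_sum (s t : R) (A : set R) : 0 <= s -> measurable A ->
  (\int[stdn]_x stdn ((fun y => s * x + t * y)%R @^-1` A) =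
   stdn ((fun x => Num.sqrt (s ^+ 2 + t ^+ 2) * x)%R @^-1` A))%E.
Proof.
move=> s0 mA.
transitivity (\int[stdn]_x stdn ((fun y => s * x + `|t| * y)%R @^-1` A))%E.
  apply: eq_integral => x _.
  have mA' : measurable ((fun y => s * x + y) @^-1` A).
    by rewrite -[X in measurable X]setTI; exact: measurable_funD.
  exact: (@stdn_scale_abs t _ mA').
rewrite -(real_normK (num_real t)); have := normr_ge0 t; move: `|t| => {}t.
rewrite le_eqVlt => /predU1P[<-|t0].
  rewrite expr0n addr0 sqrtr_sqr ger0_norm//.
  transitivity (\int[stdn]_x (\1_((fun x => s * x) @^-1` A) x)%:E)%E.
    apply: eq_integral => x _; rewrite indicE.
    case: (boolP (x \in _)); rewrite ?inE ?notin_setE /= => sxA.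
      have -> : (fun y => s * x + 0 * y) @^-1` A = setT.
        by apply/seteqP; split => // y _ /=; rewrite mul0r addr0.
      exact: probability_setT.
    have -> : (fun y => s * x + 0 * y) @^-1` A = set0.
      by apply/seteqP; split => // y /=; rewrite mul0r addr0.
    exact: (measure0 stdn).
  rewrite integral_indic ?setIT//.
  by rewrite -[X in measurable X]setTI; exact: measurable_funM.
move: s0; rewrite le_eqVlt => /predU1P[<-|s0].
  rewrite expr0n add0r sqrtr_sqr gtr0_norm//.
  rewrite (eq_integral (cst (stdn ((fun x => t * x)%R @^-1` A)))); last first.
    by move=> x _ /=; congr (stdn _); apply/seteqP; split => y /=; rewrite mul0r add0r.
  by rewrite integral_cst// [X in (_ * X)%E]probability_setT mule1.
apply: stdn_sum_gt0 => //.
  by rewrite sqrtr_gt0 addr_gt0// exprn_gt0.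
by rewrite sqr_sqrtr 1?addrC// addr_ge0// sqr_ge0.
Qed.

End normal_stability.

Section normal_moments.
Context {R : realType}.
Implicit Types (s x : R).

(** The exponential turns the standard density into s times the normal density of
    deviation s. *)
Lemma stdn_exp_sqr s : 0 < s ->
  (\int[stdn]_x (expR ((1 - s ^- 2) * (x ^+ 2 / 2)))%:E = s%:E)%E.
Proof.
move=> s0.
have mf : measurable_fun setT (fun x : R => (expR ((1 - s ^- 2) * (x ^+ 2 / 2)))%:E).
  apply/measurable_EFinP; apply: measurableT_comp => //.
  by apply: measurable_funM => //; apply: measurable_funM.
rewrite ge0_integral_stdn//.
transitivity (\int[lebesgue_measure]_x (s%:E * (normal_pdf 0 s x)%:E))%E.
  apply: eq_integral => x _; rewrite -!EFinM; congr EFin.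
  rewrite !normal_pdfE ?gt_eqF// /normal_fun !subr0.
  rewrite mulrCA [RHS]mulrA; congr (_ * _).
    rewrite /normal_peak expr1n mul1r -mulrnAr sqrtrM ?sqr_ge0//.
    by rewrite sqrtr_sqr gtr0_norm// invfM mulrA mulfV ?gt_eqF// mul1r.
  rewrite -expRD; congr expR; rewrite !mulr2n; field.
  by rewrite (gt_eqF s0) gt_eqF// addr_gt0// exprn_gt0.
rewrite ge0_integralZl//.
- by rewrite integral_normal_pdf mule1.
- by apply/measurable_EFinP; exact: measurable_normal_pdf.
- by move=> x _; rewrite lee_fin normal_pdf_ge0.
- by rewrite lee_fin ltW.
Qed.

Lemma stdn_integrable_exp s : 0 < s ->
  stdn.-integrable setT (fun x => (expR ((1 - s ^- 2) * (x ^+ 2 / 2)))%:E).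
Proof.
move=> s0; apply/integrableP; split.
  apply/measurable_EFinP; apply: measurableT_comp => //.
  by apply: measurable_funM => //; apply: measurable_funM.
under eq_integral do rewrite gee0_abs ?lee_fin ?expR_ge0//.
by rewrite stdn_exp_sqr// ltry.
Qed.

(** Powers up to the fourth are dominated by the exponential of a multiple of x^2
    that [stdn_integrable_exp] provides for s = 2. *)
Lemma stdn_integrable_X n : (n <= 4)%N ->
  stdn.-integrable setT (fun x : R => (x ^+ n)%:E).
Proof.
move=> n4.
have mX : measurable_fun setT (fun x : R => (x ^+ n)%:E).
  by apply/measurable_EFinP; exact: measurable_funX.
(* For |x| >= 1 the constant comes from y^2 / 2 <= exp y at y = 3 x^2 / 8, which
   gives x^4 <= (128 / 9) exp y. *)
have key (x : R) : `|x ^+ n| <= 16 * expR ((1 - 2 ^- 2) * (x ^+ 2 / 2)).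
  have -> : 1 - 2 ^- 2 = 3 / 4 :> R by field.
  rewrite normrX.
  have [x1|x1] := leP `|x| 1.
    apply: (le_trans (exprn_ile1 n (normr_ge0 x) x1)).
    have : 1 <= expR (3 / 4 * (x ^+ 2 / 2)).
      by rewrite -expR0 ler_expR mulr_ge0// divr_ge0// sqr_ge0.
    lra.
  apply: (@le_trans _ _ (`|x| ^+ 4)).
    by rewrite ler_weXn2l// ltW.
  have h : 0 <= 3 / 4 * (x ^+ 2 / 2) by rewrite mulr_ge0// divr_ge0// sqr_ge0.
  have := expR_ge1Dxn 1 h; rewrite (_ : 2`!%:R = 2)//.
  have -> : `|x| ^+ 4 = (x ^+ 2) ^+ 2.
    by rewrite -(real_normK (num_real x)) -exprM.
  move: (x ^+ 2) (expR _) => y e.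
  have := sqr_ge0 y; rewrite !exprMn; lra.
apply: (le_integrable measurableT mX _
  (integrableZl measurableT 16 (stdn_integrable_exp (ltr0Sn R 1)))) => x _ /=.
by rewrite lee_fin; apply: (le_trans (key x)); exact: ler_norm.
Qed.

(** With m the mean of x^2 / 2, the inequality 1 + y <= exp y and [stdn_exp_sqr]
    give (1 - s^-2) m <= s - 1 for every s > 0.  Both sides vanish at s = 1, so
    their derivatives there agree: m = 1 / 2. *)
Lemma stdn_sqr : \int[stdn]_x (x ^+ 2) = 1 :> R.
Proof.
have iY : stdn.-integrable setT (fun x : R => (x ^+ 2 / 2)%:E).
  under eq_fun do rewrite mulrC EFinM.
  exact: integrableZl (stdn_integrable_X _).
suff E : \int[stdn]_x (x ^+ 2 / 2) = 2^-1 :> R.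
  have := E; rewrite RintegralZr//; last exact: stdn_integrable_X.
  by move=> H; apply: (@mulIf _ 2^-1); rewrite ?invr_eq0// H mul1r.
have key s : 0 < s -> (1 - s ^- 2) * (\int[stdn]_x (x ^+ 2 / 2)) <= s - 1 :> R.
  move=> s0; rewrite lerBrDl -RintegralZl//.
  rewrite -[X in X + _](exp_cst stdn) -RintegralD//; last 2 first.
  - exact: (bmeas_int stdn (bmeas_cst 1)).
  - exact: (integrableZl measurableT (1 - s ^- 2) iY).
  rewrite -[leRHS]/(fine s%:E) -(stdn_exp_sqr s0).
  apply: le_Rintegral => //.
  - exact: (integrableD measurableT (bmeas_int stdn (bmeas_cst 1))
      (integrableZl measurableT (1 - s ^- 2) iY)).
  - exact: stdn_integrable_exp.
  - by move=> x _; exact: expR_ge1Dx.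
set m := \int[stdn]_x (x ^+ 2 / 2) in key *.
have keyp s : 0 < s -> (s - 1) * ((s + 1) * m - s ^+ 2) <= 0.
  move=> s0; have := key s s0.
  have s2 : 0 < s ^+ 2 by rewrite exprn_gt0.
  rewrite -(ler_pM2l s2) mulrA mulrBr mulr1 mulfV ?gt_eqF//.
  by rewrite -subr_le0 => H; apply: le_trans H; rewrite le_eqVlt; apply/orP; left; apply/eqP; ring.
have m0 : 0 <= m by apply: Rintegral_ge0 => x _; rewrite divr_ge0// sqr_ge0.
(* If m is not 1 / 2, the inequality fails at a value of s displaced from 1 by a
   quarter of |1 - 2 m|. *)
pose e := 1 - 2 * m; have e1 : e <= 1 by rewrite /e; lra.
have mE : m = (1 - e) / 2 by rewrite /e; lra.
have s0 : 0 < 1 - e / 4 by lra.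
have := keyp _ s0; rewrite mE.
have -> : (1 - e / 4 - 1) * ((1 - e / 4 + 1) * ((1 - e) / 2) - (1 - e / 4) ^+ 2)
  = e ^+ 2 * ((10 - e) / 64) by field.
rewrite pmulr_lle0; last by lra.
rewrite le_eqVlt ltNge sqr_ge0 orbF sqrf_eq0 => /eqP ->.
by rewrite subr0 mul1r.
Qed.

End normal_moments.

(** * The normal characteristic function *)

Lemma integrable_eq_law d1 d2 d3 (T1 : measurableType d1) (T2 : measurableType d2)
    (T : measurableType d3) (R : realType) (P1 : probability T1 R)
    (P2 : probability T2 R) (X : T1 -> T) (Y : T2 -> T) (g : T -> R) :
  measurable_fun setT X -> measurable_fun setT Y ->
  (forall A, measurable A -> P1 (X @^-1` A) = P2 (Y @^-1` A)) ->
  measurable_fun setT g -> P2.-integrable setT (fun y => (g (Y y))%:E) ->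
  P1.-integrable setT (fun x => (g (X x))%:E) /\
  \int[P1]_x g (X x) = \int[P2]_y g (Y y).
Proof.
move=> mX mY XY mg /integrableP[_ iY].
have mgE : measurable_fun setT (fun x => (g x)%:E) by exact/measurable_EFinP.
have H (h : T -> \bar R) : measurable_fun setT h -> (forall x, (0 <= h x)%E) ->
    (\int[P1]_x h (X x) = \int[P2]_y h (Y y))%E.
  move=> mh h0.
  transitivity (\int[image_measure mX P1]_x h x)%E.
    by rewrite ge0_integral_pushforward.
  rewrite (eq_measure_integral (image_measure mY P2)); last by move=> A mA _; exact: XY.
  by rewrite ge0_integral_pushforward.
have iX : P1.-integrable setT (fun x => (g (X x))%:E).
  apply/integrableP; split; first by apply/measurable_EFinP; exact: measurableT_comp.
  rewrite (H (fun x => `|(g x)%:E|%E))//; exact: measurableT_comp.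
split => //; rewrite /Rintegral; congr fine.
rewrite integralE [RHS]integralE; congr (_ - _)%E.
- transitivity (\int[P1]_x (fun z => (g z)%:E)^\+ (X x))%E.
    by apply: eq_integral => x _; rewrite !funeposE.
  rewrite (H _ (measurable_funepos mgE) (funepos_ge0 _)).
  by apply: eq_integral => x _; rewrite !funeposE.
- transitivity (\int[P1]_x (fun z => (g z)%:E)^\- (X x))%E.
    by apply: eq_integral => x _; rewrite !funenegE.
  rewrite (H _ (measurable_funeneg mgE) (funeneg_ge0 _)).
  by apply: eq_integral => x _; rewrite !funenegE.
Qed.

Lemma exp_eq_law d1 d2 d3 (T1 : measurableType d1) (T2 : measurableType d2)
    (T : measurableType d3) (R : realType) (P1 : probability T1 R)
    (P2 : probability T2 R) (X : T1 -> T) (Y : T2 -> T) (g : T -> R) :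
  measurable_fun setT X -> measurable_fun setT Y ->
  (forall A, measurable A -> P1 (X @^-1` A) = P2 (Y @^-1` A)) -> bmeas g ->
  \int[P1]_x g (X x) = \int[P2]_y g (Y y).
Proof.
move=> mX mY XY bg; have [mg _] := bg.
by have [_] := integrable_eq_law mX mY XY mg (bmeas_int P2 (bmeas_comp bg mY)).
Qed.

Section product_probability.
Context {d1 d2 : measure_display} {T1 : measurableType d1} {T2 : measurableType d2}.
Context {R : realType} (P1 : probability T1 R) (P2 : probability T2 R).

Definition prodP : probability (T1 * T2)%type R := (P1 \x P2)%E.

Lemma prodPE A : prodP A = (\int[P1]_x P2 (xsection A x))%E.
Proof. by []. Qed.

Lemma exp_prodP (f : T1 -> R) (g : T2 -> R) : bmeas f -> bmeas g ->
  \int[prodP]_p (f p.1 * g p.2) = \int[P1]_x f x * \int[P2]_y g y.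
Proof.
move=> bf bg.
have PX A B : measurable A -> measurable B -> prodP (A `*` B) = (P1 A * P2 B)%E.
  by move=> mA mB; exact: product_measure1E.
have GI : setI_closed (@measurable _ T2) by move=> *; exact: measurableI.
have PT1 : P1 setT = 1%E by exact: probability_setT.
have PT2 : P2 setT = 1%E by exact: probability_setT.
have ind A B : measurable A -> measurable B ->
    prodP (fst @^-1` A `&` snd @^-1` B) = (P1 A * prodP (snd @^-1` B))%E.
  move=> mA mB; have E := PX setT B measurableT mB; rewrite PT1 mul1e in E.
  have -> : prodP (snd @^-1` B) = P2 B.
    by rewrite -E; congr (prodP _); apply/seteqP; split => [p|p []].
  by rewrite -PX//.
rewrite (exp_indepE measurable_fst measurable_snd GI (sigma_algebra_self T2)
  measurableT ind bf bg).
congr (_ * _).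
apply: (exp_eq_law (P1 := prodP) (P2 := P2) (X := snd) (Y := idfun)
  measurable_snd (@measurable_id _ _ _) _ bg) => B mB.
have E := PX setT B measurableT mB; rewrite PT1 mul1e in E.
by rewrite -E; congr (prodP _); apply/seteqP; split => [p|p []].
Qed.

End product_probability.

Section normal_characteristic_function.
Context {R : realType}.
Implicit Types s t x : R.

(** The characteristic function of the standard normal law, real by symmetry.  No
    closed formula is needed: only multiplicativity and the expansion at zero. *)
Definition ncf t : R := \int[stdn]_x cos (t * x).

Let mscale t : measurable_fun setT (fun x : R => t * x).
Proof. exact: measurable_funM. Qed.

Let bcos t : bmeas (fun x : R => cos (t * x)). Proof. exact: bmeas_cos. Qed.

Let bsin t : bmeas (fun x : R => sin (t * x)). Proof. exact: bmeas_sin. Qed.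

Lemma exp_sin_stdn t : \int[stdn]_x sin (t * x) = 0.
Proof.
have H : \int[stdn]_x sin (t * x) = \int[stdn]_x sin (t * - x).
  have mopp : measurable_fun setT (fun x : R => - x) by exact: oppr_measurable.
  have lawN A : measurable A -> stdn (idfun @^-1` A) = stdn ((fun x : R => - x) @^-1` A).
    by move=> mA; rewrite stdnN.
  exact: (exp_eq_law (@measurable_id _ _ setT) mopp lawN (bsin t)).
have : \int[stdn]_x sin (t * - x) = -1 * \int[stdn]_x sin (t * x).
  by rewrite -expZ//; apply: eq_Rintegral => x _; rewrite mulrN sinN mulN1r.
by rewrite -H; lra.
Qed.

Lemma exp_stdn_sum s t (g : R -> R) : 0 <= s -> bmeas g ->
  \int[prodP stdn stdn]_p g (s * p.1 + t * p.2) =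
  \int[stdn]_x g (Num.sqrt (s ^+ 2 + t ^+ 2) * x).
Proof.
move=> s0 bg.
have mst : measurable_fun setT (fun p : R * R => s * p.1 + t * p.2).
  by apply: measurable_funD; apply: measurable_funM.
apply: (exp_eq_law mst (mscale _) _ bg) => A mA.
by rewrite -stdn_sum// prodPE; apply: eq_integral => x _; rewrite xsectionE.
Qed.

(** The addition formula for cos applied to s x + t y with x, y independent; the
    sines have mean zero by symmetry. *)
Lemma ncfM s t : 0 <= s -> ncf (Num.sqrt (s ^+ 2 + t ^+ 2)) = ncf s * ncf t.
Proof.
move=> s0; have b1 : bmeas (@cos R).
  by have := bcos 1; under eq_fun do rewrite mul1r.
rewrite /ncf -(exp_stdn_sum t s0 b1).
under eq_Rintegral do rewrite cosD.
rewrite expB; last 2 first.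
- by apply: bmeasM; [exact: (bmeas_comp (bcos s))|exact: (bmeas_comp (bcos t))].
- by apply: bmeasM; [exact: (bmeas_comp (bsin s))|exact: (bmeas_comp (bsin t))].
rewrite (exp_prodP stdn stdn (bcos s) (bcos t)) (exp_prodP stdn stdn (bsin s) (bsin t)).
by rewrite !exp_sin_stdn mulr0 subr0.
Qed.

Lemma ncf0 : ncf 0 = 1.
Proof. by rewrite /ncf; under eq_Rintegral do rewrite mul0r cos0; rewrite exp_cst. Qed.

Lemma ncf_natX (v : R) n : 0 <= v -> ncf (Num.sqrt (v *+ n)) = ncf (Num.sqrt v) ^+ n.
Proof.
move=> v0; elim: n => [|n IH]; first by rewrite mulr0n sqrtr0 ncf0 expr0.
by rewrite exprS -IH -ncfM ?sqrtr_ge0// !sqr_sqrtr ?mulrn_wge0// mulrS.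
Qed.

Lemma ncf_le1 t : `|ncf t| <= 1.
Proof. by apply: exp_normM => // x; exact: cos_max. Qed.

Lemma ncf_taylor t : `|1 - ncf t - t ^+ 2 / 2| <= t ^+ 4 * \int[stdn]_x (x ^+ 4).
Proof.
have i2 := stdn_integrable_X (R := R) (n := 2) isT.
have i4 := stdn_integrable_X (R := R) (n := 4) isT.
have ic : stdn.-integrable setT (fun x : R => (1 - cos (t * x))%:E).
  by apply: bmeas_int; apply: bmeasB => //; exact: bmeas_cst.
have it2 : stdn.-integrable setT (fun x : R => (t ^+ 2 / 2 * x ^+ 2)%:E).
  exact: (integrableZl measurableT (t ^+ 2 / 2) i2).
have it4 : stdn.-integrable setT (fun x : R => (t ^+ 4 * x ^+ 4)%:E).
  exact: (integrableZl measurableT (t ^+ 4) i4).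
have -> : 1 - ncf t - t ^+ 2 / 2 =
    \int[stdn]_x (1 - cos (t * x) - t ^+ 2 / 2 * x ^+ 2).
  rewrite RintegralB// RintegralZl// stdn_sqr mulr1; congr (_ - _).
  by rewrite expB ?exp_cst//; exact: bmeas_cst.
have icB : stdn.-integrable setT
    (fun x : R => (1 - cos (t * x) - t ^+ 2 / 2 * x ^+ 2)%:E).
  exact: (integrableB measurableT ic it2).
rewrite (le_trans (le_normr_Rintegral measurableT icB))// -RintegralZl//.
apply: le_Rintegral => //.
  exact: (integrable_norm icB).
move=> x _ /=; have := cos_taylor (t * x).
by rewrite !exprMn mulrAC.
Qed.

End normal_characteristic_function.

(** * The one-dimensional central limit theorem *)

Section one_dimensional_clt.
Context {R : realType}.

Lemma cvg_sqrt_rate (a : nat -> R) (l K : R) :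
  (forall n, (0 < n)%N -> `|a n - l| <= K * (Num.sqrt n%:R)^-1) ->
  a n @[n --> \oo] --> l.
Proof.
move=> aK; apply/cvgrPdist_le => e e0.
near=> n.
have n0 : (0 < n)%N by near: n; exists 1%N.
have nK : (`|K| / e) ^+ 2 <= n%:R by near: n; exact: nbhs_infty_ger.
rewrite distrC (le_trans (aK n n0))// (@le_trans _ _ (`|K| / Num.sqrt n%:R))//.
  by rewrite ler_wpM2r ?invr_ge0 ?sqrtr_ge0// ler_norm.
rewrite ler_pdivrMr ?sqrtr_gt0 ?ltr0n// mulrC -ler_pdivrMr//.
rewrite -[leLHS]ger0_norm ?divr_ge0 ?(ltW e0)// -sqrtr_sqr ler_wsqrtr//.
Unshelve. all: by end_near. Qed.

Context {d0 d1 : measure_display} {Om : measurableType d0} {T : measurableType d1}.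
Variables (Pr : probability Om R) (W : nat -> Om -> T) (P : probability T R).
Hypothesis iidW : iid_sample Pr W P.

(** Each term contributes cos (a s) with a = 1 / sqrt n.  Its mean and the factor
    ncf (sqrt (v / n)) have the same second-order expansion, up to O(n^-2), and
    the mean of sin (a s) is O(n^(-3/2)); by [cos_sum_iid] the total error is
    O(1 / sqrt n). *)
Lemma clt_cos (s : T -> R) (v c : R) : bmeas s -> \int[P]_x s x = 0 ->
  \int[P]_x (s x ^+ 2) = v ->
  \int[Pr]_w cos (c + (Num.sqrt n%:R)^-1 * \sum_(i < n) s (W i w)) @[n --> \oo] -->
  cos c * ncf (Num.sqrt v).
Proof.
move=> bs s0 sv; have [ms [B sB]] := bs.
have B0 : 0 <= B by rewrite (le_trans _ (sB point)).
have v0 : 0 <= v by rewrite -sv; apply: Rintegral_ge0 => x _; exact: sqr_ge0.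
set K4 := \int[stdn]_x (x ^+ 4) : R.
have K40 : 0 <= K4 by apply: Rintegral_ge0 => x _; rewrite exprn_even_ge0.
apply: (@cvg_sqrt_rate _ _ (B ^+ 4 + v ^+ 2 * K4 + B ^+ 3)) => n n0.
set a := (Num.sqrt n%:R)^-1.
have a0 : 0 < a by rewrite invr_gt0 sqrtr_gt0 ltr0n.
have a2 : a ^+ 2 = n%:R^-1 by rewrite exprVn sqr_sqrtr.
have a1 : a <= 1.
  by rewrite invf_le1 ?sqrtr_gt0 ?ltr0n// -[X in X <= _]sqrtr1 ler_wsqrtr// ler1n.
have bas : bmeas (fun x => a * s x) by exact: bmeasZ.
have ms' : measurable_fun setT (fun x => a * s x) by case: bas.
have := cos_sum_iid iidW n c ms' (ncf_le1 (Num.sqrt (v / n%:R))).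
rewrite -ncf_natX ?divr_ge0// -[v / n%:R *+ n]mulr_natr divfK ?pnatr_eq0 -?lt0n//.
under eq_Rintegral do rewrite -mulr_sumr.
move=> /le_trans; apply.
set e := ncf _; set p := \int[P]_x cos _; set r := \int[P]_x sin _.
have asB x : `|a * s x| <= a * B by rewrite normrM (ger0_norm (ltW a0)) ler_wpM2l// ltW.
have bsin : bmeas (fun x => sin (a * s x)) by exact: bmeas_sin.
have bcos : bmeas (fun x => cos (a * s x)) by exact: bmeas_cos.
have hr : `|r| <= (a * B) ^+ 3.
  have -> : r = - \int[P]_x (a * s x - sin (a * s x)).
    by rewrite expB// expZ// s0 mulr0 sub0r opprK.
  rewrite normrN; apply: exp_normM => [|x]; first exact: bmeasB.
  by rewrite (le_trans (sin_taylor _))// lerXn2r// ?nnegrE// mulr_ge0// ltW.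
have hp : `|1 - p - v * a ^+ 2 / 2| <= (a * B) ^+ 4.
  have -> : 1 - p - v * a ^+ 2 / 2 =
      \int[P]_x (1 - cos (a * s x) - (a ^+ 2 / 2) * s x ^+ 2).
    rewrite expB; [|by apply: bmeasB => //; exact: bmeas_cst|by apply: bmeasZ; exact: bmeasX].
    rewrite expB ?exp_cst//; [|exact: bmeas_cst].
    by rewrite expZ ?sv; [congr (_ - _); ring|exact: bmeasX].
  apply: exp_normM; last move=> y.
    apply: bmeasB; first by apply: bmeasB => //; exact: bmeas_cst.
    by apply: bmeasZ; exact: bmeasX.
  have := cos_taylor (a * s y); rewrite exprMn mulrAC => /le_trans; apply.
  have -> : (a * s y) ^+ 4 = `|a * s y| ^+ 4.
    by rewrite -normrX ger0_norm// exprn_even_ge0.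
  by rewrite lerXn2r// ?nnegrE// mulr_ge0// ltW.
have he : `|1 - e - v * a ^+ 2 / 2| <= v ^+ 2 * a ^+ 4 * K4.
  have := ncf_taylor (Num.sqrt (v / n%:R)).
  have -> : Num.sqrt (v / n%:R) ^+ 4 = v ^+ 2 * a ^+ 4.
    by rewrite (exprM _ 2 2) sqr_sqrtr ?divr_ge0// exprMn -a2 -exprM.
  by rewrite -/e sqr_sqrtr ?divr_ge0// -a2.
have hpe : `|p - e| <= (a * B) ^+ 4 + v ^+ 2 * a ^+ 4 * K4.
  have -> : p - e = (1 - e - v * a ^+ 2 / 2) - (1 - p - v * a ^+ 2 / 2) by ring.
  by rewrite (le_trans (ler_normB _ _))// addrC lerD.
have nE : n%:R = a ^- 2 by rewrite a2 invrK.
apply: (@le_trans _ _ (n%:R * ((a * B) ^+ 4 + v ^+ 2 * a ^+ 4 * K4 + (a * B) ^+ 3))).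
  by rewrite ler_wpM2l// lerD.
have -> : n%:R * ((a * B) ^+ 4 + v ^+ 2 * a ^+ 4 * K4 + (a * B) ^+ 3) =
    (B ^+ 4 + v ^+ 2 * K4) * a * a + B ^+ 3 * a.
  by rewrite nE; field; rewrite gt_eqF.
rewrite [leRHS]mulrDl lerD2r ler_piMr// mulr_ge0 ?(ltW a0)// addr_ge0// ?mulr_ge0//.
Qed.

End one_dimensional_clt.

(** * Borel sets of matrices *)

Section borel_matrices.
Context {R : realType} {m n : nat}.
Local Notation MX := 'M[R]_(m, n).

(** Boxes with rational centre and radius 1 / (k + 1): a countable base. *)
Definition mxbox (p : 'M[rat]_(m, n) * nat) : set MX :=
  [set M | forall i j, `|M i j - ratr (p.1 i j)| < p.2.+1%:R^-1].

Lemma mxbox_small (U : set MX) (M : MX) : open U -> U M ->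
  exists2 p, mxbox p M & mxbox p `<=` U.
Proof.
rewrite openE => /(_ M)/[apply] /nbhs_ballP[e /= e0 eU].
(* Two points of a box are at distance less than twice its radius. *)
have [k ke] : exists k, 2 * k.+1%:R^-1 < e.
  exists (Num.truncn (2 / e)).
  by rewrite ltr_pdivrMr ?ltr0n// mulrC -ltr_pdivrMr// truncnS_gt.
have k0 : 0 < k.+1%:R^-1 :> R by rewrite invr_gt0 ltr0n.
have ex i j : exists r : rat, `|M i j - ratr r| < k.+1%:R^-1.
  have /rat_in_itvoo[r] : M i j - k.+1%:R^-1 < M i j + k.+1%:R^-1.
    by rewrite ltrBlDr -addrA ltrDl addr_gt0.
  rewrite in_itv/= => /andP[r1 r2]; exists r; rewrite ltr_norml.
  move: r1 r2; move: (_^-1) (ratr r) (M i j) => dl a b h1 h2.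
  by apply/andP; split; lra.
pose c : 'M[rat]_(m, n) := \matrix_(i, j) xchoose (ex i j).
exists (c, k).
  by move=> i j /=; rewrite mxE; exact: (xchooseP (ex i j)).
move=> N cN; apply: eU; split => // i j.
have := cN i j; rewrite /= mxE => h1; have h2 := xchooseP (ex i j).
rewrite /ball/= (_ : _ - _ = (M i j - ratr (xchoose (ex i j))) -
  (N i j - ratr (xchoose (ex i j)))); last by ring.
rewrite (le_lt_trans (ler_normB _ _))// (lt_trans _ ke)// mulr_natl mulr2n.
exact: ltrD.
Qed.

(** An open set is the union of the countably many rational boxes that it
    contains, and a box is a finite intersection of conditions on the entries. *)
Lemma measurable_mx d (T : measurableType d) (f : T -> MX) :
  (forall i j, measurable_fun setT (fun x => f x i j)) ->
  measurable_fun setT (f : T -> Borel MX).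
Proof.
move=> mf; apply: (@measurability _ _ T (Borel MX) setT f (@open MX) erefl) => _ [U oU <-].
rewrite setTI.
pose F (p : 'M[rat]_(m, n) * nat) : set T :=
  if pselect (mxbox p `<=` U) then f @^-1` mxbox p else set0.
have -> : f @^-1` U = \bigcup_p F p.
  apply/seteqP; split => x /=.
    move=> Ufx; have [p pf pU] := mxbox_small oU Ufx.
    by exists p => //; rewrite /F; case: pselect.
  by move=> [p _]; rewrite /F; case: pselect => // pU /= pf; exact: pU.
apply: countable_bigcupT_measurable => [|p]; first exact: countableP.
rewrite /F; case: pselect => pU; last exact: measurable0.
rewrite [X in measurable X]/=.
have -> : f @^-1` mxbox p = \bigcap_(ij : 'I_m * 'I_n)
    ((fun x => `|f x ij.1 ij.2 - ratr (p.1 ij.1 ij.2)|) @^-1` `]-oo, p.2.+1%:R^-1[%classic).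
  apply/seteqP; split => x /= H; first by move=> [i j] _ /=; rewrite in_itv/=; exact: H.
  by move=> i j; have := H (i, j) I; rewrite /= in_itv.
apply: fin_bigcap_measurable => [|[i j] _]; first exact: finite_finset.
rewrite -[X in measurable X]setTI.
have mfij : measurable_fun setT (fun x => `|f x i j - ratr (p.1 i j)|).
  by apply: measurableT_comp => //; exact: measurable_funB.
by apply: mfij.
Qed.

Lemma measurable_continuous_mx (f : MX -> R) : continuous f ->
  measurable_fun setT (f : Borel MX -> R).
Proof.
move=> /continuousP cf; apply: (measurability _ (RGenOpens.measurableE R)).
move=> _ [_ [a [b ->] <-]]; rewrite setTI; apply: sub_gen_smallest.
by apply: cf; exact: interval_open.
Qed.

Lemma measurable_mxE i j : measurable_fun setT (fun M : Borel MX => M i j).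
Proof. by apply: measurable_continuous_mx; exact: coord_continuous. Qed.

End borel_matrices.

(** * Gaussian random matrices *)

Section frobenius.
Context {R : realType} {m n : nat}.
Implicit Types A B M : 'M[R]_(m, n).

(** The Frobenius inner product, that is the general linear functional. *)
Definition frob A M : R := \sum_k \sum_l A k l * M k l.

Lemma frobDr A M N : frob A (M + N) = frob A M + frob A N.
Proof.
rewrite /frob -big_split; apply: eq_bigr => k _; rewrite -big_split.
by apply: eq_bigr => l _; rewrite mxE mulrDr.
Qed.

Lemma frobZr A (c : R) M : frob A (c *: M) = c * frob A M.
Proof.
rewrite /frob mulr_sumr; apply: eq_bigr => k _; rewrite mulr_sumr.
by apply: eq_bigr => l _; rewrite mxE mulrCA.
Qed.

Lemma frobC A M : frob A M = frob M A.
Proof. by apply: eq_bigr => k _; apply: eq_bigr => l _; rewrite mulrC. Qed.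

Lemma frob0r A : frob A 0 = 0.
Proof. by rewrite /frob big1// => k _; rewrite big1// => l _; rewrite mxE mulr0. Qed.

Lemma frob_delta i j M : frob (delta_mx i j) M = M i j.
Proof.
rewrite /frob (bigD1 i)//= [X in _ + X]big1 ?addr0 => [|k ki]; last first.
  by rewrite big1// => l _; rewrite mxE (negbTE ki) mul0r.
rewrite (bigD1 j)//= [X in _ + X]big1 ?addr0 => [|l lj].
  by rewrite mxE !eqxx mul1r.
by rewrite mxE (negbTE lj) andbF mul0r.
Qed.

End frobenius.

Section gaussian_matrix.
Context {R : realType} {q : nat}.
Local Notation MX := 'M[R]_q.
Local Notation BMX := (Borel MX).

Lemma measurable_frob (A : MX) : measurable_fun setT (fun M : BMX => frob A M).
Proof.
apply: measurable_sum => k; apply: measurable_sum => l.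
by apply: measurable_funM => //; exact: measurable_mxE.
Qed.

Lemma measurable_add_direction (B : MX) :
  measurable_fun setT ((fun p : BMX * R => (p.1 : MX) + p.2 *: B) : BMX * R -> BMX).
Proof.
apply: measurable_mx => i j.
rewrite (_ : (fun p => _) = (fun p : BMX * R => (p.1 : MX) i j + p.2 * B i j)); last first.
  by apply/funext => p; rewrite !mxE.
apply: measurable_funD; last exact: measurable_funM.
exact: (measurableT_comp (measurable_mxE i j) measurable_fst).
Qed.

(** The law of the sum of g_B B over the matrices B of the list, with independent
    standard normal coefficients g_B.  Building the law one direction at a time
    reduces linear functionals to [stdn_sum]. *)
Fixpoint gauss_law (Bs : seq MX) : probability BMX R :=
  if Bs is B :: Bs' then
    image_law (measurable_add_direction B) (prodP (gauss_law Bs') stdn)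
  else \d_((0 : MX) : BMX).

Definition gauss_var (Bs : seq MX) (A : MX) : R := \sum_(B <- Bs) frob A B ^+ 2.

Lemma gauss_var_ge0 Bs A : 0 <= gauss_var Bs A.
Proof. by apply: sumr_ge0 => B _; exact: sqr_ge0. Qed.

(** A linear functional of M + g B is the functional of M plus an independent
    normal variable: induction on the list by stability. *)
Lemma gauss_law_frob Bs A (S : set R) : measurable S ->
  gauss_law Bs ((fun M : MX => frob A M) @^-1` S) =
  stdn ((fun x => Num.sqrt (gauss_var Bs A) * x) @^-1` S).
Proof.
move=> mS; elim: Bs => [|B Bs IH] in S mS *.
  rewrite /gauss_var big_nil sqrtr0.
  transitivity ((\d_((0 : MX) : BMX) : set BMX -> \bar R) ((fun M : MX => frob A M) @^-1` S)) => //.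
  rewrite diracE; case: (boolP (_ \in _)); rewrite ?inE ?notin_setE /= frob0r => S0.
    have -> : (fun x : R => 0 * x) @^-1` S = setT.
      by apply/seteqP; split => // y _ /=; rewrite mul0r.
    by rewrite [RHS]probability_setT.
  have -> : (fun x : R => 0 * x) @^-1` S = set0.
    by apply/seteqP; split => // y /=; rewrite mul0r.
  exact: (esym (measure0 stdn)).
set c := frob A B; pose h (z : R) : \bar R := stdn ((fun y => z + c * y) @^-1` S).
have mh : measurable_fun setT h.
  have mF : measurable_fun setT (fun p : R * R => p.1 + c * p.2).
    by apply: measurable_funD => //; exact: measurable_funM.
  have mFS : measurable ((fun p : R * R => p.1 + c * p.2) @^-1` S).
    exact: (measurable_preim mF).
  have := measurable_fun_xsection stdn mFS.
  by congr (measurable_fun _ _); apply/funext => x; rewrite /= xsectionE.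
have h0 z : (0 <= h z)%E by exact: measure_ge0.
have mA := measurable_frob A.
have msc : measurable_fun setT (fun x : R => Num.sqrt (gauss_var Bs A) * x).
  exact: measurable_funM.
transitivity (\int[gauss_law Bs]_M h (frob A M))%E.
  transitivity (prodP (gauss_law Bs) stdn
    ((fun p : BMX * R => frob A ((p.1 : MX) + p.2 *: B)) @^-1` S)); first by [].
  rewrite prodPE; apply: eq_integral => M _.
  rewrite xsectionE /h; congr (stdn _); apply/seteqP; split => y /=.
    by rewrite frobDr frobZr mulrC.
  by rewrite frobDr frobZr mulrC.
transitivity (\int[image_measure mA (gauss_law Bs)]_z h z)%E.
  by rewrite ge0_integral_pushforward.
rewrite (eq_measure_integral (image_measure msc stdn)); last first.
  by move=> D mD _; exact: IH.
rewrite ge0_integral_pushforward//.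
have -> : gauss_var (B :: Bs) A = Num.sqrt (gauss_var Bs A) ^+ 2 + c ^+ 2.
  by rewrite sqr_sqrtr ?gauss_var_ge0// /gauss_var big_cons addrC.
exact: (stdn_sum c (sqrtr_ge0 _) mS).
Qed.

Lemma exp_gauss_cos Bs A c :
  \int[gauss_law Bs]_M cos (c + frob A M) = cos c * ncf (Num.sqrt (gauss_var Bs A)).
Proof.
have bc : bmeas (fun x : R => cos (c + x)).
  by apply: bmeas_cos; exact: measurable_funD.
have msc : measurable_fun setT (fun x : R => Num.sqrt (gauss_var Bs A) * x).
  exact: measurable_funM.
rewrite (exp_eq_law (measurable_frob A) msc (@gauss_law_frob Bs A) bc).
set s := Num.sqrt _.
have bcs (t : R) : bmeas (fun x : R => cos (t * x)).
  by apply: bmeas_cos; exact: measurable_funM.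
have bsn (t : R) : bmeas (fun x : R => sin (t * x)).
  by apply: bmeas_sin; exact: measurable_funM.
under eq_Rintegral do rewrite cosD.
rewrite expB; [|exact: bmeasZ|exact: bmeasZ].
by rewrite !expZ// exp_sin_stdn mulr0 subr0.
Qed.

Lemma gauss_sqr Bs A :
  (gauss_law Bs).-integrable setT (fun M => (frob A M ^+ 2)%:E) /\
  \int[gauss_law Bs]_M (frob A M ^+ 2) = gauss_var Bs A.
Proof.
set s := Num.sqrt (gauss_var Bs A).
have msc : measurable_fun setT (fun x : R => s * x) by exact: measurable_funM.
have m2 : measurable_fun setT (fun x : R => x ^+ 2) by exact: measurable_funX.
have i2 : stdn.-integrable setT (fun x : R => (s ^+ 2 * x ^+ 2)%:E).
  exact: (integrableZl measurableT (s ^+ 2) (stdn_integrable_X (R := R) (n := 2) isT)).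
have i2' : stdn.-integrable setT (fun x : R => ((s * x) ^+ 2)%:E).
  by under eq_fun do rewrite exprMn.
have [iM ->] := integrable_eq_law (measurable_frob A) msc (@gauss_law_frob Bs A) m2 i2'.
split => //; under eq_Rintegral do rewrite exprMn.
rewrite RintegralZl//; last exact: (stdn_integrable_X (R := R) (n := 2) isT).
by rewrite stdn_sqr mulr1 sqr_sqrtr// gauss_var_ge0.
Qed.

Lemma gauss_mean Bs A :
  (gauss_law Bs).-integrable setT (fun M => (frob A M)%:E) /\
  \int[gauss_law Bs]_M frob A M = 0.
Proof.
set s := Num.sqrt (gauss_var Bs A).
have msc : measurable_fun setT (fun x : R => s * x) by exact: measurable_funM.
have i1 := stdn_integrable_X (R := R) (n := 1) isT.
have iN : \int[stdn]_x x = 0 :> R.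
  have mopp : measurable_fun setT (fun x : R => - x) by exact: oppr_measurable.
  have lawN S : measurable S -> stdn (idfun @^-1` S) = stdn ((fun x : R => - x) @^-1` S).
    by move=> mS; rewrite stdnN.
  have i1N : stdn.-integrable setT (fun x : R => (- x)%:E).
    have := integrableZl measurableT (-1) i1.
    by apply: eq_integrable => // x _; rewrite expr1 -EFinM mulN1r.
  have [_ E] := integrable_eq_law (@measurable_id _ _ setT) mopp lawN (@measurable_id _ _ setT) i1N.
  have : \int[stdn]_x (- x) = -1 * \int[stdn]_x x :> R.
    by rewrite -RintegralZl//; apply: eq_Rintegral => x _; rewrite mulN1r.
  by move: E => /= <-; lra.
have is1 : stdn.-integrable setT (fun x : R => (s * x)%:E).
  exact: (integrableZl measurableT s i1).
have [iM ->] := integrable_eq_law (measurable_frob A) msc (@gauss_law_frob Bs A)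
  (@measurable_id _ _ setT) is1.
split => //; by rewrite RintegralZl// iN mulr0.
Qed.

(** By polarization, since only second moments of linear functionals are known. *)
Lemma gauss_covariance Bs k l s t :
  covariance (gauss_law Bs) (fun M : MX => M k l) (fun M : MX => M s t) =
  (\sum_(B <- Bs) B k l * B s t)%:E.
Proof.
have mean0 i j : expectation (gauss_law Bs) (fun M : BMX => (M : MX) i j) = 0%E.
  have [iM E] := gauss_mean Bs (delta_mx i j).
  rewrite unlock -[RHS]/(0%:E) -E /Rintegral fineK; last exact: integrable_fin_num.
  by apply: eq_integral => M _; rewrite frob_delta.
rewrite unlock !mean0 /= unlock.
(* 4 x y = (x + y)^2 - (x - y)^2. *)
pose A1 : MX := delta_mx k l + delta_mx s t.
pose A2 : MX := delta_mx k l + -1 *: delta_mx s t.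
have frob1 M : frob A1 M = M k l + M s t by rewrite frobC frobDr !(frobC M) !frob_delta.
have frob2 M : frob A2 M = M k l - M s t.
  by rewrite frobC frobDr frobZr !(frobC M) !frob_delta mulN1r.
have [i1 E1] := gauss_sqr Bs A1; have [i2 E2] := gauss_sqr Bs A2.
transitivity ((\int[gauss_law Bs]_M (4^-1 * frob A1 M ^+ 2 - 4^-1 * frob A2 M ^+ 2))%:E).
  rewrite /Rintegral fineK; last first.
    apply: integrable_fin_num => //.
    exact: (integrableB measurableT (integrableZl measurableT 4^-1 i1)
      (integrableZl measurableT 4^-1 i2)).
  apply: eq_integral => M _; rewrite frob1 frob2; congr EFin.
  transitivity ((M k l - 0) * (M s t - 0)); first by [].
  by rewrite !subr0; field.
rewrite RintegralB//; last 2 first.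
- exact: (integrableZl measurableT 4^-1 i1).
- exact: (integrableZl measurableT 4^-1 i2).
rewrite !RintegralZl// E1 E2 /gauss_var !mulr_sumr -sumrB; congr EFin.
by apply: eq_bigr => B _; rewrite frob1 frob2; field.
Qed.

Lemma gauss_law_centered (Bs : seq MX) (C : 'I_q -> 'I_q -> 'I_q -> 'I_q -> R) :
  (forall k l s t, \sum_(B <- Bs) B k l * B s t = C k l s t) ->
  centered_gaussian C (gauss_law Bs).
Proof.
move=> CE; split => [A|k l s t]; last by rewrite gauss_covariance CE.
exists (Num.sqrt (gauss_var Bs A)) => S mS.
have -> : gauss_law Bs [set M : MX | S (\sum_k \sum_l A k l * M k l)] =
  stdn ((fun x => Num.sqrt (gauss_var Bs A) * x) @^-1` S) by exact: gauss_law_frob.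
case: eqP => [->|/eqP s0].
  rewrite diracE; case: (boolP (_ \in _)); rewrite ?inE ?notin_setE /= => S0.
    have -> : (fun x : R => 0 * x) @^-1` S = setT.
      by apply/seteqP; split => // y _ /=; rewrite mul0r.
    by rewrite [LHS]probability_setT.
  have -> : (fun x : R => 0 * x) @^-1` S = set0.
    by apply/seteqP; split => // y /=; rewrite mul0r.
  exact: (measure0 stdn).
rewrite -stdn_affine//; last by rewrite lt0r s0 sqrtr_ge0.
by congr (stdn _); apply/seteqP; split => x /=; rewrite add0r.
Qed.

End gaussian_matrix.

(** * Factorization of positive semidefinite matrices *)

Section cholesky.
Context {R : realType}.

Definition psd n (S : 'M[R]_n) :=
  S^T = S /\ forall x : 'rV[R]_n, 0 <= (x *m S *m x^T) 0 0.

Lemma psd_block n (S : 'M[R]_(1 + n)) (x : 'rV[R]_1) (y : 'rV[R]_n) : S^T = S ->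
  row_mx x y *m S *m (row_mx x y)^T =
  x *m ulsubmx S *m x^T + y *m (ursubmx S)^T *m x^T
  + (x *m ursubmx S *m y^T + y *m drsubmx S *m y^T).
Proof.
move=> Sym; rewrite -{1}(submxK S) mul_row_block tr_row_mx mul_row_col !mulmxDl.
by rewrite trmx_ursub Sym.
Qed.

(** One step of block elimination: when the corner a is positive the Schur
    complement is again positive semidefinite; when a vanishes so does the whole
    first row. *)
Lemma cholesky_step n (S : 'M[R]_(1 + n)) :
  (forall C : 'M[R]_n, psd C -> exists A : 'M[R]_n, C = A *m A^T) ->
  psd S -> exists A : 'M[R]_(1 + n), S = A *m A^T.
Proof.
move=> IH [Sym pos].
have E x y := @psd_block n S x y Sym.
set a := @ulsubmx R 1 n 1 n S in E; set b := @ursubmx R 1 n 1 n S in E.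
set C := @drsubmx R 1 n 1 n S in E.
have posE x y := pos (@row_mx R 1 1 n x y).
have SE : S = block_mx a b b^T C by rewrite trmx_ursub Sym submxK.
have CT : C^T = C by rewrite /C trmx_drsub Sym.
pose a0 := a 0 0; have aE : a = a0%:M by rewrite [LHS]mx11_scalar.
have a_ge0 : 0 <= a0.
  have := posE 1%:M 0; rewrite E !mul0mx trmx0 !mulmx0 !addr0 trmx1 mul1mx mulmx1.
  by [].
have [a_eq0|a_neq0] := eqVneq a0 0.
  have a_0 : a = 0 by rewrite aE a_eq0 raddf0.
  (* With a = 0 the form is affine in the first coordinate; a nonzero slope makes
     it negative at this value of the coordinate. *)
  have neg (c e : R) : e != 0 ->
      0 <= - (c + 1) / (2 * e) * e + (- (c + 1) / (2 * e) * e + c) -> false.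
    move=> e0; have -> : - (c + 1) / (2 * e) * e + (- (c + 1) / (2 * e) * e + c) = -1.
      by field.
    by rewrite lerNr oppr0 ler10.
  have b0 : b = 0.
    apply/matrixP => i j; rewrite ord1 [RHS]mxE; apply/eqP; apply: contraT => bj.
    have := posE (- (C j j + 1) / (2 * b 0 j))%:M (delta_mx 0 j).
    rewrite E a_0 mulmx0 mul0mx add0r.
    rewrite tr_scalar_mx trmx_delta -!rowE !mul_mx_scalar mul_scalar_mx.
    rewrite -!colE; move: bj; rewrite !mxE.
    exact: neg.
  have [|A' CE] := IH C.
    split=> // y; have := posE 0 y.
    by rewrite E trmx0 !mulmx0 !mul0mx !add0r.
  exists (@block_mx R 1 n 1 n 0 0 0 A').
  by rewrite SE a_0 b0 CE tr_block_mx mulmx_block !trmx0 !mulmx0 !mul0mx !addr0 !add0r.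
have a_gt0 : 0 < a0 by rewrite lt0r a_neq0.
pose r := Num.sqrt a0.
have r_neq0 : r != 0 by rewrite gt_eqF// sqrtr_gt0.
have r2 : r * r = a0 by rewrite -expr2 sqr_sqrtr.
have [|A' SchurE] := IH (C - a0^-1 *: (b^T *m b)).
  split=> [|y].
    by rewrite linearB/= CT linearZ/= trmx_mul trmxK.
  pose v := y *m b^T; have vT : v^T = b *m y^T by rewrite trmx_mul trmxK.
  have := posE (- a0^-1 *: v) y.
  have -> : row_mx (- a0^-1 *: v) y *m S *m (row_mx (- a0^-1 *: v) y)^T =
      y *m (C - a0^-1 *: (b^T *m b)) *m y^T; last by [].
  rewrite E aE mul_mx_scalar -/v.
  have -> : (- a0^-1 *: v)^T = - a0^-1 *: (b *m y^T) by rewrite linearZ/= vT.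
  rewrite scalerA mulrN mulfV// scaleN1r mulNmx -scalemxAr.
  rewrite addNr add0r -!scalemxAl mulmxBr mulmxBl -scalemxAr -scalemxAl mulmxA -/v.
  by rewrite scaleNr addrC.
exists (@block_mx R 1 n 1 n r%:M 0 (r^-1 *: b^T) A').
rewrite SE aE tr_block_mx mulmx_block !trmx0 !mulmx0 !mul0mx !addr0 -SchurE.
rewrite tr_scalar_mx -scalar_mxM r2 linearZ/= trmxK.
rewrite mul_scalar_mx mul_mx_scalar !scalerA !mulfV// !scale1r.
rewrite -scalemxAl -scalemxAr scalerA -invfM r2.
by rewrite addrCA subrr addr0.
Qed.

Lemma cholesky n (S : 'M[R]_n) : psd S -> exists A : 'M[R]_n, S = A *m A^T.
Proof.
elim: n S => [|n IH] S; first by move=> _; exists 0; rewrite flatmx0 [RHS]flatmx0.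
exact: (@cholesky_step n S IH).
Qed.

End cholesky.

(** * Bernstein polynomials in sines *)

Section bernstein.
Context {R : realType}.
Implicit Types (u a : R) (h : nat -> R).

(** The Bernstein basis polynomial 'C(N, k) u^k (1 - u)^(N - k), given by its
    recursion in N so that moments are computed by induction. *)
Fixpoint bern (N k : nat) u : R :=
  match N, k with
  | 0, 0 => 1
  | 0, _.+1 => 0
  | N'.+1, 0 => (1 - u) * bern N' 0 u
  | N'.+1, k'.+1 => u * bern N' k' u + (1 - u) * bern N' k u
  end.

Lemma bern_ge0 N k u : 0 <= u <= 1 -> 0 <= bern N k u.
Proof.
move=> /andP[u0 u1]; have v0 : 0 <= 1 - u by rewrite subr_ge0.
elim: N k => [|N IH] [|k] //=; first by rewrite mulr_ge0.
by rewrite addr_ge0 ?mulr_ge0.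
Qed.

Lemma bern_big N k u : (N < k)%N -> bern N k u = 0.
Proof.
elim: N k => [|N IH] [|k] //= Nk.
by rewrite !IH ?mulr0 ?addr0// ltnW.
Qed.

(** One more Bernoulli(u) trial: the mean of h is a mixture of the means of h
    shifted by the outcome. *)
Lemma bern_sumS N h u : \sum_(k < N.+2) h k * bern N.+1 k u =
  u * (\sum_(k < N.+1) h k.+1 * bern N k u) +
  (1 - u) * (\sum_(k < N.+1) h k * bern N k u).
Proof.
rewrite big_ord_recl /= /bump /=.
under eq_bigr do rewrite /bump /= add1n mulrDr.
rewrite big_split /= mulr_sumr addrCA; congr (_ + _).
  by apply: eq_bigr => k _; rewrite mulrCA.
rewrite mulr_sumr [RHS]big_ord_recl /= mulrCA; congr (_ + _).
rewrite big_ord_recr /= bern_big// !mulr0 addr0.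
by apply: eq_bigr => k _; rewrite /bump /= add1n mulrCA.
Qed.

Lemma bern_sum1 N u : \sum_(k < N.+1) bern N k u = 1.
Proof.
elim: N => [|N IH]; first by rewrite big_ord1.
have := bern_sumS N (fun=> 1) u.
under eq_bigr do rewrite mul1r; move=> ->.
by under eq_bigr do rewrite mul1r; rewrite IH; ring.
Qed.

Lemma bern_variance N a u :
  \sum_(k < N.+1) (k%:R - a) ^+ 2 * bern N k u =
  N%:R * u * (1 - u) + (N%:R * u - a) ^+ 2.
Proof.
elim: N a => [|N IH] a; first by rewrite big_ord1 /=; ring.
rewrite (bern_sumS N (fun k => (k%:R - a) ^+ 2)) IH.
have -> : \sum_(k < N.+1) (k.+1%:R - a) ^+ 2 * bern N k u =
    N%:R * u * (1 - u) + (N%:R * u - (a - 1)) ^+ 2.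
  rewrite -IH; apply: eq_bigr => k _; congr (_ ^+ 2 * _).
  by rewrite -natr1; ring.
by rewrite -natr1; ring.
Qed.

(** The variance of the mean of N Bernoulli trials is at most 1 / N. *)
Lemma bern_concentration N u : 0 <= u <= 1 -> (0 < N)%N ->
  \sum_(k < N.+1) (k%:R / N%:R - u) ^+ 2 * bern N k u <= N%:R^-1.
Proof.
move=> /andP[u0 u1] N0; have N0' : 0 < N%:R :> R by rewrite ltr0n.
have -> : \sum_(k < N.+1) (k%:R / N%:R - u) ^+ 2 * bern N k u =
    N%:R ^- 2 * \sum_(k < N.+1) (k%:R - N%:R * u) ^+ 2 * bern N k u.
  rewrite mulr_sumr; apply: eq_bigr => k _; rewrite mulrA; congr (_ * _).
  by field; rewrite gt_eqF.
rewrite bern_variance subrr expr0n/= addr0.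
have -> : N%:R ^- 2 * (N%:R * u * (1 - u)) = N%:R^-1 * (u * (1 - u)).
  by field; rewrite gt_eqF.
by rewrite ler_piMr ?invr_ge0 ?ltW//; nra.
Qed.

End bernstein.

Section product_weights.
Context {R : realType} {I : finType} (N : nat) (b : I -> 'I_N -> R).
Hypothesis b1 : forall i, \sum_k b i k = 1.

Lemma product_weights_sum1 : \sum_(K : {ffun I -> 'I_N}) \prod_i b i (K i) = 1.
Proof. by rewrite -(bigA_distr_bigA b) big1. Qed.

(** A sum over multi-indices of products of weights factors, and all the factors
    but the one at j are one. *)
Lemma product_weights_marginal (h : 'I_N -> R) (j : I) :
  \sum_(K : {ffun I -> 'I_N}) h (K j) * \prod_i b i (K i) = \sum_k h k * b j k.
Proof.
pose c i k := if i == j then h k * b i k else b i k.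
transitivity (\sum_(K : {ffun I -> 'I_N}) \prod_i c i (K i)).
  apply: eq_bigr => K _; rewrite (bigD1 j)//= [RHS](bigD1 j)//= mulrA /c eqxx.
  by congr (_ * _); apply: eq_bigr => i /negbTE ij; rewrite ij.
rewrite -(bigA_distr_bigA c) (bigD1 j)//= [X in _ * X]big1 ?mulr1.
  by apply: eq_bigr => k _; rewrite /c eqxx.
by move=> i /negbTE ij; under eq_bigr do rewrite /c ij; exact: b1.
Qed.

End product_weights.

Section sine_chart.
Context {R : realType}.
Variable L : R.
Hypothesis L0 : 0 < L.
Implicit Types x y u : R.

(** An increasing bijection from [-L, L] onto [0, 1] which is a trigonometric
    polynomial: Bernstein polynomials in it are trigonometric polynomials. *)
Definition sine_chart x := (1 + sin (pi / 2 / L * x)) / 2.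

Definition sine_node u := asin (2 * u - 1) / (pi / 2 / L).

Let w0 : 0 < pi / 2 / L :> R. Proof. by rewrite !divr_gt0// pi_gt0. Qed.

Lemma sine_chart01 x : 0 <= sine_chart x <= 1.
Proof.
have := sin_geN1 (pi / 2 / L * x); have := sin_le1 (pi / 2 / L * x).
by rewrite /sine_chart => ? ?; apply/andP; split; lra.
Qed.

Lemma sine_nodeK u : 0 <= u <= 1 -> sine_chart (sine_node u) = u.
Proof.
move=> /andP[u0 u1]; rewrite /sine_chart /sine_node.
have -> : pi / 2 / L * (asin (2 * u - 1) / (pi / 2 / L)) = asin (2 * u - 1).
  by rewrite mulrC divfK ?gt_eqF.
by rewrite asinK ?in_itv/=; [field|apply/andP; split; lra].
Qed.

Lemma sine_node_bound u : 0 <= u <= 1 -> `|sine_node u| <= L.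
Proof.
move=> /andP[u0 u1].
have h : -1 <= 2 * u - 1 <= 1 by apply/andP; split; lra.
rewrite ler_norml /sine_node ler_pdivlMr// ler_pdivrMr//.
have -> : L * (pi / 2 / L) = pi / 2 by field; rewrite gt_eqF.
have -> : - L * (pi / 2 / L) = - (pi / 2) by field; rewrite gt_eqF.
by rewrite asin_geNpi2// asin_lepi2.
Qed.

(** Both sides are 2 sin q times a cosine or a sine, with q half of the
    difference; the cosine of the midpoint is at least sin q because the midpoint
    is at distance at least q from the ends of the interval. *)
Lemma sin_gap (a b : R) : - (pi / 2) <= b -> b <= a -> a <= pi / 2 ->
  1 - cos (a - b) <= sin a - sin b.
Proof.
move=> hb ba ha.
pose p := (a + b) / 2; pose q := (a - b) / 2.
have aE : a = p + q by rewrite /p /q; field.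
have bE : b = p - q by rewrite /p /q; field.
have q0 : 0 <= q by rewrite divr_ge0// subr_ge0.
have pi0 := @pi_gt0 R.
have -> : sin a - sin b = 2 * (cos p * sin q) by rewrite aE bE sinD sinB; ring.
rewrite oneBcosE -/q expr2 ler_wpM2l// ler_wpM2r//.
  by apply: sin_ge0_pi; apply/andP; split => //; rewrite /q; lra.
have -> : sin q = cos (pi / 2 - q) by rewrite cosB cos_pihalf sin_pihalf; ring.
rewrite -(cos_norm p).
have h1 : `|p| <= pi / 2 - q by rewrite ler_norml /p /q; apply/andP; split; lra.
have [->//|ne] := eqVneq `|p| (pi / 2 - q).
have m1 : pi / 2 - q \in `[0, pi].
  by rewrite in_itv/= (le_trans (normr_ge0 p) h1)/=; move: pi0 q0; clearbody q; lra.
have m2 : `|p| \in `[0, pi].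
  by rewrite in_itv/= normr_ge0/= (le_trans h1)//; move: pi0 q0; clearbody q; lra.
by apply/ltW; rewrite (ltr_cos m2 m1) lt_neqAle ne.
Qed.

(** A quantitative form of injectivity: points at distance at least e have images
    at a distance bounded below independently of the points. *)
Lemma sine_chart_gap x y (e : R) : `|x| <= L -> `|y| <= L -> 0 < e ->
  e <= `|x - y| -> e <= L ->
  (1 - cos (pi / 2 / L * e)) / 2 <= `|sine_chart x - sine_chart y|.
Proof.
move=> xL yL e0; wlog yx : x y xL yL / y <= x => [H|].
  have [yx|/ltW xy] := leP y x; first exact: H.
  by rewrite distrC [X in _ -> _ -> _ <= X]distrC; exact: H.
rewrite ger0_norm ?subr_ge0// => exy eL.
have pi0 := @pi_gt0 R.
have wL : pi / 2 / L * L = pi / 2 by field; rewrite gt_eqF.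
have bnd z : `|z| <= L -> - (pi / 2) <= pi / 2 / L * z <= pi / 2.
  rewrite ler_norml => /andP[z1 z2]; apply/andP; split.
    have -> : - (pi / 2) = pi / 2 / L * - L by rewrite mulrN wL.
    by rewrite ler_pM2l.
  have h : pi / 2 / L * z <= pi / 2 / L * L by rewrite ler_pM2l.
  by rewrite wL in h.
have /andP[_ hx] := bnd _ xL; have /andP[hy _] := bnd _ yL.
have hyx : pi / 2 / L * y <= pi / 2 / L * x by rewrite ler_pM2l.
have := sin_gap hy hyx hx; rewrite -mulrBr => gap.
have cosle : cos (pi / 2 / L * (x - y)) <= cos (pi / 2 / L * e).
  have [->//|ne] := eqVneq e (x - y).
  have m1 : pi / 2 / L * (x - y) \in `[0, pi].
    by rewrite in_itv/= mulr_ge0 ?(ltW w0) ?subr_ge0//= mulrBr; lra.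
  have m2 : pi / 2 / L * e \in `[0, pi].
    rewrite in_itv/= mulr_ge0 ?(ltW w0) ?(ltW e0)//=.
    by have := bnd e; rewrite gtr0_norm// => /(_ eL) /andP[_]; lra.
  by apply/ltW; rewrite (ltr_cos m2 m1) ltr_pM2l// lt_neqAle ne.
rewrite (le_trans _ (ler_norm _))// /sine_chart.
by move: gap cosle; move: (sin _) (sin _) (cos _) (cos _) => s1 s2 c1 c2; lra.
Qed.

End sine_chart.

(** * Trigonometric polynomials on matrices *)

Section trigonometric_polynomials.
Context {R : realType} {m n : nat}.
Local Notation MX := 'M[R]_(m, n).

(** The real span of the functions cos (c + <A, M>); closed under products by the
    product formula for cosines. *)
Inductive trigpoly : (MX -> R) -> Prop :=
| trigpoly_cos A c : trigpoly (fun M => cos (c + frob A M))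
| trigpolyD f g : trigpoly f -> trigpoly g -> trigpoly (fun M => f M + g M)
| trigpolyZ a f : trigpoly f -> trigpoly (fun M => a * f M).

Lemma frobDl (A B M : MX) : frob (A + B) M = frob A M + frob B M.
Proof. by rewrite frobC frobDr !(frobC M). Qed.

Lemma frobZl (a : R) (A M : MX) : frob (a *: A) M = a * frob A M.
Proof. by rewrite frobC frobZr (frobC M). Qed.

Lemma trigpoly_cst a : trigpoly (fun=> a).
Proof.
have := trigpolyZ a (trigpoly_cos 0 0); congr trigpoly; apply/funext => M.
by rewrite frobC frob0r addr0 cos0 mulr1.
Qed.

Lemma trigpolyM f g : trigpoly f -> trigpoly g -> trigpoly (fun M => f M * g M).
Proof.
move=> tf; elim: tf g => [A c|f1 f2 _ IH1 _ IH2|a f1 _ IH1] g tg.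
- elim: tg => [B e|g1 g2 _ IH1 _ IH2|a g1 _ IH1].
  + have := trigpolyD (trigpolyZ 2^-1 (trigpoly_cos (A + B) (c + e)))
              (trigpolyZ 2^-1 (trigpoly_cos (A + -1 *: B) (c - e))).
    congr trigpoly; apply/funext => M; rewrite !frobDl frobZl mulN1r.
    have -> : c + e + (frob A M + frob B M) = (c + frob A M) + (e + frob B M) by ring.
    have -> : c - e + (frob A M - frob B M) = (c + frob A M) - (e + frob B M) by ring.
    by rewrite cosD cosB; field.
  + by have := trigpolyD IH1 IH2; congr trigpoly; apply/funext => M; rewrite mulrDr.
  + by have := trigpolyZ a IH1; congr trigpoly; apply/funext => M; rewrite mulrCA.
- by have := trigpolyD (IH1 g tg) (IH2 g tg); congr trigpoly; apply/funext => M; rewrite mulrDl.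
- by have := trigpolyZ a (IH1 g tg); congr trigpoly; apply/funext => M; rewrite mulrA.
Qed.

Lemma trigpoly_sum I (s : seq I) (F : I -> MX -> R) :
  (forall i, trigpoly (F i)) -> trigpoly (fun M => \sum_(i <- s) F i M).
Proof.
move=> tF; elim: s => [|i s IH].
  by have := trigpoly_cst 0; congr trigpoly; apply/funext => M; rewrite big_nil.
by have := trigpolyD (tF i) IH; congr trigpoly; apply/funext => M; rewrite big_cons.
Qed.

Lemma trigpoly_prod I (s : seq I) (F : I -> MX -> R) :
  (forall i, trigpoly (F i)) -> trigpoly (fun M => \prod_(i <- s) F i M).
Proof.
move=> tF; elim: s => [|i s IH].
  by have := trigpoly_cst 1; congr trigpoly; apply/funext => M; rewrite big_nil.
by have := trigpolyM (tF i) IH; congr trigpoly; apply/funext => M; rewrite big_cons.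
Qed.

Lemma trigpoly_bern N k u : trigpoly u -> trigpoly (fun M => bern N k (u M)).
Proof.
move=> tu; have tv : trigpoly (fun M => 1 - u M).
  have := trigpolyD (trigpoly_cst 1) (trigpolyZ (-1) tu).
  by congr trigpoly; apply/funext => M; rewrite mulN1r.
elim: N k => [|N IH] [|k] /=; do ?exact: trigpoly_cst.
  exact: trigpolyM.
by apply: trigpolyD; exact: trigpolyM.
Qed.

Lemma trigpoly_sine_chart (L : R) i j : trigpoly (fun M => sine_chart L (M i j)).
Proof.
have := trigpolyZ 2^-1 (trigpolyD (trigpoly_cst 1)
  (trigpoly_cos ((pi / 2 / L) *: delta_mx i j) (- (pi / 2)))).
congr trigpoly; apply/funext => M.
by rewrite frobZl frob_delta addrC addrC [- _ + _]addrC cosBpihalf mulrC.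
Qed.

End trigonometric_polynomials.

Section uniform_continuity.
Context {R : realType} {m n : nat}.
Local Notation MX := 'M[R]_(m, n).

Definition mxcube (L : R) : set MX := [set M | forall i j, `|M i j| <= L].

Lemma continuous_vec_mx : continuous (vec_mx : 'rV[R]_(m * n) -> MX).
Proof.
move=> v U /nbhs_ballP[e /= e0 eU]; apply/nbhs_ballP; exists e => //= w [_ vw].
by apply: eU; split => // i j; rewrite !mxE; exact: vw.
Qed.

Lemma compact_mxcube (L : R) : compact (mxcube L).
Proof.
have -> : mxcube L = (vec_mx : 'rV[R]_(m * n) -> MX) @`
    [set v : 'rV[R]_(m * n) | forall k, `[- L, L]%classic (v ord0 k)].
  apply/seteqP; split => M /=.
    move=> ML; exists (mxvec M); last exact: mxvecK.
    by move=> k; case/mxvec_indexP: k => i j; rewrite mxvecE /= in_itv/= -ler_norml.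
  by move=> [v vL <-] i j; rewrite mxE ler_norml; have := vL (mxvec_index i j); rewrite /= in_itv.
apply: continuous_compact; last first.
  by apply: (@rV_compact R (m * n) (fun=> `[- L, L]%classic)) => k; exact: segment_compact.
by apply: continuous_subspaceT => v; exact: continuous_vec_mx.
Qed.

(** Uniform continuity near a compact set, where only the first point is confined
    to the cube. *)
Lemma mxcube_unif_continuous (f : MX -> R) (L e : R) : continuous f -> 0 < e ->
  exists2 r : R, 0 < r & forall M N : MX, mxcube L M -> (forall i j, `|M i j - N i j| < r) ->
    `|f M - f N| < e.
Proof.
move=> cf e0.
have /compact_near_coveringP cov := @compact_mxcube L.
have [|r /= r0 rP] := cov R (0^'+) (fun (r : R) (M : MX) => forall N : MX,
    (forall i j, `|M i j - N i j| < r) -> `|f M - f N| < e) _.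
  move=> M _.
  have /cvgrPdist_lt /(_ (e / 2)) := cf M.
  rewrite divr_gt0// => /(_ isT) /nbhs_ballP[r /= r0 rM].
  exists (ball M (r / 2), [set t | t < r / 2]) => /=.
    split; first by apply: nbhsx_ballx; rewrite divr_gt0.
    by apply: nbhs_right_lt; rewrite divr_gt0.
  move=> [N t] /= [[_ MN] tr] N' NN'.
  have h1 := rM N; have h2 := rM N'.
  have {}h1 : `|f M - f N| < e / 2.
    apply: h1; split => // i j; apply: (lt_trans (MN i j)).
    by rewrite ltr_pdivrMr// ltr_pMr// ltr1n.
  have {}h2 : `|f M - f N'| < e / 2.
    apply: h2; split => // i j; rewrite /ball/=.
    have -> : M i j - N' i j = (M i j - N i j) + (N i j - N' i j) by ring.
    rewrite (le_lt_trans (ler_normD _ _))// [ltRHS]splitr ltrD//; first exact: MN.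
    exact: lt_trans (NN' i j) tr.
  have -> : f N - f N' = (f M - f N') - (f M - f N) by ring.
  by rewrite (le_lt_trans (ler_normB _ _))// [ltRHS]splitr ltrD.
exists (r / 2); first by rewrite divr_gt0.
move=> M N ML; apply: (rP (r / 2)) => //; rewrite ?divr_gt0//.
by rewrite /ball_/= sub0r normrN gtr0_norm ?divr_gt0// ltr_pdivrMr// ltr_pMr// ltr1n.
Qed.

End uniform_continuity.

(** * Uniform approximation on cubes *)

Section trigonometric_density.
Context {R : realType} {m n : nat}.
Local Notation MX := 'M[R]_(m, n).
Local Notation I := ('I_m * 'I_n)%type.

(** The approximation is the multivariate Bernstein polynomial of f in the charts
    of the entries: an average of values of f at grid matrices with weights
    concentrated near the chart of M.  Averaging preserves the bound B outside the
    cube as well, which is what makes tightness sufficient. *)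
Lemma trigpoly_dense (f : MX -> R) (B L e : R) : continuous f ->
  (forall M, `|f M| <= B) -> 0 < L -> 0 < e ->
  exists g, [/\ trigpoly g, forall M, `|g M| <= B &
                forall M, mxcube L M -> `|f M - g M| <= e].
Proof.
move=> cf fB L0 e0.
have B0 : 0 <= B by rewrite (le_trans _ (fB 0)).
have e2 : 0 < e / 2 by rewrite divr_gt0.
have [r r0 unif] := mxcube_unif_continuous L cf e2.
(* [sine_chart_gap] only holds for separations up to L. *)
pose e1 := Num.min r L.
have e10 : 0 < e1 by rewrite lt_min r0.
have e1L : e1 <= L by rewrite ge_min lexx orbT.
have e1r : e1 <= r by rewrite ge_min lexx.
pose gam := (1 - cos (pi / 2 / L * e1)) / 2.
have gam0 : 0 < gam.
  have pi0 := @pi_gt0 R.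
  have w0 : 0 < pi / 2 / L by rewrite !divr_gt0.
  rewrite divr_gt0// subr_gt0 -[ltRHS](@cos0 R) ltr_cos ?in_itv/= ?lexx ?(ltW pi0)//.
    by rewrite mulr_gt0.
  rewrite mulr_ge0 ?(ltW w0) ?(ltW e10)//=.
  have : pi / 2 / L * e1 <= pi / 2 / L * L by rewrite ler_pM2l.
  have -> : pi / 2 / L * L = pi / 2 by rewrite divfK ?gt_eqF.
  by lra.
(* At nodes separated from M by e1 in some entry the squared distance of the
   charts is at least gam^2, so that c times it dominates the oscillation 2 B;
   N makes the mean of this term small. *)
pose c := 2 * B / gam ^+ 2.
have c0 : 0 <= c by rewrite divr_ge0 ?mulr_ge0// sqr_ge0.
pose N := (Num.truncn (c * #|{: I}|%:R / (e / 2))).+1.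
have N0 : 0 < N%:R :> R by rewrite ltr0n.
have NP : c * #|{: I}|%:R / N%:R <= e / 2.
  by rewrite ler_pdivrMr// [leRHS]mulrC -ler_pdivrMr// ltW// truncnS_gt.
pose u (i : I) (M : MX) := sine_chart L (M i.1 i.2).
have u01 i M : 0 <= u i M <= 1 by exact: sine_chart01.
pose w (K : {ffun I -> 'I_N.+1}) M := \prod_i bern N (K i) (u i M).
have w_ge0 K M : 0 <= w K M by apply: prodr_ge0 => i _; exact: bern_ge0.
have b1 M (j : I) : \sum_(k < N.+1) bern N k (u j M) = 1 by exact: bern_sum1.
have w1 M : \sum_K w K M = 1.
  exact: (product_weights_sum1 (b1 M)).
pose t (k : 'I_N.+1) : R := k%:R / N%:R.
have t01 k : 0 <= t k <= 1.
  by rewrite /t divr_ge0//= ler_pdivrMr// mul1r ler_nat -ltnS.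
pose node (K : {ffun I -> 'I_N.+1}) : MX := \matrix_(i, j) sine_node L (t (K (i, j))).
pose g (M : MX) := \sum_K f (node K) * w K M.
exists g; split.
- apply: trigpoly_sum => K; apply: trigpolyZ; apply: trigpoly_prod => i.
  by apply: trigpoly_bern; exact: trigpoly_sine_chart.
- move=> M; rewrite (le_trans (ler_norm_sum _ _ _))// -[leRHS]mulr1 -(w1 M) mulr_sumr.
  by apply: ler_sum => K _; rewrite normrM (ger0_norm (w_ge0 K M)) ler_wpM2r.
move=> M ML.
have key K : `|f M - f (node K)| <= e / 2 + c * \sum_i (t (K i) - u i M) ^+ 2.
  have [near|/existsNP[i /existsNP[j /negP]]] :=
      pselect (forall i j, `|M i j - node K i j| < r).
    rewrite (le_trans (ltW (unif M (node K) ML near)))// lerDl mulr_ge0// sumr_ge0// => i _.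
    exact: sqr_ge0.
  rewrite -leNgt mxE => far.
  apply: (@le_trans _ _ (2 * B)).
    by rewrite (le_trans (ler_normB _ _))// mulr_natl mulr2n lerD.
  rewrite -[leLHS]add0r lerD ?(ltW e2)//.
  have gap := sine_chart_gap L0 (ML i j) (sine_node_bound L0 (t01 (K (i, j)))) e10
    (le_trans e1r far) e1L.
  rewrite sine_nodeK// -/gam in gap.
  have gam2 : gam ^+ 2 <= (t (K (i, j)) - u (i, j) M) ^+ 2.
    rewrite -[leRHS]real_normK ?num_real// distrC lerXn2r// nnegrE//.
    exact: ltW.
  have : gam ^+ 2 <= \sum_i (t (K i) - u i M) ^+ 2.
    rewrite (bigD1 (i, j))//= (le_trans gam2)// lerDl sumr_ge0// => k _.
    exact: sqr_ge0.
  move=> /(ler_wpM2l c0); apply: le_trans.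
  by rewrite /c divfK// gt_eqF// exprn_gt0.
have -> : f M - g M = \sum_K (f M - f (node K)) * w K M.
  rewrite -[f M]mulr1 -{1}(w1 M) mulr_sumr -sumrB.
  by apply: eq_bigr => K _; rewrite mulr1 mulrBl.
apply: (le_trans (ler_norm_sum _ _ _)).
apply: (@le_trans _ _ (\sum_(K : {ffun I -> 'I_N.+1})
    (e / 2 + c * \sum_i (t (K i) - u i M) ^+ 2) * w K M)).
  by apply: ler_sum => K _; rewrite normrM (ger0_norm (w_ge0 K M)) ler_wpM2r.
under eq_bigr do rewrite mulrDl -[c * _ * _]mulrA mulr_suml.
rewrite big_split/= -mulr_sumr w1 mulr1 -mulr_sumr exchange_big/=.
rewrite [leRHS]splitr lerD2l (le_trans _ NP)// -mulrA ler_wpM2l//.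
rewrite -[#|{: I}|]sum1_card natr_sum mulr_suml.
apply: ler_sum => i _; rewrite mul1r.
rewrite (product_weights_marginal (b1 M) (fun k => (t k - u i M) ^+ 2)).
exact: bern_concentration.
Qed.

End trigonometric_density.

(** * Characteristic functions and convergence in law *)

Section levy.
Context {R : realType} {m n : nat}.
Local Notation MX := 'M[R]_(m, n).
Local Notation BMX := (Borel MX).

Lemma measurable_mxcube (L : R) : measurable (mxcube L : set BMX).
Proof.
have -> : (mxcube L : set BMX) = \bigcap_(i in [set: 'I_m]) \bigcap_(j in [set: 'I_n])
    ((fun M : BMX => `|(M : MX) i j|) @^-1` [set` `]-oo, L]]).
  apply/seteqP; split => M /= ML; first by move=> i _ j _ /=; rewrite in_itv/=; exact: ML.
  by move=> i j; have := ML i I j I; rewrite /= in_itv/=.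
apply: fin_bigcap_measurable => [|i _]; first exact: finite_finset.
apply: fin_bigcap_measurable => [|j _]; first exact: finite_finset.
rewrite -[X in measurable X]setTI.
by apply: measurableT_comp => //; exact: measurable_mxE.
Qed.

Lemma mxcube_homo (L L' : R) : L <= L' -> (mxcube L : set MX) `<=` mxcube L'.
Proof. by move=> LL' M ML i j; exact: le_trans (ML i j) LL'. Qed.

(** Continuity from below of the probability mu along an increasing sequence of
    cubes. *)
Lemma mxcube_exhaust (mu : probability BMX R) (e : R) : 0 < e ->
  exists2 L : R, 0 < L & (mu (~` mxcube L) <= e%:E)%E.
Proof.
move=> e0; pose F k : set BMX := mxcube k.+1%:R.
have mF k : measurable (F k) by exact: measurable_mxcube.
have FT : \bigcup_k F k = setT.
  apply/seteqP; split => // M _.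
  exists (Num.truncn (\sum_i \sum_j `|(M : MX) i j|)) => // i j.
  apply/ltW/(le_lt_trans _ (truncnS_gt _)).
  rewrite (bigD1 i)//= (bigD1 j)//= -addrA lerDl addr_ge0// sumr_ge0// => k _.
  by rewrite sumr_ge0.
have ndF : nondecreasing_seq F.
  by move=> k l kl; apply/subsetPset/mxcube_homo; rewrite ler_nat.
have := nondecreasing_cvg_mu (mu := mu) mF (bigcupT_measurable _ mF) ndF.
rewrite FT [X in _ --> X]probability_setT => /fine_cvgP[_].
move=> /cvgrPdist_le /(_ e e0)[N _ /(_ N (leqnn N))] /= H.
exists N.+1%:R => //; rewrite probability_setC.
  have -> : mu (mxcube N.+1%:R) = (fine (mu (mxcube N.+1%:R)))%:E.
    by rewrite fineK// fin_num_measure//; exact: mF.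
  by rewrite -EFinB lee_fin; exact: le_trans (ler_norm _) H.
exact: measurable_mxcube.
Qed.

Context {d0 : measure_display} {Om : measurableType d0}.
Variables (Pr : probability Om R) (T : nat -> Om -> MX) (mu : probability BMX R).
Hypothesis mT : forall k i j, measurable_fun setT (fun w => T k w i j).
Hypothesis cosT : forall A c,
  \int[Pr]_w cos (c + frob A (T k w)) @[k --> \oo] --> \int[mu]_M cos (c + frob A M).
Hypothesis tightT : forall e : R, 0 < e ->
  exists L : R, \forall k \near \oo, (Pr (T k @^-1` (~` mxcube L)) <= e%:E)%E.

Let mTM k : measurable_fun setT (T k : Om -> BMX).
Proof. exact: measurable_mx. Qed.

Lemma trigpoly_bmeas g : trigpoly g -> bmeas (g : BMX -> R).
Proof.
elim=> [A c|f1 f2 _ b1 _ b2|a f _ bf]; [|exact: bmeasD|exact: bmeasZ].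
apply: bmeas_cos; apply: measurable_funD => //.
apply: measurable_sum => i; apply: measurable_sum => j.
by apply: measurable_funM => //; exact: measurable_mxE.
Qed.

Lemma trigpoly_cvg g : trigpoly g ->
  \int[Pr]_w g (T k w) @[k --> \oo] --> \int[mu]_M g M.
Proof.
elim=> [A c|f1 f2 t1 c1 t2 c2|a f tf cf]; first exact: cosT.
  rewrite expD; [|exact: trigpoly_bmeas|exact: trigpoly_bmeas].
  rewrite (_ : (fun k => _) = (fun k => \int[Pr]_w f1 (T k w) + \int[Pr]_w f2 (T k w))).
    exact: cvgD.
  by apply/funext => k; rewrite expD//; apply: (bmeas_comp _ (mTM k)); exact: trigpoly_bmeas.
rewrite expZ; last exact: trigpoly_bmeas.
rewrite (_ : (fun k => _) = (fun k => a * \int[Pr]_w f (T k w))).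
  by apply: cvgM => //; exact: cvg_cst.
by apply/funext => k; rewrite expZ//; apply: (bmeas_comp _ (mTM k)); exact: trigpoly_bmeas.
Qed.

(** On the cube the functions differ by at most e, and off the cube, which has
    probability at most e, by at most 2 B. *)
Lemma exp_diff_cube d' (T' : measurableType d') (P : probability T' R) (X : T' -> BMX)
    (f g : MX -> R) (B L e : R) :
  measurable_fun setT X -> bmeas (f : BMX -> R) -> bmeas (g : BMX -> R) -> 0 <= e ->
  (forall M, `|f M| <= B) -> (forall M, `|g M| <= B) ->
  (forall M, mxcube L M -> `|f M - g M| <= e) ->
  (P (X @^-1` (~` mxcube L)) <= e%:E)%E ->
  `|\int[P]_w f (X w) - \int[P]_w g (X w)| <= e + 2 * B * e.
Proof.
move=> mX bf bg e0 fB gB fge Pe.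
have B0 : 0 <= B by rewrite (le_trans _ (fB 0)).
have mC : measurable (~` mxcube L : set BMX).
  by apply: measurableC; exact: measurable_mxcube.
have bfX := bmeas_comp bf mX; have bgX := bmeas_comp bg mX.
have bI := bmeas_comp (bmeas_indic (R := R) mC) mX.
rewrite -expB// (le_trans (exp_norm_le _ (bmeasB bfX bgX)))//.
have bR : bmeas (fun w => e + 2 * B * \1_(~` mxcube L) (X w)).
  by apply: bmeasD; [exact: bmeas_cst|exact: bmeasZ].
apply: (@le_trans _ _ (\int[P]_w (e + 2 * B * \1_(~` mxcube L) (X w)))).
  apply: exp_le => // [|w]; first by apply: bmeas_norm; exact: bmeasB.
  have [XL|XL] := pselect (mxcube L (X w)).
    by rewrite (le_trans (fge _ XL))// lerDl !mulr_ge0// indicE.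
  rewrite indicE mem_set// mulr1 (le_trans (ler_normB _ _))//.
  by rewrite -[leLHS]add0r lerD// mulr_natl mulr2n lerD.
rewrite expD ?exp_cst//; [|exact: bmeas_cst|exact: bmeasZ].
rewrite lerD2l expZ// ler_wpM2l ?mulr_ge0//.
rewrite (exp_indic P (A := X @^-1` (~` mxcube L))); last first.
  exact: (measurable_preim mX).
rewrite -lee_fin fineK//; apply: fin_num_measure.
exact: (measurable_preim mX).
Qed.

(** Replacing f by a trigonometric polynomial g with the same bound costs little
    under mu and, by tightness, under every late law of T; for g convergence is the
    hypothesis. *)
Lemma levy_cvg_in_law : cvg_in_law Pr T mu.
Proof.
move=> f cf bdf; have [B' /= fB'] : exists B', forall M, setT M -> `|f M| <= B'.
  case: bdf => B0 [_ H]; exists (B0 + 1) => M MT.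
  by apply: (H (B0 + 1)) => //; rewrite ltrDl.
pose B := `|B'|; have fB M : `|f M| <= B by rewrite (le_trans (fB' M I))// ler_norm.
apply/cvgrPdist_le => e e0.
(* Two replacements at a cost of e' + 2 B e' each, and e' for the polynomial. *)
pose e' := e / (3 + 4 * B).
have B0 : 0 <= B by exact: normr_ge0.
have e'0 : 0 < e' by rewrite divr_gt0//; lra.
have [L1 tL1] := tightT e'0.
have [L2 L20 tL2] := mxcube_exhaust mu e'0.
pose L := Num.max L1 L2.
have L0 : 0 < L by rewrite lt_max L20 orbT.
have sub Li : Li <= L -> (~` mxcube L : set BMX) `<=` ~` mxcube Li.
  by move=> LiL; apply/subsetC/mxcube_homo.
have mC Li : measurable (~` mxcube Li : set BMX).
  by apply: measurableC; exact: measurable_mxcube.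
have [g [tg gB fg]] := trigpoly_dense cf fB L0 e'0.
have bg := trigpoly_bmeas tg.
have bf : bmeas (f : BMX -> R).
  by split; [exact: measurable_continuous_mx|exists B].
have muL : (mu (idfun @^-1` (~` mxcube L)) <= e'%:E)%E.
  apply: (le_trans _ tL2); apply: le_measure; rewrite ?inE; [exact: mC|exact: mC|].
  have L2L : L2 <= L by rewrite /L le_max lexx orbT.
  exact: sub L2L.
have mf := exp_diff_cube (@measurable_id _ BMX setT) bf bg (ltW e'0) fB gB fg muL.
move/cvgrPdist_le : (trigpoly_cvg tg) => /(_ e' e'0) cg.
near=> k.
have PL : (Pr (T k @^-1` (~` mxcube L)) <= e'%:E)%E.
  apply: (@le_trans _ _ (Pr (T k @^-1` (~` mxcube L1)))); last by near: k.
  have mp A : measurable (A : set BMX) -> measurable (T k @^-1` A).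
    by move=> mA; rewrite -[X in measurable X]setTI; exact: mTM.
  apply: le_measure; rewrite ?inE; [exact: mp|exact: mp|].
  have L1L : L1 <= L by rewrite /L le_max lexx.
  by move=> w; exact: sub L1L _.
have Tf := exp_diff_cube (@mTM k) bf bg (ltW e'0) fB gB fg PL.
have gk : `|\int[mu]_M g M - \int[Pr]_w g (T k w)| <= e' by near: k.
rewrite [in X in _ <= X](_ : e = (e' + 2 * B * e') + e' + (e' + 2 * B * e')); last first.
  by rewrite /e'; field; lra.
rewrite (_ : \int[mu]_x f x - _ = (\int[mu]_x f x - \int[mu]_x g x) +
  (\int[mu]_M g M - \int[Pr]_w g (T k w)) -
  (\int[Pr]_w f (T k w) - \int[Pr]_w g (T k w))); last by ring.
rewrite (le_trans (ler_normB _ _))// lerD// (le_trans (ler_normD _ _))//.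
by rewrite lerD.
Unshelve. all: by end_near.
Qed.

End levy.

(** * Conditional quantiles and the error of fitted ranks *)

Section conditional_quantile.
Context {R : realType} {d : nat}.
Variables (k : R.-pker d.-tuple R ~> R) (z : d.-tuple R).
Hypothesis kz01 : k z (unitI R) = 1%E.
Hypothesis cF : continuous (fun t => condF k t z).
Implicit Types (t tau : R).

Let S tau := [set t | unitI R t /\ tau <= condF k t z].

Let S1 tau : 0 <= tau <= 1 -> S tau 1.
Proof.
move=> /andP[_ tau1]; split; first by rewrite /= in_itv/= ler01 lexx.
by rewrite (condF_ge1 kz01).
Qed.

Let lbS tau : has_lbound (S tau).
Proof. by exists 0 => t [/=]; rewrite in_itv/= => /andP[]. Qed.

Lemma condQ_le t tau : 0 <= t <= 1 -> tau <= condF k t z -> condQ k tau z <= t.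
Proof. by move=> t01 tF; apply: (ge_inf (@lbS tau)); split => //=; rewrite in_itv. Qed.

Lemma condQ01 tau : 0 <= tau <= 1 -> 0 <= condQ k tau z <= 1.
Proof.
move=> t01; apply/andP; split.
  apply: lb_le_inf; first by exists 1; exact: S1.
  by move=> t [/=]; rewrite in_itv/= => /andP[].
by apply: (ge_inf (@lbS tau)); exact: S1.
Qed.

(** Continuity of the distribution function rules out a jump over the level tau. *)
Lemma condF_condQ tau : 0 <= tau <= 1 -> condF k (condQ k tau z) z = tau.
Proof.
move=> t01; apply/eqP; rewrite eq_le; apply/andP; split.
  have [s s01 <-] := condF_surj kz01 cF t01.
  by apply: (condF_homo k z); apply: condQ_le.
rewrite leNgt; apply/negP => Flt.
have e0 : 0 < tau - condF k (condQ k tau z) z by rewrite subr_gt0.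
have /cvgrPdist_lt /(_ _ e0) := cF (x := condQ k tau z).
move=> /nbhs_ballP[r /= r0 near_Q].
have [t St tr] := inf_adherent r0 (conj (ex_intro _ _ (S1 t01)) (@lbS tau)).
have Qt : condQ k tau z <= t by exact: (ge_inf (@lbS tau)).
have : ball (condQ k tau z) r t.
  by rewrite /ball/= distrC ger0_norm ?subr_ge0//; rewrite ltrBlDl.
move=> /near_Q; rewrite distrC => /ltr_normlW; case: St => _ St.
by move: St Flt; lra.
Qed.

Lemma condQ_homo : {in `[0, 1] &, {homo (fun tau => condQ k tau z) : a b / a <= b}}.
Proof.
move=> a b a01 b01 ab; apply: condQ_le; first exact: condQ01.
by rewrite condF_condQ.
Qed.

Section clipped_estimation_error.
Variables (psi : R -> R) (a b K N : R) (G : R -> R).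
Hypotheses (K0 : 0 <= K) (a01 : 0 <= a <= 1) (b01 : 0 <= b <= 1) (ab : a <= b).
Hypothesis psi_lip : forall u v, 0 <= u <= 1 -> 0 <= v <= 1 ->
  `|psi u - psi v| <= K * `|u - v|.
Hypothesis psi_left : forall u, 0 <= u < a -> psi u = 0.
Hypothesis psi_right : forall u, b < u <= 1 -> psi u = 0.
Hypothesis psi1 : psi 1 = 0.
Hypothesis G01 : forall t, 0 <= t <= 1 -> 0 <= G t <= 1.
Hypothesis G_homo : {in `[0, 1] &, {homo G : t u / t <= u}}.
Hypothesis G_near : forall t, condQ k a z <= t <= condQ k b z ->
  `|condF k t z - G t| <= N.

Let psi_limit0 c : 0 <= c <= 1 ->
  (forall e, 0 < e -> exists2 y, 0 <= y <= 1 & psi y = 0 /\ `|c - y| <= e) -> psi c = 0.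
Proof.
move=> c01 H; apply/eqP; rewrite -normr_le0; apply/ler_addgt0Pl => e e0; rewrite addr0.
have K1 : 0 < K + 1 by rewrite ltr_wpDl.
have [|y y01 [py cy]] := H (e / (K + 1)); first by rewrite divr_gt0.
rewrite -[psi c]subr0 -py (le_trans (psi_lip c01 y01))//.
apply: (@le_trans _ _ ((K + 1) * (e / (K + 1)))).
  by apply: ler_pM => //; rewrite lerDl.
by rewrite mulrC divfK// gt_eqF.
Qed.

Let psi_a : 0 < a -> psi a = 0.
Proof.
move=> a0; apply: psi_limit0 => // e e0; have /andP[_ a1] := a01.
have [ea|ae] := leP e a; last first.
  exists 0; first by rewrite lexx ler01.
  by rewrite psi_left ?lexx//= subr0 ger0_norm ?(ltW a0)//; split => //; exact: ltW.
exists (a - e); first by rewrite subr_ge0 ea/=; lra.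
by rewrite psi_left ?subr_ge0 ?ea/= ?gtrBl// subKr ger0_norm// ltW.
Qed.

Let psi_b : psi b = 0.
Proof.
have /andP[b0] := b01; rewrite le_eqVlt => /predU1P[->//|b1].
apply: psi_limit0 => // e e0; have [eb|be] := leP (b + e) 1; last first.
  exists 1; first by rewrite ler01 lexx.
  by split => //; rewrite distrC ger0_norm ?subr_ge0 ?(ltW b1)//; lra.
exists (b + e); first by rewrite eb addr_ge0// ltW.
rewrite psi_right ?eb ?ltrDl ?e0//; split => //.
by rewrite opprD addrA subrr sub0r normrN ger0_norm// ltW.
Qed.

(** For t in the quantile range this is the Lipschitz bound.  To the left of it
    psi vanishes at the true rank, and G t <= G (Q a) <= a + N: either G t < a,
    where psi vanishes, or G t is within N of a, where psi is zero.  The right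
    side is symmetric. *)
Lemma clipped_error t : 0 <= t <= 1 ->
  `|psi (G t) - psi (condF k t z)| <= K * N.
Proof.
move=> t01; have Gt := G01 t01; have /andP[Gt0 Gt1] := Gt.
have Ft : 0 <= condF k t z <= 1 by rewrite condF_ge0 condF_le1.
have /andP[F0 F1] := Ft.
have Qa := condQ01 a01; have Qb := condQ01 b01.
have Qab : condQ k a z <= condQ k b z by apply: condQ_homo; rewrite ?in_itv.
have FQa := condF_condQ a01; have FQb := condF_condQ b01.
have nearQ s : condQ k a z <= s <= condQ k b z -> 0 <= s <= 1 ->
    `|psi (G s) - psi (condF k s z)| <= K * N.
  move=> sQ s01; rewrite (le_trans (psi_lip (G01 s01) _)) ?condF_ge0 ?condF_le1//.
  by rewrite ler_wpM2l// distrC; exact: G_near.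
have N0 : 0 <= N.
  by rewrite (le_trans _ (G_near (t := condQ k a z) _))// lexx.
have [tQa|Qat] := ltP t (condQ k a z).
  have Fa : condF k t z < a.
    by rewrite ltNge; apply/negP => /(condQ_le t01); rewrite leNgt tQa.
  rewrite (psi_left (u := condF k t z)) ?F0// subr0.
  have [Ga|aG] := ltP (G t) a; first by rewrite psi_left ?Gt0// normr0 mulr_ge0.
  have GQ : G t <= G (condQ k a z) by apply: G_homo; rewrite ?in_itv//= ltW.
  have GN : `|a - G (condQ k a z)| <= N.
    by rewrite -{1}FQa; apply: G_near; rewrite lexx.
  rewrite -[psi (G t)]subr0 -(psi_a (le_lt_trans F0 Fa)).
  rewrite (le_trans (psi_lip Gt a01))// ler_wpM2l// ger0_norm ?subr_ge0//.
  by move: GN; rewrite ler_norml => /andP[+ _]; lra.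
have [Qbt|tQb] := ltP (condQ k b z) t; last by apply: nearQ => //; rewrite Qat.
have bF : b <= condF k t z by rewrite -FQb; apply: (condF_homo k z); exact: ltW.
have psiF : psi (condF k t z) = 0.
  move: bF; rewrite le_eqVlt => /predU1P[E|bF]; last by rewrite psi_right ?bF.
  by rewrite -E.
rewrite psiF subr0.
have [bG|Gb] := ltP b (G t); first by rewrite psi_right ?bG// normr0 mulr_ge0.
have GQ : G (condQ k b z) <= G t by apply: G_homo; rewrite ?in_itv//= ltW.
have GN : `|b - G (condQ k b z)| <= N.
  by rewrite -{1}FQb; apply: G_near; rewrite lexx Qab.
rewrite -[psi (G t)]subr0 -psi_b.
rewrite (le_trans (psi_lip Gt b01))// ler_wpM2l// distrC ger0_norm ?subr_ge0//.
by move: GN; rewrite ler_norml => /andP[_]; lra.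
Qed.

End clipped_estimation_error.

End conditional_quantile.

(** * Score functions *)

Section score_functions.
Context {R : realType} {q : nat}.
Variable phi : R -> 'cV[R]_q.
Hypothesis Hphi : admissible_phi phi.
Implicit Types (k s : 'I_q) (u v : R).

(** Composing with the projection onto [0, 1] makes the functions phi_k Lipschitz
    on the whole line without changing them on [0, 1]. *)
Definition clamp01 u : R := Num.min 1 (Num.max 0 u).

Lemma clamp01_itv u : 0 <= clamp01 u <= 1.
Proof. by rewrite le_min ler01 le_max lexx/= ge_min lexx. Qed.

Lemma clamp01_id u : 0 <= u <= 1 -> clamp01 u = u.
Proof. by move=> /andP[u0 u1]; rewrite /clamp01 max_r// min_r. Qed.

Lemma clamp01_lip u v : `|clamp01 u - clamp01 v| <= `|u - v|.
Proof.
rewrite /clamp01 /Num.min /Num.max.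
have h3 := ler_norm (u - v); have h4 := ler_norm (v - u); rewrite (distrC v) in h4.
rewrite ler_norml.
by case: (ltP 0 u) => u0; case: (ltP 0 v) => v0; case: ltP => h1; case: ltP => h2;
  apply/andP; split; move: u0 v0 h1 h2 h3 h4; lra.
Qed.

Definition score k u : R := phi (clamp01 u) k 0.

Lemma score_id k u : 0 <= u <= 1 -> score k u = phi u k 0.
Proof. by move=> u01; rewrite /score clamp01_id. Qed.

Lemma score_lipschitz : exists2 K, 0 <= K &
  forall k u v, `|score k u - score k v| <= K * `|u - v|.
Proof.
have [_ _ lip _ _] := Hphi.
have lipk k : exists2 K, 0 <= K & forall u v, `|score k u - score k v| <= K * `|u - v|.
  have [K [_ HK]] := lip k; exists (`|K| + 1); first exact: addr_ge0.
  move=> u v.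
  have := HK (`|K| + 1) (le_lt_trans (ler_norm _) (ltr_pwDr ltr01 (lexx _))).
  move=> /(_ (clamp01 u, clamp01 v)) /= H.
  have itv w : unitI R (clamp01 w) by rewrite /= in_itv/=; exact: clamp01_itv.
  rewrite (le_trans (H _))//; first by split; exact: itv.
  by rewrite ler_wpM2l// ?addr_ge0// clamp01_lip.
pose K k := sval (cid2 (lipk k)).
have K0 k : 0 <= K k by rewrite /K; case: cid2.
have KP k u v : `|score k u - score k v| <= K k * `|u - v| by rewrite /K; case: cid2 => //=.
exists (\sum_k K k) => [|k u v]; first by apply: sumr_ge0.
rewrite (le_trans (KP k u v))// ler_wpM2r// (bigD1 k)//= lerDl sumr_ge0//.
Qed.

Lemma score_bounded : exists2 B, 0 <= B & forall k u, `|score k u| <= B.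
Proof.
have [K K0 KP] := score_lipschitz.
exists (\sum_k `|score k 0| + K).
  by rewrite addr_ge0// sumr_ge0.
move=> k u; rewrite /score -(clamp01_id (clamp01_itv u)) -/(score k _).
rewrite -[score k _](subrK (score k 0)) addrC (le_trans (ler_normD _ _))// lerD//.
  by rewrite (bigD1 k)//= lerDl sumr_ge0.
rewrite (le_trans (KP _ _ _))// subr0 -[leRHS]mulr1 ler_wpM2l//.
by have /andP[c0 c1] := clamp01_itv u; rewrite ger0_norm.
Qed.

Lemma score_bmeas k : bmeas (score k).
Proof.
have [B _ BP] := score_bounded; split; last by exists B.
have [K K0 KP] := score_lipschitz.
apply: continuous_measurable_fun => u.
apply/cvgrPdist_le => e e0.
have K1 : 0 < K + 1 by rewrite ltr_wpDl.
have eK : 0 < e / (K + 1) by rewrite divr_gt0.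
near=> v.
rewrite (le_trans (KP k u v))//.
apply: (@le_trans _ _ ((K + 1) * (e / (K + 1)))); last by rewrite mulrC divfK// gt_eqF.
by apply: ler_pM => //; rewrite lerDl.
Unshelve. all: by end_near.
Qed.

Lemma exp_score (f : R -> R) : bmeas (fun u => f (clamp01 u)) ->
  \int[unif01]_u f (clamp01 u) = \int[lebesgue_measure]_(u in unitI R) f u.
Proof.
move=> bf; rewrite exp_unif01//; apply: eq_Rintegral => u.
by rewrite inE/= in_itv/= => u01; rewrite clamp01_id.
Qed.

Lemma exp_score0 k : \int[unif01]_u score k u = 0.
Proof.
have [_ _ _ /(_ k)[<- _] _] := Hphi.
exact: (exp_score (f := fun u => phi u k 0) (score_bmeas k)).
Qed.

Lemma exp_scoreM k s : \int[unif01]_u (score k u * score s u) = gramSigma phi k s.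
Proof.
rewrite mxE; apply: (exp_score (f := fun u => phi u k 0 * phi u s 0)).
by apply: bmeasM; exact: score_bmeas.
Qed.

(** The quadratic form is the integral of a square. *)
Lemma gramSigma_psd : psd (gramSigma phi).
Proof.
split => [|x].
  by apply/matrixP => k s; rewrite mxE -!exp_scoreM; apply: eq_Rintegral => u _; rewrite mulrC.
have bx k : bmeas (fun u => x 0 k * score k u) by apply: bmeasZ; exact: score_bmeas.
have -> : (x *m gramSigma phi *m x^T) 0 0 = \int[unif01]_u ((\sum_k x 0 k * score k u) ^+ 2).
  transitivity (\int[unif01]_u \sum_k \sum_s (x 0 k * score k u) * (x 0 s * score s u)).
    rewrite exp_sum => [|k]; last by apply: bmeas_sum => s; exact: bmeasM.
    rewrite mxE.
    under eq_bigr do rewrite mxE big_distrl/=.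
    rewrite exchange_big/=.
    apply: eq_bigr => k _; rewrite exp_sum => [|s]; last exact: bmeasM.
    apply: eq_bigr => s _; rewrite [x^T _ _]mxE -exp_scoreM mulrAC.
    rewrite -expZ; last by apply: bmeasM; exact: score_bmeas.
    by apply: eq_Rintegral => u _; ring.
  by apply: eq_Rintegral => u _; rewrite expr2 big_distrlr.
rewrite -[leLHS](exp_cst unif01); apply: exp_le.
- exact: bmeas_cst.
- by apply: bmeasX; apply: bmeas_sum => k; exact: bx.
- by move=> u; exact: sqr_ge0.
Qed.

Lemma phi_suppP k u : 0 <= u <= 1 -> phi u k 0 != 0 ->
  (\bigcup_k phi_supp phi k) u.
Proof.
by move=> u01 pu; exists k => //; apply: subset_closure; split => //=.
Qed.

Let supp01 u : (\bigcup_k phi_supp phi k) u -> 0 < u < 1.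
Proof.
have [_ + _ _ _] := Hphi => H [k _]; have [_ sub] := H k.
by move=> /sub /=; rewrite in_itv.
Qed.

Let supp_neq0 : (\bigcup_k phi_supp phi k) !=set0.
Proof.
have [q0 _ _ int2 _] := Hphi; apply: contrapT => emp.
have [_] := int2 (Ordinal q0).
rewrite (_ : \int[lebesgue_measure]_(u in _) _ = \int[lebesgue_measure]_(u in unitI R) (0 : R)).
  by rewrite Rintegral_cst// mul0r => /eqP; rewrite eq_sym oner_eq0.
apply: eq_Rintegral => u; rewrite inE/= in_itv/= => u01.
apply/eqP; rewrite sqrf_eq0; apply/negPn/negP => pu; apply: emp; exists u.
exact: (phi_suppP u01 pu).
Qed.

Let supp_lb : has_lbound (\bigcup_k phi_supp phi k).
Proof. by exists 0 => u /supp01 /andP[/ltW]. Qed.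

Let supp_ub : has_ubound (\bigcup_k phi_supp phi k).
Proof. by exists 1 => u /supp01 /andP[_ /ltW]. Qed.

(** The supports are contained in (0, 1), and their union is nonempty because
    phi_k has norm one. *)
Lemma tau_order : [/\ 0 <= tau_min phi, tau_min phi <= tau_max phi & tau_max phi <= 1].
Proof.
have [u su] := supp_neq0; split.
- by apply: lb_le_inf => // v /supp01 /andP[/ltW].
- by rewrite (le_trans (ge_inf supp_lb su))//; exact: ub_le_sup.
- by apply: ge_sup => // v /supp01 /andP[_ /ltW].
Qed.

Lemma score_left k u : 0 <= u < tau_min phi -> score k u = 0.
Proof.
have [_ mM M1] := tau_order; move=> /andP[u0 um].
have u01 : 0 <= u <= 1 by rewrite u0 ltW// (lt_le_trans um)// (le_trans mM).
rewrite score_id//; apply/eqP/negPn/negP => /(phi_suppP u01) /(ge_inf supp_lb).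
by rewrite leNgt um.
Qed.

Lemma score_right k u : tau_max phi < u <= 1 -> score k u = 0.
Proof.
have [m0 mM M1] := tau_order; move=> /andP[Mu u1].
have u01 : 0 <= u <= 1 by rewrite u1 andbT ltW// (le_lt_trans _ Mu)// (le_trans m0).
rewrite score_id//; apply/eqP/negPn/negP => /(phi_suppP u01) /(ub_le_sup supp_ub).
by rewrite leNgt Mu.
Qed.

(** The point 1 is outside the supports, which are contained in (0, 1). *)
Lemma score1 k : score k 1 = 0.
Proof.
have u01 : 0 <= (1 : R) <= 1 by rewrite ler01 lexx.
rewrite score_id//; apply/eqP/negPn/negP => /(phi_suppP u01) /supp01.
by rewrite ltxx andbF.
Qed.

Lemma normT_le d (kz : R.-pker d.-tuple R ~> R) (f : R -> d.-tuple R -> R) N z t :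
  (normT phi kz f <= N%:E)%E -> zcube z -> quantile_range phi kz z t -> `|f t z| <= N.
Proof.
move=> fN zc tQ; rewrite -lee_fin; apply: le_trans fN.
apply: (@le_trans _ _ (ereal_sup [set `|f t z|%:E | t in quantile_range phi kz z])).
  by apply: ereal_sup_ubound; exists t.
by apply: ereal_sup_ubound; exists z.
Qed.

(** [clipped_error] for phi_k on the quantile range, with the sup norm as the
    bound on the estimation error. *)
Lemma score_error d (kz : R.-pker d.-tuple R ~> R) (z : d.-tuple R) (G : R -> R)
    (h : R -> d.-tuple R -> R) (K N : R) :
  0 <= K -> (forall k u v, `|score k u - score k v| <= K * `|u - v|) ->
  zcube z -> kz z (unitI R) = 1%E -> continuous (fun t => condF kz t z) ->
  (forall t, unitI R t -> unitI R (G t)) -> {in `[0, 1] &, {homo G : t u / t <= u}} ->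
  (forall t, h t z = condF kz t z - G t) -> (normT phi kz h <= N%:E)%E ->
  forall k t, 0 <= t <= 1 -> `|score k (G t) - score k (condF kz t z)| <= K * N.
Proof.
move=> K0 KP zc kz1 cF G01 Gh hE hN k t t01.
have [m0 mM M1] := tau_order.
have m01 : 0 <= tau_min phi <= 1 by rewrite m0 (le_trans mM).
have M01 : 0 <= tau_max phi <= 1 by rewrite M1 (le_trans m0).
apply: (clipped_error kz1 cF K0 m01 M01 mM) => //.
- by move=> u uM; exact: score_left.
- by move=> u uM; exact: score_right.
- exact: score1.
- by move=> u uQ; rewrite -hE; apply: (normT_le hN zc); rewrite /quantile_range/= in_itv.
Qed.

End score_functions.

(** * Convergence in probability *)

Section convergence_in_probability.
Context {R : realType} {d0 : measure_display} {Om : measurableType d0}.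
Variable Pr : probability Om R.
Implicit Types (X Y : nat -> Om -> R).

(** One parameter plays both the role of the distance and of the probability. *)
Definition cvg_prob0 X := forall e : R, 0 < e ->
  \forall n \near \oo, (Pr [set w | (e < `|X n w|)%R] <= e%:E)%E.

Lemma measurable_gt_norm (f : Om -> R) (e : R) : measurable_fun setT f ->
  measurable [set w | (e < `|f w|)%R].
Proof.
move=> mf; rewrite -[X in measurable X]setTI.
rewrite (_ : [set w | _] = (fun w => `|f w|) @^-1` [set` `]e, +oo[]); last first.
  by apply/seteqP; split => w /=; rewrite in_itv/= andbT.
by apply: measurableT_comp => //.
Qed.

Lemma exp_indic_gt_norm (f : Om -> R) (e : R) : measurable_fun setT f ->
  (Pr [set w | (e < `|f w|)%R] =
   (\int[Pr]_w \1_([set w | (e < `|f w|)%R]) w)%:E)%E.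
Proof. by move=> mf; rewrite prob_exp_indic//; exact: measurable_gt_norm. Qed.

Lemma chebyshev_bmeas (f : Om -> R) (L : R) : bmeas f -> 0 < L ->
  (Pr [set w | (L < `|f w|)%R] <= ((\int[Pr]_w (f w ^+ 2)) / L ^+ 2)%:E)%E.
Proof.
move=> bf L0; have [mf _] := bf; rewrite exp_indic_gt_norm// lee_fin.
have bI := bmeas_indic (R := R) (measurable_gt_norm L mf).
have L2 : 0 < L ^+ 2 by rewrite exprn_gt0.
rewrite ler_pdivlMr// mulrC -expZ//; apply: exp_le => //.
- exact: bmeasZ.
- exact: bmeasX.
- move=> w; rewrite indicE; case: (boolP (w \in _)); rewrite ?mulr0 ?sqr_ge0//.
  rewrite inE/= mulr1 => /ltW Lf; rewrite -[leRHS]real_normK ?num_real//.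
  by rewrite lerXn2r// nnegrE// ltW.
Qed.

Lemma cvg_prob0_L2 X : (forall n, bmeas (X n)) ->
  \int[Pr]_w (X n w ^+ 2) @[n --> \oo] --> 0 -> cvg_prob0 X.
Proof.
move=> bX X2 e e0; have e3 : 0 < e ^+ 3 by rewrite exprn_gt0.
move/cvgrPdist_le : X2 => /(_ _ e3) X2; near=> n.
rewrite (le_trans (chebyshev_bmeas (bX n) e0))// lee_fin.
rewrite ler_pdivrMr ?exprn_gt0// -exprS.
have : `|0 - \int[Pr]_w (X n w ^+ 2)| <= e ^+ 3 by near: n.
by rewrite sub0r normrN; apply: le_trans; exact: ler_norm.
Unshelve. all: by end_near.
Qed.

Lemma cvg_prob0D X Y : (forall n, bmeas (X n)) -> (forall n, bmeas (Y n)) ->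
  cvg_prob0 X -> cvg_prob0 Y -> cvg_prob0 (fun n w => X n w + Y n w).
Proof.
move=> bX bY cX cY e e0; have e2 : 0 < e / 2 by rewrite divr_gt0.
near=> n; have [mX _] := bX n; have [mY _] := bY n.
have mA := measurable_gt_norm (e / 2) mX; have mB := measurable_gt_norm (e / 2) mY.
have mC : measurable [set w | (e < `|X n w + Y n w|)%R].
  by apply: measurable_gt_norm; exact: measurable_funD.
apply: (@le_trans _ _ (Pr ([set w | (e / 2 < `|X n w|)%R] `|` [set w | (e / 2 < `|Y n w|)%R]))).
  apply: le_measure; rewrite ?inE//; first exact: measurableU.
  move=> w /= eXY; have := ler_normD (X n w) (Y n w).
  have [Xe|Xe] := ltP (e / 2) `|X n w|; first by left.
  by right; move: (ler_normD (X n w) (Y n w)) Xe eXY => /=; lra.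
rewrite (le_trans (measureU2 _ mA mB))// [in leRHS](splitr e) EFinD.
by apply: leeD; near: n; [exact: cX|exact: cY].
Unshelve. all: by end_near.
Qed.

Lemma cvg_prob0Z (c : R) X : (forall n, bmeas (X n)) ->
  cvg_prob0 X -> cvg_prob0 (fun n w => c * X n w).
Proof.
move=> bX cX e e0; pose e' := Num.min e (e / (`|c| + 1)).
have c1 : 0 < `|c| + 1 by rewrite ltr_wpDl.
have e'0 : 0 < e' by rewrite lt_min e0 divr_gt0.
near=> n; have [mX _] := bX n.
apply: (@le_trans _ _ e'%:E); last by rewrite lee_fin ge_min lexx.
apply: (@le_trans _ _ (Pr [set w | (e' < `|X n w|)%R])); last by near: n; exact: cX.
apply: le_measure; rewrite ?inE.
- by apply: measurable_gt_norm; case: (bmeasZ c (bX n)).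
- exact: measurable_gt_norm.
move=> w /=; rewrite normrM => ecX; rewrite gt_min; apply/orP; right.
rewrite ltr_pdivrMr// (lt_le_trans ecX)// mulrC ler_wpM2l// lerDl//.
Unshelve. all: by end_near.
Qed.

Lemma cvg_prob0_sum I (s : seq I) (F : I -> nat -> Om -> R) :
  (forall i n, bmeas (F i n)) -> (forall i, cvg_prob0 (F i)) ->
  cvg_prob0 (fun n w => \sum_(i <- s) F i n w).
Proof.
move=> bF cF; elim: s => [|i s IH].
  move=> e e0; apply: nearW => n; rewrite (_ : [set w | _] = set0) ?measure0 ?lee_fin ?ltW//.
  by apply/seteqP; split => // w /=; rewrite big_nil normr0 ltNge ltW.
rewrite (_ : (fun n w => _) = (fun n w => F i n w + \sum_(j <- s) F j n w)).
  by apply: cvg_prob0D => // n; exact: bmeas_sum.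
by apply/funext => n; apply/funext => w; rewrite big_cons.
Qed.

Lemma cvg_prob0_exp_cos Y X (c : R) :
  (forall n, bmeas (Y n)) -> (forall n, bmeas (X n)) -> cvg_prob0 X ->
  \int[Pr]_w cos (c + (Y n w + X n w)) - \int[Pr]_w cos (c + Y n w) @[n --> \oo] --> 0.
Proof.
move=> bY bX cX; apply/cvgrPdist_le => e e0.
have e3 : 0 < e / 3 by rewrite divr_gt0.
near=> n; rewrite sub0r normrN.
have [mX _] := bX n; have [mY _] := bY n.
have bcos (g : Om -> R) : measurable_fun setT g -> bmeas (fun w => cos (c + g w)).
  by move=> mg; apply: bmeas_cos; exact: measurable_funD.
have b1 := bcos _ (measurable_funD mY mX); have b2 := bcos _ mY.
have bI := bmeas_indic (R := R) (measurable_gt_norm (e / 3) mX).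
rewrite -expB// (le_trans (exp_norm_le _ (bmeasB b1 b2)))//.
apply: (@le_trans _ _ (\int[Pr]_w (e / 3 + 2 * \1_([set w | (e / 3 < `|X n w|)%R]) w))).
  apply: exp_le; first exact/bmeas_norm/bmeasB.
    by apply: bmeasD; [exact: bmeas_cst|exact: bmeasZ].
  move=> w; have [Xe|Xe] := pselect ((e / 3 < `|X n w|)%R).
    rewrite indicE mem_set// mulr1 (le_trans (ler_normB _ _))// -[leLHS]add0r lerD ?(ltW e3)//.
    by rewrite (_ : 2 = 1 + 1)// lerD// cos_max.
  rewrite indicE memNset// mulr0 addr0 (le_trans (cos_lip _ _))//.
  rewrite (_ : c + (Y n w + X n w) - (c + Y n w) = X n w); last by ring.
  by rewrite leNgt; exact/negP.
rewrite expD ?exp_cst//; [|exact: bmeas_cst|exact: bmeasZ].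
rewrite expZ//.
have : (Pr [set w | (e / 3 < `|X n w|)%R] <= (e / 3)%:E)%E by near: n; exact: cX.
by rewrite exp_indic_gt_norm// lee_fin; lra.
Unshelve. all: by end_near.
Qed.

End convergence_in_probability.

Section perturbed_levy.
Context {R : realType} {m n : nat} {d0 : measure_display} {Om : measurableType d0}.
Local Notation MX := 'M[R]_(m, n).
Variables (Pr : probability Om R) (T S Rm : nat -> Om -> MX).
Variable mu : probability (Borel MX) R.
Hypothesis TE : forall k w i j, T k w i j = S k w i j + Rm k w i j.
Hypothesis bS : forall k i j, bmeas (fun w => S k w i j).
Hypothesis bR : forall k i j, bmeas (fun w => Rm k w i j).
Variable V : R.
Hypothesis varS : forall k i j, \int[Pr]_w (S k w i j ^+ 2) <= V.
Hypothesis R0 : forall i j, cvg_prob0 Pr (fun k w => Rm k w i j).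
Hypothesis cosS : forall A c,
  \int[Pr]_w cos (c + frob A (S k w)) @[k --> \oo] --> \int[mu]_M cos (c + frob A M).

(** The main part S satisfies the central limit theorem in the form of cosines
    and is tight by its bounded second moments; a perturbation converging to zero
    in probability affects neither. *)
Lemma perturbed_levy : cvg_in_law Pr T mu.
Proof.
have bT k i j : bmeas (fun w => T k w i j).
  by under eq_fun do rewrite TE; exact: bmeasD.
have bfrob (X : nat -> Om -> MX) A k : (forall i j, bmeas (fun w => X k w i j)) ->
    bmeas (fun w => frob A (X k w)).
  by move=> bX; apply: bmeas_sum => i; apply: bmeas_sum => j; exact: bmeasZ.
apply: levy_cvg_in_law => [k i j|A c|e e0].
- by case: (bT k i j).
- have frobR : cvg_prob0 Pr (fun k w => frob A (Rm k w)).
    apply: cvg_prob0_sum => [i k|i]; first by apply: bmeas_sum => j; exact: bmeasZ.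
    apply: cvg_prob0_sum => [j k|j]; first exact: bmeasZ.
    exact: cvg_prob0Z.
  have := cvg_prob0_exp_cos c (fun k => bfrob S A k (bS k))
    (fun k => bfrob Rm A k (bR k)) frobR.
  move=> /(fun h => cvgD h (@cosS A c)); rewrite add0r; apply: cvg_trans.
  apply: near_eq_cvg; near=> k; rewrite subrK; apply: eq_Rintegral => w _.
  have -> : T k w = S k w + Rm k w by apply/matrixP => i j; rewrite mxE TE.
  by rewrite frobDr.
(* The m n entries share e, half of it for each of S and Rm. *)
pose N : R := (m * n).+1%:R; have N0 : 0 < N by rewrite ltr0n.
pose e' := e / N / 2; have e'0 : 0 < e' by rewrite !divr_gt0.
have Ve0 : 0 <= `|V| / e' by rewrite divr_ge0// ltW.
have [L [L1 LV Le]] : exists L, [/\ 1 <= L, `|V| / e' <= L & e' <= L].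
  by exists (`|V| / e' + 1 + e'); split; lra.
have L0 : 0 < L by exact: lt_le_trans L1.
have VL : `|V| / L ^+ 2 <= e'.
  rewrite ler_pdivrMr ?exprn_gt0// -ler_pdivrMl// mulrC.
  apply: (le_trans LV).
  by rewrite expr2 ler_peMl// ltW.
have nearR : \forall k \near \oo, forall (p : 'I_m * 'I_n),
(Pr [set w | (e' < `|Rm k w p.1 p.2|)%R] <= e'%:E)%E.
  by apply: filter_forall => p; exact: R0.
exists (L + L); near=> k.
have mC : measurable (T k @^-1` (~` mxcube (L + L))).
  have mT : measurable_fun setT (T k : Om -> Borel MX).
    by apply: measurable_mx => i j; case: (bT k i j).
  rewrite -[X in measurable X]setTI; apply: mT => //.
  by apply: measurableC; exact: measurable_mxcube.
have mSk i j : measurable [set w | (L < `|S k w i j|)%R].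
  by apply: measurable_gt_norm; case: (bS k i j).
have mRk i j : measurable [set w | (L < `|Rm k w i j|)%R].
  by apply: measurable_gt_norm; case: (bR k i j).
have bSk i j := bmeas_indic (R := R) (mSk i j).
have bRk i j := bmeas_indic (R := R) (mRk i j).
rewrite prob_exp_indic// lee_fin.
pose hit i j w : R :=
  \1_([set w | (L < `|S k w i j|)%R]) w + \1_([set w | (L < `|Rm k w i j|)%R]) w.
have hit0 i j w : 0 <= hit i j w by rewrite addr_ge0// indicE.
apply: (@le_trans _ _ (\int[Pr]_w \sum_i \sum_j hit i j w)).
  apply: exp_le => //.
  - exact: bmeas_indic.
  - by apply: bmeas_sum => i; apply: bmeas_sum => j; exact: bmeasD.
  move=> w; have [cT|] := pselect (mxcube (L + L) (T k w)).
    rewrite indicE memNset; last by apply.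
    by apply: sumr_ge0 => i _; apply: sumr_ge0 => j _.
  move=> /existsNP[i /existsNP[j /negP]]; rewrite -ltNge TE => TL.
  rewrite (bigD1 i)//= (bigD1 j)//= -[leRHS]addrA -[leLHS]addr0 lerD//; last first.
    by rewrite addr_ge0// sumr_ge0// => ? _; apply: sumr_ge0.
  apply: (@le_trans _ _ 1); first by rewrite indicE; case: (_ \in _).
  have [SL|SL] := ltP L `|S k w i j|.
    by rewrite /hit indicE mem_set// lerDl indicE.
  rewrite /hit [X in _ + X]indicE mem_set ?lerDr ?indicE//=.
  by move: (ler_normD (S k w i j) (Rm k w i j)) TL SL; lra.
rewrite exp_sum => [|i]; last by apply: bmeas_sum => j; exact: bmeasD.
apply: (@le_trans _ _ (\sum_(i < m) \sum_(j < n) (e' + e'))).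
  apply: ler_sum => i _; rewrite exp_sum => [|j]; last exact: bmeasD.
  apply: ler_sum => j _; rewrite expD//; apply: lerD.
    rewrite -lee_fin -prob_exp_indic//.
    rewrite (le_trans (chebyshev_bmeas Pr (bS k i j) L0))// lee_fin.
    apply: le_trans VL; rewrite ler_wpM2r ?invr_ge0 ?exprn_ge0 ?(ltW L0)//.
    by rewrite (le_trans (varS k i j))// ler_norm.
  rewrite -lee_fin -prob_exp_indic//.
  apply: (@le_trans _ _ (Pr [set w | (e' < `|Rm k w i j|)%R])).
    apply: le_measure; rewrite ?inE//.
      by apply: measurable_gt_norm; case: (bR k i j).
    by move=> w /=; exact: le_lt_trans.
  have /(_ (i, j)) : forall (p : 'I_m * 'I_n),
      (Pr [set w | (e' < `|Rm k w p.1 p.2|)%R] <= e'%:E)%E by near: k.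
  exact.
rewrite !sumr_const !card_ord -mulrnA mulnC -splitr -mulr_natr.
rewrite -mulrA ler_piMr ?(ltW e0)// mulrC ler_pdivrMr// mul1r ler_nat leqW//.
Unshelve. all: by end_near.
Qed.

End perturbed_levy.

(** * Fitted ranks *)

Section fitted_ranks.
Context {R : realType} {d q : nat}.
Variable phi : R -> 'cV[R]_q.
Hypothesis Hphi : admissible_phi phi.
Context {d0 d1 : measure_display} {Om : measurableType d0} {T : measurableType d1}.
Variables (Pr : probability Om R) (W : nat -> Om -> T) (P : probability T R).
Hypothesis iidW : iid_sample Pr W P.
Variable pi : T -> R * d.-tuple R.
Hypothesis mpi : measurable_fun setT pi.
Hypothesis piW : forall i w, unitI R (pi (W i w)).1 /\ zcube (pi (W i w)).2.
Variable kz : R.-pker d.-tuple R ~> R.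
Hypothesis kz01 : forall z, zcube z -> kz z (unitI R) = 1%E.
Hypothesis kzcont : forall z, zcube z -> continuous (fun t => condF kz t z).
Variable Fh : forall n, n.-tuple (R * d.-tuple R) -> d.-tuple R -> R -> R.
Hypothesis HFh : estimator Fh.

Definition true_rank (p : R * d.-tuple R) : R := condF kz p.1 p.2.

Lemma measurable_true_rank : measurable_fun setT true_rank.
Proof.
have mh : measurable_fun setT (fun p : R * d.-tuple R => (p.2, p.1)).
  exact: measurable_fun_pair.
exact: (measurableT_comp (measurable_condF kz) mh).
Qed.

Definition cube_samples n : set (n.-tuple (R * d.-tuple R)) :=
  [set s | forall i, unitI R (tnth s i).1 /\ zcube (tnth s i).2].

Lemma measurable_zcube : measurable (@zcube R d).
Proof.
rewrite (_ : @zcube R d = \bigcap_(j in [set: 'I_d]) ((@tnth _ R ^~ j) @^-1` unitI R)).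
  apply: fin_bigcap_measurable => [|j _]; first exact: finite_finset.
  by rewrite -[X in measurable X]setTI; exact: measurable_tnth.
by apply/seteqP; split => z /= zc j; [move=> _|]; exact: zc.
Qed.

Lemma measurable_cube_samples n : measurable (@cube_samples n).
Proof.
rewrite rectangles_gen; apply: sub_gen_smallest.
exists (fun=> unitI R `*` @zcube R d) => // i.
by apply: measurableX => //; exact: measurable_zcube.
Qed.

Definition sample_of n w : n.-tuple (R * d.-tuple R) := [tuple pi (W i w) | i < n].

Lemma sample_of_cube n w : cube_samples (sample_of n w).
Proof. by move=> i; rewrite tnth_mktuple; exact: piW. Qed.

Lemma measurable_sample_of n : measurable_fun setT (@sample_of n).
Proof. exact: (measurable_map_tuple iidW). Qed.

(** Set to zero off the samples of the cube, because measurability of the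
    estimator is only assumed there. *)
Definition fitted_rank n (i : 'I_n) : n.-tuple (R * d.-tuple R) -> R :=
  (fun s => Fh s (tnth s i).2 (tnth s i).1) \_ (@cube_samples n).

Lemma fitted_rankE n (i : 'I_n) w :
  fitted_rank i (sample_of n w) = Fh (sample_of n w) (pi (W i w)).2 (pi (W i w)).1.
Proof.
by rewrite /fitted_rank patchE mem_set ?tnth_mktuple//; exact: sample_of_cube.
Qed.

Lemma measurable_fitted_rank n (i : 'I_n) : measurable_fun setT (fitted_rank i).
Proof.
have [H _] := measurable_restrictT
  (fun s : n.-tuple (R * d.-tuple R) => Fh s (tnth s i).2 (tnth s i).1)
  (@measurable_cube_samples n).
by apply: H; case: HFh => _ /(_ n i).
Qed.

Definition rank_error k n (i : 'I_n) (s : n.-tuple (R * d.-tuple R)) : R :=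
  score phi k (fitted_rank i s) - score phi k (true_rank (tnth s i)).

Lemma bmeas_score_true_rank k n (i : 'I_n) :
  bmeas (fun s : n.-tuple (R * d.-tuple R) => score phi k (true_rank (tnth s i))).
Proof.
apply: (bmeas_comp (score_bmeas Hphi k)).
by apply: measurableT_comp measurable_true_rank _; exact: measurable_tnth.
Qed.

Lemma bmeas_score_fitted_rank k n (i : 'I_n) :
  bmeas (fun s => score phi k (fitted_rank i s)).
Proof. exact: (bmeas_comp (score_bmeas Hphi k) (measurable_fitted_rank i)). Qed.

Lemma bmeas_rank_error k n (i : 'I_n) : bmeas (rank_error k i).
Proof. exact: bmeasB (bmeas_score_fitted_rank k i) (bmeas_score_true_rank k i). Qed.

Let hat_error n w t z : R := condF kz t z - Fh (sample_of n w) z t.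

(** The estimator is evaluated on a sample of the cube, where it is a monotone map
    of [0, 1]. *)
Lemma rank_error_normT K N n w :
  0 <= K -> (forall k u v, `|score phi k u - score phi k v| <= K * `|u - v|) ->
  (normT phi kz (hat_error n w) <= N%:E)%E ->
  forall k (i : 'I_n), `|rank_error k i (sample_of n w)| <= K * N.
Proof.
move=> K0 KP hN k i; rewrite /rank_error fitted_rankE tnth_mktuple.
have [t01 zc] := piW i w.
have [/(_ n _ _ (sample_of_cube (n := n) w) zc)[F01 _ Fhomo _ _] _] := HFh.
by apply: (score_error Hphi K0 KP zc (kz01 zc) (kzcont zc) F01 Fhomo _ hN).
Qed.

Variable g : nat -> R.
Hypothesis OPg : bigO_P Pr (fun n w => normT phi kz (hat_error n w)) g.

(** The boundedness in probability of the sup norm in terms of the rank errors.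
    The exceptional set need not be measurable, hence the outer measure. *)
Lemma rank_error_bigO (e : R) : 0 < e -> exists2 M : R, 0 < M &
  forall n, (0 < n)%N -> exists2 E : set Om, (Pr^*%mu E < e%:E)%E &
    forall w, ~ E w -> forall k (i : 'I_n), `|rank_error k i (sample_of n w)| <= M * `|g n|.
Proof.
move=> e0; have [g0 /(_ e e0)[M M0 HM]] := OPg.
have [K K0 KP] := score_lipschitz Hphi.
exists ((K + 1) * M) => [|n n0]; first by rewrite mulr_gt0// ltr_wpDl.
exists [set w | (M%:E < `|normT phi kz (hat_error n w) * ((g n)^-1)%:E|)%E].
  by apply: le_lt_trans HM; apply: ereal_sup_ubound; exists n.
move=> w /= /negP; rewrite -leNgt => nM k i.
have gn0 := g0 n n0; have gn : 0 < `|g n| by rewrite normr_gt0.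
have nN : (normT phi kz (hat_error n w) <= (M * `|g n|)%:E)%E.
  move: nM; case: (normT _ _ _) => [r| |] //=.
  - rewrite !lee_fin normrM normfV ler_pdivrMr//.
    exact: le_trans (ler_norm r).
  - by rewrite abseM/= gt0_mulye ?lte_fin ?normr_gt0 ?invr_eq0.
  - by move=> _; exact: leNye.
rewrite (le_trans (rank_error_normT K0 KP nN k i))// -mulrA ler_wpM2r ?lerDl//.
by rewrite mulr_ge0// ltW.
Qed.

Hypothesis g0 : g n @[n --> \oo] --> 0.

(** Off a set of small probability the errors are of order g n, and they are
    bounded everywhere; the exceptional set may be enlarged to the measurable set
    where this error exceeds its bound. *)
Lemma rank_error_L2 (e : R) : 0 < e -> \forall n \near \oo,
  forall k (i : 'I_n), \int[Pr]_w (rank_error k i (sample_of n w) ^+ 2) <= e.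
Proof.
move=> e0; have [B B0 BP] := score_bounded Hphi.
pose C := (2 * B) ^+ 2; have C0 : 0 <= C by exact: sqr_ge0.
pose e1 := e / 2 / (C + 1).
have C1 : 0 < C + 1 by rewrite ltr_wpDl.
have e2 : 0 < e / 2 by rewrite divr_gt0.
have e10 : 0 < e1 by rewrite divr_gt0.
have [M M0 HM] := rank_error_bigO e10.
pose r := Num.min 1 (e / 2) / M.
have r0 : 0 < r by rewrite divr_gt0// lt_min ltr01.
move/cvgrPdist_le : g0 => /(_ r r0) gr.
near=> n => k i.
have n0 : (0 < n)%N by near: n; exact: nbhs_infty_gt.
have [E PE HE] := HM n n0.
(* eta is the bound on the errors off the exceptional set, and e1 the
   probability of that set. *)
pose eta := M * `|g n|.
have eta0 : 0 <= eta by rewrite mulr_ge0// ltW.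
have eta1 : eta <= Num.min 1 (e / 2).
  have : `|0 - g n| <= r by near: n.
  by rewrite sub0r normrN /r ler_pdivlMr// mulrC.
have eta2 : eta ^+ 2 <= e / 2.
  move: eta1; rewrite le_min => /andP[h1 h2]; rewrite expr2.
  by rewrite (le_trans _ h2)// ler_piMl.
have bD := bmeas_comp (bmeas_rank_error k i) (measurable_sample_of (n := n)).
have [mD _] := bD.
set A := [set w | (eta < `|rank_error k i (sample_of n w)|)%R].
have mA : measurable A by exact: measurable_gt_norm.
have PA : \int[Pr]_w \1_A w <= e1.
  rewrite -lee_fin -prob_exp_indic// -measurable_mu_extE//.
  apply/ltW/(le_lt_trans _ PE); apply: le_mu_ext => w.
  by rewrite /A/= => Dw; apply: contrapT => /HE /(_ k i); rewrite leNgt Dw.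
have bA := bmeas_indic (R := R) mA.
apply: (@le_trans _ _ (\int[Pr]_w (eta ^+ 2 + C * \1_A w))).
  apply: exp_le; [exact: bmeasX|by apply: bmeasD; [exact: bmeas_cst|exact: bmeasZ]|].
  move=> w; rewrite -real_normK ?num_real//; have [wA|wA] := pselect (A w).
    rewrite indicE mem_set// mulr1 -[leLHS]add0r lerD ?sqr_ge0//.
    rewrite lerXn2r ?nnegrE//; first by rewrite mulr_ge0.
    by rewrite (le_trans (ler_normB _ _))// mulr_natl mulr2n lerD.
  rewrite indicE memNset// mulr0 addr0 lerXn2r ?nnegrE//.
  by rewrite leNgt; exact/negP.
rewrite expD ?exp_cst//; [|exact: bmeas_cst|exact: bmeasZ].
rewrite expZ// [leRHS]splitr lerD//.
apply: (@le_trans _ _ ((C + 1) * e1)); last by rewrite /e1 mulrC divfK// gt_eqF.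
apply: ler_pM => //; last by rewrite lerDl.
by rewrite -[leLHS](exp_cst Pr); apply: exp_le; [exact: bmeas_cst| |].
Unshelve. all: by end_near.
Qed.

End fitted_ranks.

(** * Negligible remainders *)

Lemma cond_indepC d0 d1 d2 d3 (T : measurableType d0) (T1 : measurableType d1)
    (T2 : measurableType d2) (T3 : measurableType d3) (R : realType)
    (P : probability T R) (X : T -> T1) (Y : T -> T2) (Z : T -> T3) :
  cond_indep P X Y Z -> cond_indep P Y X Z.
Proof.
move=> [kX [kY [cX cY ci]]]; exists kY, kX; split => // A B C mA mB mC.
rewrite [X in P (X `&` _)]setIC ci//.
by apply: eq_integral => w _; rewrite muleC.
Qed.

Section negligible_remainders.
Context {R : realType} {d0 d1 : measure_display} {Om : measurableType d0}.
Context {T : measurableType d1}.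
Variables (Pr : probability Om R) (W : nat -> Om -> T) (P : probability T R).
Hypothesis iidW : iid_sample Pr W P.

Lemma sqr_normalized n (x : R) : ((Num.sqrt n%:R)^-1 * x) ^+ 2 = n%:R^-1 * x ^+ 2.
Proof. by rewrite exprMn exprVn sqr_sqrtr. Qed.

Section one_sided.
Context {d2 : measure_display} {T' : measurableType d2}.
Variables (u : T -> R) (pi : T -> T') (nu : probability R R).
Hypotheses (mu : measurable_fun setT u) (mpi : measurable_fun setT pi).
Hypothesis ind : forall A B, measurable A -> measurable B ->
  P (u @^-1` A `&` pi @^-1` B) = (nu A * P (pi @^-1` B))%E.
Variables (psi : R -> R) (B : R) (D : forall n, 'I_n -> n.-tuple T' -> R).
Hypotheses (bpsi : bmeas psi) (psi0 : \int[nu]_x psi x = 0).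
Hypothesis psiB : forall x, `|psi x| <= B.
Hypothesis bD : forall n (i : 'I_n), bmeas (D i).

Let V n w : n.-tuple T' := [tuple pi (W i w) | i < n].

Let mV n : measurable_fun setT (V n).
Proof. exact: (measurable_map_tuple iidW). Qed.

Let bterm n (i : 'I_n) : bmeas (fun w => psi (u (W i w)) * D i (V n w)).
Proof.
apply: bmeasM; last exact: (bmeas_comp (bD i) (@mV n)).
apply: (bmeas_comp bpsi); apply: measurableT_comp => //.
by case: iidW.
Qed.

Lemma bmeas_centred_sum n : bmeas (fun w =>
  (Num.sqrt n%:R)^-1 * \sum_(i < n) psi (u (W i w)) * D i (V n w)).
Proof. by apply: bmeasZ; apply: bmeas_sum. Qed.

(** By [exp_sqr_centred_sum] the second moment is the mean of the n second moments
    of the terms. *)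
Lemma centred_sum_L2_le n (e : R) : 0 <= e ->
  (forall i : 'I_n, \int[Pr]_w (D i (V n w) ^+ 2) <= e) ->
  \int[Pr]_w (((Num.sqrt n%:R)^-1 * \sum_(i < n) psi (u (W i w)) * D i (V n w)) ^+ 2)
  <= B ^+ 2 * e.
Proof.
move=> e0 De; under eq_Rintegral do rewrite sqr_normalized.
rewrite expZ; last by apply: bmeasX; apply: bmeas_sum.
rewrite (exp_sqr_centred_sum iidW mu mpi ind bpsi psi0 (@bD n)).
have [->|n0] := eqVneq n 0%N.
  by rewrite big_ord0 mulr0 mulr_ge0// sqr_ge0.
rewrite ler_pdivrMl ?ltr0n ?lt0n//.
apply: (@le_trans _ _ (\sum_(i < n) B ^+ 2 * e)); last first.
  by rewrite sumr_const card_ord mulr_natl.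
apply: ler_sum => i _.
have bDV := bmeas_comp (bD i) (@mV n).
rewrite (le_trans _ (ler_wpM2l (sqr_ge0 B) (De i)))// -expZ; last exact: bmeasX.
apply: exp_le => [||w].
- exact: (bmeasX 2 (bterm i)).
- exact/bmeasZ/bmeasX.
rewrite exprMn ler_wpM2r ?sqr_ge0// -real_normK ?num_real//.
by rewrite lerXn2r ?nnegrE// (le_trans (normr_ge0 (psi 0))).
Qed.

Lemma centred_sum_cvg0 :
  (forall e : R, 0 < e -> \forall n \near \oo, forall i : 'I_n,
     \int[Pr]_w (D i (V n w) ^+ 2) <= e) ->
  cvg_prob0 Pr (fun n w =>
    (Num.sqrt n%:R)^-1 * \sum_(i < n) psi (u (W i w)) * D i (V n w)).
Proof.
move=> D0; apply: cvg_prob0_L2 => [n|]; first exact: bmeas_centred_sum.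
apply/cvgrPdist_le => e e0.
have B1 : 0 < B ^+ 2 + 1 by rewrite ltr_wpDl// sqr_ge0.
have e1 : 0 < e / (B ^+ 2 + 1) by rewrite divr_gt0.
have {}D0 := D0 _ e1; near=> n.
have := @centred_sum_L2_le n _ (ltW e1).
rewrite sub0r normrN ger0_norm; last first.
  rewrite -[leLHS](exp_cst Pr); apply: exp_le; first exact: bmeas_cst.
    by apply: bmeasX; exact: bmeas_centred_sum.
  by move=> w; exact: sqr_ge0.
move=> h; apply: (le_trans (h _)); first by near: n.
apply: (@le_trans _ _ ((B ^+ 2 + 1) * (e / (B ^+ 2 + 1)))).
  by rewrite ler_wpM2r ?(ltW e1)// lerDl.
by rewrite mulrC divfK// gt_eqF.
Unshelve. all: by end_near.
Qed.

End one_sided.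

(** Outside two small sets each of the n products is at most M1 M2 g h in absolute
    value, and n / sqrt n = sqrt n. *)
Lemma product_errors_cvg0 (D1 D2 : forall n, 'I_n -> Om -> R) (g h : nat -> R) :
  (forall n (i : 'I_n), bmeas (D1 n i)) -> (forall n (i : 'I_n), bmeas (D2 n i)) ->
  (forall e : R, 0 < e -> exists2 M : R, 0 < M &
    forall n, (0 < n)%N -> exists2 E : set Om, (Pr^*%mu E < e%:E)%E &
      forall w, ~ E w -> forall i : 'I_n, `|D1 n i w| <= M * `|g n|) ->
  (forall e : R, 0 < e -> exists2 M : R, 0 < M &
    forall n, (0 < n)%N -> exists2 E : set Om, (Pr^*%mu E < e%:E)%E &
      forall w, ~ E w -> forall i : 'I_n, `|D2 n i w| <= M * `|h n|) ->
  Num.sqrt n%:R * g n * h n @[n --> \oo] --> 0 ->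
  cvg_prob0 Pr (fun n w =>
    (Num.sqrt n%:R)^-1 * \sum_(i < n) D1 n i w * D2 n i w).
Proof.
move=> b1 b2 H1 H2 gh e e0; have e2 : 0 < e / 2 by rewrite divr_gt0.
have [M1 M10 {}H1] := H1 _ e2; have [M2 M20 {}H2] := H2 _ e2.
have r0 : 0 < e / (M1 * M2) by rewrite divr_gt0// mulr_gt0.
move/cvgrPdist_le : gh => /(_ _ r0) gh; near=> n.
have n0 : (0 < n)%N by near: n; exact: nbhs_infty_gt.
have [E1 PE1 {}H1] := H1 n n0; have [E2 PE2 {}H2] := H2 n n0.
have ghn : `|0 - Num.sqrt n%:R * g n * h n| <= e / (M1 * M2) by near: n.
have sn : 0 < Num.sqrt n%:R :> R by rewrite sqrtr_gt0 ltr0n.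
have mA : measurable [set w |
    (e < `|(Num.sqrt n%:R)^-1 * \sum_(i < n) D1 n i w * D2 n i w|)%R].
  apply: measurable_gt_norm.
  suff [] : bmeas (fun w => (Num.sqrt n%:R)^-1 * \sum_(i < n) D1 n i w * D2 n i w) by [].
  by apply: bmeasZ; apply: bmeas_sum => i; exact: bmeasM.
rewrite -measurable_mu_extE//.
apply: (@le_trans _ _ ((Pr^*)%mu (E1 `|` E2))).
  apply: le_mu_ext => w /=; apply: contraPP => /not_orP[nE1 nE2]; apply/negP; rewrite -leNgt.
  have D12 (i : 'I_n) : `|D1 n i w * D2 n i w| <= (M1 * M2) * (`|g n| * `|h n|).
    rewrite normrM (le_trans (ler_pM _ _ (H1 w nE1 i) (H2 w nE2 i)))//.
    by rewrite mulrACA.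
  rewrite normrM ger0_norm ?invr_ge0 ?(ltW sn)// ler_pdivrMl//.
  apply: (@le_trans _ _ (\sum_(i < n) M1 * M2 * (`|g n| * `|h n|))).
    by rewrite (le_trans (ler_norm_sum _ _ _))// ler_sum.
  have nE : n%:R = Num.sqrt n%:R * Num.sqrt n%:R :> R by rewrite -expr2 sqr_sqrtr.
  rewrite sumr_const card_ord -[leLHS]mulr_natl [X in X * _ <= _]nE -[leLHS]mulrA ler_pM2l//.
  move: ghn; rewrite sub0r normrN !normrM ler_pdivlMr ?mulr_gt0// (ger0_norm (ltW sn)).
  by apply: le_trans; rewrite le_eqVlt; apply/orP; left; apply/eqP; ring.
have := outer_measureU2 (Pr^*)%mu E1 E2.
move=> /le_trans; apply.
by rewrite [in leRHS](splitr e) EFinD; apply: leeD; exact: ltW.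
Unshelve. all: by end_near.
Qed.

End negligible_remainders.

(** * Moments of products of scores *)

Section rank_product_moments.
Context {R : realType} {d0 d1 d2 : measure_display} {T : measurableType d0}.
Context {T1 : measurableType d1} {T2 : measurableType d2}.
Variables (P : probability T R) (U V : T -> R) (piX : T -> T1) (piY : T -> T2).
Hypotheses (mU : measurable_fun setT U) (mpiX : measurable_fun setT piX).
Hypotheses (mpiY : measurable_fun setT piY).
Variable r : T2 -> R.
Hypotheses (mr : measurable_fun setT r) (VE : forall w, V w = r (piY w)).
Hypothesis indU : forall A B, measurable A -> measurable B ->
  P (U @^-1` A `&` piY @^-1` B) = (unif01 A * P (piY @^-1` B))%E.
Hypothesis indV : forall A B, measurable A -> measurable B ->
  P (V @^-1` A `&` piX @^-1` B) = (unif01 A * P (piX @^-1` B))%E.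

(** U is uniform and independent of V, which is a function r of piY; V is uniform
    in its turn. *)
Lemma exp_rank_product (f g : R -> R) : bmeas f -> bmeas g ->
  \int[P]_w (f (U w) * g (V w)) = \int[unif01]_u f u * \int[unif01]_u g u.
Proof.
move=> bf bg.
have GI d3 (T3 : measurableType d3) : setI_closed (@measurable _ T3).
  by move=> *; exact: measurableI.
have bgr : bmeas (fun p => g (r p)) by exact: (bmeas_comp bg mr).
have mV : measurable_fun setT V.
  by rewrite (_ : V = r \o piY); [exact: measurableT_comp|apply/funext => w /=; rewrite VE].
under eq_Rintegral do rewrite VE.
rewrite (exp_indepE mU mpiY (GI _ T2) (sigma_algebra_self T2) measurableT indU bf bgr).
congr (_ * _).
have := exp_indepE mV mpiX (GI _ T1) (sigma_algebra_self T1) measurableT indV bg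
  (bmeas_cst 1).
rewrite exp_cst mulr1 => <-.
by apply: eq_Rintegral => w _; rewrite mulr1 VE.
Qed.

Context {q : nat}.
Variable phi : R -> 'cV[R]_q.
Hypothesis Hphi : admissible_phi phi.

(** The linear functional A of the matrix of products of scores. *)
Definition score_form (A : 'M[R]_q) (w : T) : R :=
  \sum_k \sum_l A k l * (score phi k (U w) * score phi l (V w)).

Let mV : measurable_fun setT V.
Proof.
by rewrite (_ : V = r \o piY); [exact: measurableT_comp|apply/funext => w /=; rewrite VE].
Qed.

Let bab k l : bmeas (fun w => score phi k (U w) * score phi l (V w)).
Proof.
by apply: bmeasM; [exact: (bmeas_comp (score_bmeas Hphi k))
                  |exact: (bmeas_comp (score_bmeas Hphi l))].
Qed.

Let bAab (A : 'M[R]_q) k l : bmeas (fun w => A k l * (score phi k (U w) * score phi l (V w))).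
Proof. exact: bmeasZ. Qed.

Lemma bmeas_score_form A : bmeas (score_form A).
Proof. by apply: bmeas_sum => k; apply: bmeas_sum => l; exact: bAab. Qed.

Lemma exp_score_form A : \int[P]_w score_form A w = 0.
Proof.
rewrite exp_sum => [|k]; last by apply: bmeas_sum => l; exact: bAab.
rewrite big1// => k _; rewrite exp_sum => [|l]; last exact: bAab.
rewrite big1// => l _; rewrite expZ//.
by rewrite exp_rank_product ?exp_score0 ?mul0r ?mulr0//; exact: score_bmeas.
Qed.

(** Expanding the square, each mean of four scores splits into a product of two
    entries of Sigma by [exp_rank_product]. *)
Lemma exp_score_form_sqr (Bs : seq 'M[R]_q) A :
  (forall k l s t, \sum_(B <- Bs) B k l * B s t = tensor_cov (gramSigma phi) k l s t) ->
  \int[P]_w (score_form A w ^+ 2) = gauss_var Bs A.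
Proof.
move=> BsE.
have bb (k l s t : 'I_q) : bmeas (fun w => (A k l * A s t) *
    (score phi k (U w) * score phi l (V w) * (score phi s (U w) * score phi t (V w)))).
  by apply: bmeasZ; exact: bmeasM.
transitivity (\sum_k \sum_l \sum_s \sum_t
    (A k l * A s t) * tensor_cov (gramSigma phi) k l s t).
  transitivity (\int[P]_w (\sum_k \sum_l \sum_s \sum_t (A k l * A s t) *
    (score phi k (U w) * score phi l (V w) * (score phi s (U w) * score phi t (V w))))).
    apply: eq_Rintegral => w _; rewrite expr2 /score_form mulr_suml.
    apply: eq_bigr => k _; rewrite mulr_suml; apply: eq_bigr => l _.
    rewrite mulr_sumr; apply: eq_bigr => s _; rewrite mulr_sumr; apply: eq_bigr => t _.
    by ring.
  rewrite exp_sum => [|k]; last first.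
    by apply: bmeas_sum => l; apply: bmeas_sum => s; apply: bmeas_sum => t; exact: bb.
  apply: eq_bigr => k _; rewrite exp_sum => [|l]; last first.
    by apply: bmeas_sum => s; apply: bmeas_sum => t; exact: bb.
  apply: eq_bigr => l _; rewrite exp_sum => [|s]; last first.
    by apply: bmeas_sum => t; exact: bb.
  apply: eq_bigr => s _; rewrite exp_sum => [|t]; last exact: bb.
  apply: eq_bigr => t _; rewrite expZ; last exact: bmeasM.
  congr (_ * _); rewrite /tensor_cov -!(exp_scoreM Hphi).
  rewrite -exp_rank_product; last 2 first.
  - by apply: bmeasM; exact: score_bmeas.
  - by apply: bmeasM; exact: score_bmeas.
  by apply: eq_Rintegral => w _; ring.
under eq_bigr => k _ do under eq_bigr => l _ do under eq_bigr => s _ do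
  under eq_bigr => t _ do rewrite -BsE mulr_sumr.
under eq_bigr => k _ do under eq_bigr => l _ do under eq_bigr => s _ do
  rewrite exchange_big/=.
under eq_bigr => k _ do under eq_bigr => l _ do rewrite exchange_big/=.
under eq_bigr => k _ do rewrite exchange_big/=.
rewrite exchange_big/=; apply: eq_bigr => B _.
rewrite expr2 /frob mulr_suml; apply: eq_bigr => k _.
rewrite mulr_suml; apply: eq_bigr => l _.
rewrite mulr_sumr; apply: eq_bigr => s _; rewrite mulr_sumr; apply: eq_bigr => t _.
by ring.
Qed.

End rank_product_moments.

(** The matrices B are the tensor products of the columns of a factor of S. *)
Lemma tensor_factor (R : realType) q (S : 'M[R]_q) : psd S ->
  exists Bs : seq 'M[R]_q,
    forall k l s t, \sum_(B <- Bs) B k l * B s t = tensor_cov S k l s t.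
Proof.
move=> /cholesky[A SE].
exists [seq (\matrix_(k, l) (A k p.1 * A l p.2) : 'M[R]_q) | p : 'I_q * 'I_q].
move=> k l s t; rewrite big_map big_enum/=.
rewrite /tensor_cov SE !mxE big_distrlr/= pair_big/=.
apply: eq_bigr => p _; rewrite !mxE; ring.
Qed.

(** * The limit law of the rank correlation *)

Section rank_correlation_clt.
Context {R : realType} {d q : nat}.
Variable phi : R -> 'cV[R]_q.
Hypothesis Hphi : admissible_phi phi.
Variable P : law R d.
Hypotheses (Pcube : P (@cube R d) = 1%E).
Hypothesis ci : cond_indep P (fun w => w.1.1) (fun w => w.1.2) (fun w => w.2).
Variables kX kY : R.-pker d.-tuple R ~> R.
Hypothesis HkX : continuous_cond_law P (fun w => w.1.1) kX.
Hypothesis HkY : continuous_cond_law P (fun w => w.1.2) kY.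
Context {d0 : measure_display} {Om : measurableType d0}.
Variables (Pr : probability Om R) (W : nat -> Om -> obs R d).
Hypothesis Wcube : forall i w, cube (W i w).
Hypothesis iidW : iid_sample Pr W P.
Variables FhX FhY : forall n, n.-tuple (R * d.-tuple R) -> d.-tuple R -> R -> R.
Hypotheses (HFhX : estimator FhX) (HFhY : estimator FhY).
Variables g h : nat -> R.
Hypotheses (g0 : g n @[n --> \oo] --> 0) (h0 : h n @[n --> \oo] --> 0).
Hypothesis OPg : bigO_P Pr (fun n w => normT phi kX
  (fun t z => condF kX t z - FhX (sampleXZ W n w) z t)) g.
Hypothesis OPh : bigO_P Pr (fun n w => normT phi kY
  (fun t z => condF kY t z - FhY (sampleYZ W n w) z t)) h.
Hypothesis gh0 : Num.sqrt n%:R * g n * h n @[n --> \oo] --> 0.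

Let piX (o : obs R d) : R * d.-tuple R := (o.1.1, o.2).
Let piY (o : obs R d) : R * d.-tuple R := (o.1.2, o.2).

Let mX : measurable_fun setT (fun o : obs R d => o.1.1).
Proof. exact: measurableT_comp. Qed.

Let mY : measurable_fun setT (fun o : obs R d => o.1.2).
Proof. exact: measurableT_comp. Qed.

Let mZ : measurable_fun setT (fun o : obs R d => o.2).
Proof. exact: measurable_snd. Qed.

Let mpiX : measurable_fun setT piX. Proof. exact: measurable_fun_pair. Qed.
Let mpiY : measurable_fun setT piY. Proof. exact: measurable_fun_pair. Qed.

Let piXW i w : unitI R (piX (W i w)).1 /\ zcube (piX (W i w)).2.
Proof. by case: (Wcube i w). Qed.

Let piYW i w : unitI R (piY (W i w)).1 /\ zcube (piY (W i w)).2.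
Proof. by case: (Wcube i w). Qed.

Let rX (o : obs R d) : R := condF kX o.1.1 o.2.
Let rY (o : obs R d) : R := condF kY o.1.2 o.2.

Let mrX : measurable_fun setT rX.
Proof. exact: (measurableT_comp (measurable_true_rank kX) mpiX). Qed.

Let mrY : measurable_fun setT rY.
Proof. exact: (measurableT_comp (measurable_true_rank kY) mpiY). Qed.

Let Pzcube : P ((fun o : obs R d => o.2) @^-1` @zcube R d) = 1%E.
Proof.
have mzc : measurable ((fun o : obs R d => o.2) @^-1` @zcube R d).
  by rewrite -[X in measurable X]setTI; apply: mZ => //; exact: measurable_zcube.
have mc : measurable (@cube R d).
  rewrite (_ : @cube R d = (fun o => o.1.1) @^-1` unitI R `&`
      ((fun o => o.1.2) @^-1` unitI R `&` (fun o : obs R d => o.2) @^-1` @zcube R d)).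
    apply: measurableI; first exact: (measurable_preim mX).
    by apply: measurableI => //; rewrite -[X in measurable X]setTI; exact: mY.
  by apply/seteqP; split => o /=; [move=> []|move=> [? []]].
apply/eqP; rewrite eq_le; apply/andP; split; first exact: (probability_le1 P).
rewrite -Pcube; apply: le_measure; rewrite ?inE//.
by move=> o [].
Qed.

Let indX A B : measurable A -> measurable B ->
  P (rX @^-1` A `&` piY @^-1` B) = (unif01 A * P (piY @^-1` B))%E.
Proof.
have [ck k01 kc] := HkX.
exact: (rank_uniform_indep mX mY mZ ci ck (measurable_zcube (R := R) (d := d)) Pzcube k01 kc).
Qed.

Let indY A B : measurable A -> measurable B ->
  P (rY @^-1` A `&` piX @^-1` B) = (unif01 A * P (piX @^-1` B))%E.
Proof.
have [ck k01 kc] := HkY.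
exact: (rank_uniform_indep mY mX mZ (cond_indepC ci) ck
  (measurable_zcube (R := R) (d := d)) Pzcube k01 kc).
Qed.

Let aX k n (i : 'I_n) (w : Om) : R := score phi k (rX (W i w)).
Let bY l n (i : 'I_n) (w : Om) : R := score phi l (rY (W i w)).
Let eX k n (i : 'I_n) (w : Om) : R := rank_error phi kX FhX k i (sample_of W piX n w).
Let eY l n (i : 'I_n) (w : Om) : R := rank_error phi kY FhY l i (sample_of W piY n w).

Let mW i : measurable_fun setT (W i). Proof. by case: iidW. Qed.

Let baX k n (i : 'I_n) : bmeas (aX k i).
Proof. exact: (bmeas_comp (bmeas_comp (score_bmeas Hphi k) mrX) (mW i)). Qed.

Let bbY l n (i : 'I_n) : bmeas (bY l i).
Proof. exact: (bmeas_comp (bmeas_comp (score_bmeas Hphi l) mrY) (mW i)). Qed.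

Let beX k n (i : 'I_n) : bmeas (eX k i).
Proof.
exact: (bmeas_comp (bmeas_rank_error Hphi kX HFhX k i) (measurable_sample_of iidW mpiX (n := n))).
Qed.

Let beY l n (i : 'I_n) : bmeas (eY l i).
Proof.
exact: (bmeas_comp (bmeas_rank_error Hphi kY HFhY l i) (measurable_sample_of iidW mpiY (n := n))).
Qed.

Let normalized n (F : 'I_n -> Om -> R) (w : Om) : R :=
  (Num.sqrt n%:R)^-1 * \sum_(i < n) F i w.

Let oracle n (w : Om) : 'M[R]_q :=
  \matrix_(k, l) normalized (fun (i : 'I_n) w => aX k i w * bY l i w) w.

Let remainder n (w : Om) : 'M[R]_q := \matrix_(k, l)
  (normalized (fun (i : 'I_n) w => aX k i w * eY l i w) w +
   (normalized (fun (i : 'I_n) w => bY l i w * eX k i w) w +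
    normalized (fun (i : 'I_n) w => eX k i w * eY l i w) w)).

Let bnormalized n (F : 'I_n -> Om -> R) : (forall i, bmeas (F i)) -> bmeas (normalized F).
Proof. by move=> bF; apply: bmeasZ; apply: bmeas_sum. Qed.

Let decomposition n w k l :
  (Num.sqrt n%:R *: rho_hat W FhX FhY phi n w) k l = oracle n w k l + remainder n w k l.
Proof.
rewrite !mxE /normalized -!mulrDr summxE mulrA.
have -> : Num.sqrt n%:R * n%:R^-1 = (Num.sqrt n%:R)^-1 :> R.
  have [->|n0] := eqVneq n 0%N; first by rewrite sqrtr0 mul0r invr0.
  have s0 : Num.sqrt n%:R != 0 :> R by rewrite gt_eqF// sqrtr_gt0 ltr0n lt0n.
  have nE : n%:R = Num.sqrt n%:R * Num.sqrt n%:R :> R by rewrite -expr2 sqr_sqrtr.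
  by rewrite [X in X^-1]nE invfM mulrA divff// mul1r.
congr (_ * _); rewrite -!big_split/=; apply: eq_bigr => i _.
rewrite !mxE big_ord1 !mxE.
have itv m (u : R) : unitI R u -> phi u m 0 = score phi m u.
  by rewrite /= in_itv/= => u01; rewrite score_id.
have [xi zi] := piXW i w; have [yi _] := piYW i w.
have [HX _] := HFhX; have [HY _] := HFhY.
have [FX _ _ _ _] := HX n _ _ (sample_of_cube piXW (n := n) w) zi.
have [FY _ _ _ _] := HY n _ _ (sample_of_cube piYW (n := n) w) zi.
rewrite (itv k _ (FX _ xi)) (itv l _ (FY _ yi)).
rewrite /eX /eY /rank_error (fitted_rankE piXW) (fitted_rankE piYW) !tnth_mktuple.
rewrite /aX /bY /rX /rY /true_rank /=.
by ring.
Qed.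

(** The expansion of the statistic around the true ranks, combined with the
    estimates for its four parts. *)
Lemma rank_correlation_clt (Bs : seq 'M[R]_q) :
  (forall k l s t, \sum_(B <- Bs) B k l * B s t = tensor_cov (gramSigma phi) k l s t) ->
  cvg_in_law Pr (fun n w => Num.sqrt n%:R *: rho_hat W FhX FhY phi n w) (gauss_law Bs).
Proof.
move=> BsE; have [B B0 BP] := score_bounded Hphi.
have bor n k l : bmeas (fun w => oracle n w k l).
  under eq_fun do rewrite mxE.
  by apply: bnormalized => i; exact: bmeasM.
have bre n k l : bmeas (fun w => remainder n w k l).
  under eq_fun do rewrite mxE.
  apply: bmeasD; first by apply: bnormalized => i; exact: bmeasM.
  by apply: bmeasD; apply: bnormalized => i; exact: bmeasM.
apply: (perturbed_levy decomposition bor bre (V := B ^+ 2 * B ^+ 2)).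
- move=> n k l; under eq_Rintegral do rewrite mxE.
  pose D m (i : 'I_m) (s : m.-tuple (R * d.-tuple R)) := score phi l (true_rank kY (tnth s i)).
  have bD m (i : 'I_m) : bmeas (D m i) by exact: bmeas_score_true_rank.
  have DB (i : 'I_n) : \int[Pr]_w (D n i [tuple piY (W j w) | j < n] ^+ 2) <= B ^+ 2.
    rewrite -[leRHS](exp_cst Pr); apply: exp_le => [||w].
    - by apply/bmeasX/(bmeas_comp (bD n i)); exact: (measurable_sample_of iidW).
    - exact: bmeas_cst.
    - by rewrite -real_normK ?num_real// lerXn2r ?nnegrE// BP.
  have := centred_sum_L2_le iidW mrX mpiY indX (score_bmeas Hphi k) (exp_score0 Hphi k)
    (BP k) bD (sqr_ge0 B) DB.
  apply: le_trans; rewrite le_eqVlt; apply/orP; left; apply/eqP.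
  apply: eq_Rintegral => w _; congr (_ ^+ 2); rewrite /normalized; congr (_ * _).
  by apply: eq_bigr => i _; rewrite /D tnth_mktuple.
- move=> k l; under eq_fun do under eq_fun do rewrite mxE.
  have eY0 (e : R) : 0 < e -> \forall n \near \oo, forall i : 'I_n,
      \int[Pr]_w (rank_error phi kY FhY l i (sample_of W piY n w) ^+ 2) <= e.
    move=> e0; have [_ k01 kc] := HkY.
    have H := rank_error_L2 Hphi iidW mpiY piYW k01 kc HFhY OPh h0 e0.
    by apply: filterS H => n Hn i; exact: Hn.
  have eX0 (e : R) : 0 < e -> \forall n \near \oo, forall i : 'I_n,
      \int[Pr]_w (rank_error phi kX FhX k i (sample_of W piX n w) ^+ 2) <= e.
    move=> e0; have [_ k01 kc] := HkX.
    have H := rank_error_L2 Hphi iidW mpiX piXW k01 kc HFhX OPg g0 e0.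
    by apply: filterS H => n Hn i; exact: Hn.
  apply: cvg_prob0D.
  + by move=> n; apply: bnormalized => i; exact: bmeasM.
  + by move=> n; apply: bmeasD; apply: bnormalized => i; exact: bmeasM.
  + exact: (centred_sum_cvg0 iidW mrX mpiY indX (score_bmeas Hphi k) (exp_score0 Hphi k)
      (BP k) (fun n i => bmeas_rank_error Hphi kY HFhY l i) eY0).
  apply: cvg_prob0D.
  + by move=> n; apply: bnormalized => i; exact: bmeasM.
  + by move=> n; apply: bnormalized => i; exact: bmeasM.
  + exact: (centred_sum_cvg0 iidW mrY mpiX indY (score_bmeas Hphi l) (exp_score0 Hphi l)
      (BP l) (fun n i => bmeas_rank_error Hphi kX HFhX k i) eX0).
  apply: (product_errors_cvg0 (@beX k) (@beY l) _ _ gh0) => e e0.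
  + have [_ k01 kc] := HkX.
    have [M M0 H] := rank_error_bigO Hphi piXW k01 kc HFhX OPg e0.
    exists M => // n n0; have [E PE HE] := H n n0; exists E => // w nE i.
    exact: HE.
  + have [_ k01 kc] := HkY.
    have [M M0 H] := rank_error_bigO Hphi piYW k01 kc HFhY OPh e0.
    exists M => // n n0; have [E PE HE] := H n n0; exists E => // w nE i.
    exact: HE.
move=> A c; rewrite exp_gauss_cos.
have mrY' : measurable_fun setT (fun p : R * d.-tuple R => true_rank kY p).
  exact: measurable_true_rank.
have rYE o : rY o = true_rank kY (piY o) by [].
have := clt_cos iidW (c := c) (bmeas_score_form mrX mpiY mrY' rYE Hphi A)
  (exp_score_form mrX mpiX mpiY mrY' rYE indX indY Hphi A)
  (exp_score_form_sqr mrX mpiX mpiY mrY' rYE indX indY Hphi A BsE).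
apply: cvg_trans; apply: near_eq_cvg; apply: nearW => n.
apply: eq_Rintegral => w _; congr (cos (_ + _)).
rewrite /frob /score_form exchange_big/= mulr_sumr; apply: eq_bigr => k _.
rewrite exchange_big/= mulr_sumr; apply: eq_bigr => l _.
by rewrite mxE -mulr_sumr mulrCA.
Qed.

End rank_correlation_clt.

Theorem theorem14 (R : realType) (d q : nat)
  (phi : R -> 'cV[R]_q) (Hphi : admissible_phi phi)
  (P0 : set (law R d)) (HP0 : P0 `<=` @calP R d)
  (kX kY : law R d -> R.-pker d.-tuple R ~> R)
  (HkX : forall P, P0 P -> continuous_cond_law P (fun w => w.1.1) (kX P))
  (HkY : forall P, P0 P -> continuous_cond_law P (fun w => w.1.2) (kY P))
  (disp : measure_display) (Om : measurableType disp)
  (Pr : law R d -> probability Om R) (W : nat -> Om -> obs R d)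
  (HWcube : forall i w, cube (W i w))
  (HW : forall P, P0 P -> iid_sample (Pr P) W P)
  (FhX FhY : forall n, n.-tuple (R * d.-tuple R) -> d.-tuple R -> R -> R)
  (HFhX : estimator FhX) (HFhY : estimator FhY)
  (Hrates : forall P, P0 P ->
    exists (g h : nat -> R) (xi xi' : R -> d.-tuple R -> R),
      [/\ (g n @[n --> \oo] --> 0) /\ (h n @[n --> \oo] --> 0),
          bigO_P (Pr P) (fun n w => normT phi (kX P)
            (fun t z => condF (kX P) t z - FhX n (sampleXZ W n w) z t)) g /\
          bigO_P (Pr P) (fun n w => normT phi (kY P)
            (fun t z => condF (kY P) t z - FhY n (sampleYZ W n w) z t)) h,
          bigO_P (Pr P) (fun n w => normTc phi (kX P)
            (fun t z => xi t z - FhX n (sampleXZ W n w) z t)) g /\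
          bigO_P (Pr P) (fun n w => normTc phi (kY P)
            (fun t z => xi' t z - FhY n (sampleYZ W n w) z t)) h &
          Num.sqrt n%:R * g n * h n @[n --> \oo] --> 0]) :
  exists2 mu : probability (Borel 'M[R]_q) R,
    centered_gaussian (tensor_cov (gramSigma phi)) mu &
    forall P, (P0 `&` @calH R d) P ->
      cvg_in_law (Pr P)
        (fun n w => Num.sqrt n%:R *: rho_hat W FhX FhY phi n w) mu.
Proof.
have [Bs BsE] := tensor_factor (gramSigma_psd Hphi).
exists (gauss_law Bs) => [|P [P0P [_ ci]]]; first exact: gauss_law_centered.
have [Pcube _] := HP0 P P0P.
have [g [h [xi [xi' [[g0 h0] [Og Oh] _ gh0]]]]] := Hrates P P0P.
exact: (rank_correlation_clt Hphi Pcube ci (HkX P P0P) (HkY P P0P) HWcube (HW P P0P)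
  HFhX HFhY g0 h0 Og Oh gh0 BsE).
Qed.
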